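(* There exists a triple $(M,G,\rho)$ consisting of a closed oriented smooth $3$-manifold $M$, a semi-simple Lie group $G$ with Lie algebra $\mathfrak g$, and a representation $\rho:\pi_1(M)\to G\xrightarrow{\mathrm{Ad}}\mathrm{Aut}(\mathfrak g)$ (a homomorphism $\pi_1(M)\to G$ followed by the adjoint representation) which is acyclic, i.e. $H^i(M;E_\rho)=0$ for $i=0,1,2,3$, such that $$H^2_-(\Delta;E_\rho\otimes E_\rho)\neq 0 .$$
   Context: The Lie group may be real or complex semi-simple; all tensor products and dimensions are over the corresponding base field. $\widetilde M$ is the universal cover of $M$ and $E_\rho=\pi_1(M)\backslash(\widetilde M\times_\rho\mathfrak g)$ is the flat vector bundle (local system) on $M$ associated with $\rho$; cohomology is de Rham cohomology with coefficients in flat bundles. $\Delta\simeq M$ is the diagonal of $M\times M$, and $E_\rho\otimes E_\rho$ on $\Delta$ is the restriction of $E_\rho\boxtimes E_\rho$. The involution $T$ acts on $\Delta$ as the identity and on $E_\rho\otimes E_\rho$ by exchanging the two tensor factors; $H^2_-(\Delta;E_\rho\otimes E_\rho)$ is the $(-1)$-eigenspace of the induced action $T^*$ on $H^2(\Delta;E_\rho\otimes E_\rho)$ (equivalently $H^2(M;\Lambda^2E_\rho)$). *)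

(* Defs.v *)
From HB Require Import structures.
From mathcomp Require Import all_boot all_order all_algebra.
From mathcomp Require Import generic_quotient.
From mathcomp Require Import all_classical all_reals all_analysis.
From mathcomp Require Import complex lra.

Set Implicit Arguments.
Unset Strict Implicit.
Unset Printing Implicit Defensive.

Import Order.TTheory GRing.Theory Num.Theory.
Import numFieldNormedType.Exports.

Local Open Scope classical_set_scope.
Local Open Scope ring_scope.
Local Open Scope quotient_scope.

Lemma comp_within (T U V : topologicalType) (A : set T) (B : set U)
    (g : T -> U) (f : U -> V) :
  {within A, continuous g} -> (forall x, A x -> B (g x)) ->
  {within B, continuous f} -> {within A, continuous (f \o g)}.
Proof.
move=> /subspace_continuousP cg gAB /subspace_continuousP cf.
apply/subspace_continuousP => x Ax W /= fW.
have WB : nbhs (g x) [set u | B u -> W (f u)] := cf _ (gAB _ Ax) W fW.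
have nA : nbhs x [set u | A u -> B (g u) -> W (f (g u))] := cg _ Ax _ WB.
change (nbhs x [set u | A u -> W (f (g u))]).
by apply: filterS nA => y H Ay; exact: H Ay (gAB _ Ay).
Qed.

Lemma within_eq (T U : topologicalType) (A : set T) (f g : T -> U) :
  (forall x, A x -> f x = g x) ->
  {within A, continuous f} -> {within A, continuous g}.
Proof. by move=> fg; apply: subspace_eq_continuous => x /set_mem /fg. Qed.

Lemma paste_within (R : realType) (T U : topologicalType) (A : set T)
    (h : T -> R) (a : R) (f g : T -> U) :
  closed A -> continuous h ->
  {within A `&` [set p | h p <= a], continuous f} ->
  {within A `&` [set p | a <= h p], continuous g} ->
  (forall p, A p -> h p = a -> f p = g p) ->
  {within A, continuous (fun p => if h p <= a then f p else g p)}.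
Proof.
move=> cA ch cf cg fg.
have -> : A = (A `&` [set p | h p <= a]) `|` (A `&` [set p | a <= h p]).
  apply/seteqP; split => [p Ap|p [] []//].
  by case: (leP (h p) a) => [|/ltW] ha; [left|right].
move/continuous_closedP: ch => ch; apply: withinU_continuous.
- by apply: closedI => //; exact: ch _ (@closed_le R a).
- by apply: closedI => //; exact: ch _ (@closed_ge R a).
- by apply: within_eq cf => p [_ /= ->].
- apply: within_eq cg => p [Ap /= ap]; case: ifPn => // pa.
  by rewrite fg //; apply/eqP; rewrite eq_le pa.
Qed.

Lemma continuous_pair (T U V : topologicalType) (f : T -> U) (g : T -> V) :
  continuous f -> continuous g -> continuous (fun x => (f x, g x)).
Proof. by move=> cf cg x; apply: cvg_pair; [exact: cf | exact: cg]. Qed.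

Lemma closed_square (R : realType) :
  closed (`[0, 1]%classic `*` `[0, 1]%classic : set (R * R)).
Proof.
have -> : (`[0, 1]%classic `*` `[0, 1]%classic : set (R * R)) =
    fst @^-1` `[0, 1]%classic `&` snd @^-1` `[0, 1]%classic by [].
have c1 : continuous (@fst R R) by move=> ?; exact: cvg_fst.
have c2 : continuous (@snd R R) by move=> ?; exact: cvg_snd.
move: c1 c2 => /continuous_closedP c1 /continuous_closedP c2.
by apply: closedI; [apply: c1|apply: c2]; exact: interval_closed.
Qed.

Lemma continuous_minR (R : realType) (f g : R -> R) :
  continuous f -> continuous g -> continuous (fun t => Num.min (f t) (g t)).
Proof. by move=> cf cg t; exact: (continuous_min (cf t) (cg t)). Qed.

Lemma continuous_maxR (R : realType) (f g : R -> R) :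
  continuous f -> continuous g -> continuous (fun t => Num.max (f t) (g t)).
Proof. by move=> cf cg t; exact: (continuous_max (cf t) (cg t)). Qed.

Section path.
Context (R : realType) (X : topologicalType).
Implicit Types x y z : X.

Record cpath x y := CPath {
  cpath_fun :> R -> X;
  cpath_cts : {within `[0, 1], continuous cpath_fun};
  cpath0 : cpath_fun 0 = x;
  cpath1 : cpath_fun 1 = y }.

Arguments cpath_cts {x y} c : rename.

HB.instance Definition _ x y := gen_eqMixin (cpath x y).
HB.instance Definition _ x y := gen_choiceMixin (cpath x y).

Definition path_homotopic x y (c d : cpath x y) : Prop :=
  exists H : R * R -> X,
  [/\ {within `[0, 1]%classic `*` `[0, 1]%classic, continuous H},
      forall t, t \in `[0, 1] -> H (0, t) = c t /\ H (1, t) = d t &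
      forall s, s \in `[0, 1] -> H (s, 0) = x /\ H (s, 1) = y].

Lemma reparam_homotopic x y (c d : cpath x y) (phi psi : R -> R) :
  continuous phi -> continuous psi ->
  (forall t, t \in `[0, 1] -> phi t \in `[0, 1] /\ psi t \in `[0, 1]) ->
  phi 0 = psi 0 -> phi 1 = psi 1 ->
  forall (f : R -> X), {within `[0, 1], continuous f} ->
  (forall t, t \in `[0, 1] -> c t = f (phi t)) ->
  (forall t, t \in `[0, 1] -> d t = f (psi t)) -> path_homotopic c d.
Proof.
move=> cphi cpsi I e0 e1 f cf cE dE.
pose g (p : R * R) := (1 - p.1) * phi p.2 + p.1 * psi p.2.
have cg : continuous g.
  move=> p; apply: cvgD; apply: cvgM.
  - by apply: cvgB; [exact: cvg_cst | exact: cvg_fst].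
  - by apply: (@cvg_comp _ _ _ snd phi); [exact: cvg_snd | exact: cphi].
  - exact: cvg_fst.
  - by apply: (@cvg_comp _ _ _ snd psi); [exact: cvg_snd | exact: cpsi].
exists (f \o g); split.
- apply: (comp_within _ _ cf); first exact: continuous_subspaceT.
  move=> [s t] [/= s01 t01]; have [] := I t t01.
  move: s01; rewrite /g /= !in_itv /= => /andP[? ?] /andP[? ?] /andP[? ?].
  have ? : 0 <= 1 - s by rewrite subr_ge0.
  apply/andP; split; first by rewrite addr_ge0// mulr_ge0.
  rewrite -[leRHS](subrK s); apply: lerD; last by rewrite ler_piMr.
  by rewrite ler_piMr.
- by move=> t t01; rewrite /g /= subr0 !mul1r !mul0r addr0 subrr mul0r add0r
    cE ?dE.
- have z01 : (0 : R) \in `[0, 1] by rewrite in_itv /= lexx ler01.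
  have o01 : (1 : R) \in `[0, 1] by rewrite in_itv /= lexx ler01.
  move=> s s01; rewrite /g /= -e0 -e1 -!mulrDl subrK !mul1r.
  by rewrite -cE // -cE // cpath0 cpath1.
Qed.

Lemma homotopic_refl x y (c : cpath x y) : path_homotopic c c.
Proof.
apply: (@reparam_homotopic _ _ c c id id _ _ _ _ _ c) => //.
- by move=> ?; exact: cvg_id.
- by move=> ?; exact: cvg_id.
- exact: cpath_cts.
Qed.

Lemma homotopic_sym x y (c d : cpath x y) :
  path_homotopic c d -> path_homotopic d c.
Proof.
move=> [H [cH H0 H1]]; exists (H \o (fun p => (1 - p.1, p.2))).
have flip (s : R) : s \in `[0, 1] -> 1 - s \in `[0, 1].
  by rewrite !in_itv /=; lra.
split.
- apply: (comp_within _ _ cH).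
    apply/continuous_subspaceT/continuous_pair => p; last exact: cvg_snd.
    by apply: cvgB; [exact: cvg_cst | exact: cvg_fst].
  by move=> [s t] [/= s01 t01]; split => //=; exact: flip.
- by move=> t t01 /=; rewrite subr0 subrr; have [-> ->] := H0 t t01.
- by move=> s s01 /=; apply: H1; exact: flip.
Qed.

Lemma homotopic_trans x y (b c d : cpath x y) :
  path_homotopic b c -> path_homotopic c d -> path_homotopic b d.
Proof.
move=> [H [cH H0 H1]] [G [cG G0 G1]].
exists (fun p => if p.1 <= 2^-1 then H (2 * p.1, p.2) else G (2 * p.1 - 1, p.2)).
have ce (r : R) : continuous (fun p : R * R => (2 * p.1 - r, p.2)).
  apply: continuous_pair => p; last exact: cvg_snd.
  apply: cvgB; last exact: cvg_cst.
  by apply: cvgM; [exact: cvg_cst | exact: cvg_fst].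
split.
- apply: (@paste_within R _ _ _ fst).
  + exact: closed_square.
  + by move=> p; exact: cvg_fst.
  + have -> : (fun p => H (2 * p.1, p.2)) = H \o (fun p => (2 * p.1 - 0, p.2)).
      by apply/funext => p /=; rewrite subr0.
    apply: (comp_within _ _ cH); first exact: continuous_subspaceT.
    move=> [s t] [[/= + ?] ?]; rewrite in_itv /= => ?; split => //=.
    by rewrite in_itv /=; lra.
  + apply: (comp_within _ _ cG); first exact: continuous_subspaceT.
    move=> [s t] [[/= + ?] ?]; rewrite in_itv /= => ?; split => //=.
    by rewrite in_itv /=; lra.
  + move=> [s t] [/= _ t01] ->; rewrite divff ?pnatr_eq0 // subrr.
    by rewrite (H0 t t01).2 (G0 t t01).1.
- move=> t t01 /=; rewrite mulr0 invr_ge0 ler0n ifF; last by apply/negbTE; lra.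
  by rewrite mulr1 (H0 t t01).1 -[2 - 1]/(1 + 1 - 1) addrK (G0 t t01).2.
- move=> s; rewrite in_itv /= => s01; case: ifPn => sh.
    by apply: H1; rewrite in_itv /=; lra.
  by apply: G1; rewrite in_itv /=; move: sh; rewrite -ltNge; lra.
Qed.

Definition homotopicb x y (c d : cpath x y) := `[< path_homotopic c d >].

Lemma homotopicb_refl x y : reflexive (@homotopicb x y).
Proof. by move=> c; apply/asboolP; exact: homotopic_refl. Qed.

Lemma homotopicb_sym x y : symmetric (@homotopicb x y).
Proof. by move=> c d; apply/asboolP/asboolP; exact: homotopic_sym. Qed.

Lemma homotopicb_trans x y : transitive (@homotopicb x y).
Proof.
move=> c b d /asboolP bc /asboolP cd; apply/asboolP.
exact: homotopic_trans bc cd.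
Qed.

Canonical homotopicb_equiv x y := EquivRel (@homotopicb x y)
  (@homotopicb_refl x y) (@homotopicb_sym x y) (@homotopicb_trans x y).

Definition hpath x y := {eq_quot (homotopicb_equiv x y)}.
HB.instance Definition _ x y := Choice.on (hpath x y).
HB.instance Definition _ x y := EqQuotient.on (hpath x y).

Lemma hpath_eqP x y (c d : cpath x y) :
  \pi_(hpath x y) c = \pi_(hpath x y) d <-> path_homotopic c d.
Proof. by split=> [/eqmodP/asboolP//|cd]; apply/eqmodP/asboolP. Qed.

Section cat.
Context x y z (c : cpath x y) (d : cpath y z).

Definition cat_fun (t : R) : X := if t <= 2^-1 then c (2 * t) else d (2 * t - 1).

Let cat_cts : {within `[0, 1], continuous cat_fun}.
Proof.
have ce (r : R) : continuous (fun t : R => 2 * t - r).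
  move=> t; apply: cvgB; last exact: cvg_cst.
  by apply: cvgM; [exact: cvg_cst | exact: cvg_id].
apply: (@paste_within R _ _ _ id).
- exact: interval_closed.
- by move=> p; exact: cvg_id.
- have -> : (fun t => c (2 * t)) = c \o (fun t : R => 2 * t - 0).
    by apply/funext => p /=; rewrite subr0.
  apply: (comp_within _ _ (cpath_cts c)); first exact: continuous_subspaceT.
  by move=> t [/=]; rewrite !in_itv /=; lra.
- apply: (comp_within _ _ (cpath_cts d)); first exact: continuous_subspaceT.
  by move=> t [/=]; rewrite !in_itv /=; lra.
- by move=> t _ ->; rewrite divff ?pnatr_eq0 // subrr cpath1 cpath0.
Qed.

Let cat0 : cat_fun 0 = x.
Proof. by rewrite /cat_fun invr_ge0 ler0n mulr0 cpath0. Qed.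

Let cat1 : cat_fun 1 = z.
Proof.
rewrite /cat_fun ifF; last by apply/negbTE; lra.
by rewrite mulr1 -[2 - 1]/(1 + 1 - 1) addrK cpath1.
Qed.

Definition cpath_cat : cpath x z := CPath cat_cts cat0 cat1.
End cat.

Section rev.
Context x y (c : cpath x y).

Let rev_cts : {within `[0, 1], continuous (fun t => c (1 - t))}.
Proof.
apply: (comp_within _ _ (cpath_cts c)).
  apply: continuous_subspaceT => t.
  by apply: cvgB; [exact: cvg_cst | exact: cvg_id].
by move=> t /=; rewrite !in_itv /=; lra.
Qed.

Let rev0 : c (1 - 0) = y. Proof. by rewrite subr0 cpath1. Qed.
Let rev1 : c (1 - 1) = x. Proof. by rewrite subrr cpath0. Qed.

Definition cpath_rev : cpath y x := CPath rev_cts rev0 rev1.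
End rev.

Definition cpath_cst x : cpath x x :=
  @CPath x x (fun=> x) (continuous_subspaceT (@cst_continuous _ _ x)) erefl erefl.

Definition hcat x y z (p : hpath x y) (q : hpath y z) : hpath x z :=
  \pi_(hpath x z) (cpath_cat (repr p) (repr q)).

Definition hrev x y (p : hpath x y) : hpath y x :=
  \pi_(hpath y x) (cpath_rev (repr p)).

Definition hcst x : hpath x x := \pi_(hpath x x) (cpath_cst x).

Lemma homotopic_cat x y z (c c' : cpath x y) (d d' : cpath y z) :
  path_homotopic c c' -> path_homotopic d d' ->
  path_homotopic (cpath_cat c d) (cpath_cat c' d').
Proof.
move=> [H [cH H0 H1]] [G [cG G0 G1]].
exists (fun p => if p.2 <= 2^-1 then H (p.1, 2 * p.2) else G (p.1, 2 * p.2 - 1)).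
have ce (r : R) : continuous (fun p : R * R => (p.1, 2 * p.2 - r)).
  apply: continuous_pair => p; first exact: cvg_fst.
  apply: cvgB; last exact: cvg_cst.
  by apply: cvgM; [exact: cvg_cst | exact: cvg_snd].
split.
- apply: (@paste_within R _ _ _ snd).
  + exact: closed_square.
  + by move=> p; exact: cvg_snd.
  + have -> : (fun p => H (p.1, 2 * p.2)) = H \o (fun p => (p.1, 2 * p.2 - 0)).
      by apply/funext => p /=; rewrite subr0.
    apply: (comp_within _ _ cH); first exact: continuous_subspaceT.
    move=> [s t] [[/= ? +] ?]; rewrite in_itv /= => ?; split => //=.
    by rewrite in_itv /=; lra.
  + apply: (comp_within _ _ cG); first exact: continuous_subspaceT.
    move=> [s t] [[/= ? +] ?]; rewrite in_itv /= => ?; split => //=.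
    by rewrite in_itv /=; lra.
  + move=> [s t] [/= s01 _] ->; rewrite divff ?pnatr_eq0 // subrr.
    by rewrite (H1 s s01).2 (G1 s s01).1.
- move=> t; rewrite in_itv /= /cat_fun => t01; case: ifPn => th.
    by apply: H0; rewrite in_itv /=; lra.
  by apply: G0; rewrite in_itv /=; move: th; rewrite -ltNge; lra.
- move=> s s01 /=; rewrite mulr0 invr_ge0 ler0n ifF; last by apply/negbTE; lra.
  by rewrite mulr1 (H1 s s01).1 -[2 - 1]/(1 + 1 - 1) addrK (G1 s s01).2.
Qed.

Lemma homotopic_rev x y (c c' : cpath x y) :
  path_homotopic c c' -> path_homotopic (cpath_rev c) (cpath_rev c').
Proof.
move=> [H [cH H0 H1]]; exists (H \o (fun p => (p.1, 1 - p.2))).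
have flip (s : R) : s \in `[0, 1] -> 1 - s \in `[0, 1].
  by rewrite !in_itv /=; lra.
split.
- apply: (comp_within _ _ cH).
    apply/continuous_subspaceT/continuous_pair => p; first exact: cvg_fst.
    by apply: cvgB; [exact: cvg_cst | exact: cvg_snd].
  by move=> [s t] [/= s01 t01]; split => //=; exact: flip.
- by move=> t t01 /=; apply: H0; exact: flip.
- by move=> s s01 /=; rewrite subr0 subrr; have [-> ->] := H1 s s01.
Qed.

Lemma hpath_repr x y (c : cpath x y) : path_homotopic (repr (\pi_(hpath x y) c)) c.
Proof. by apply/hpath_eqP; rewrite reprK. Qed.

Lemma hcatE x y z (c : cpath x y) (d : cpath y z) :
  hcat (\pi c) (\pi d) = \pi_(hpath x z) (cpath_cat c d).
Proof. by apply/hpath_eqP/homotopic_cat; exact: hpath_repr. Qed.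

Lemma hrevE x y (c : cpath x y) : hrev (\pi c) = \pi_(hpath y x) (cpath_rev c).
Proof. by apply/hpath_eqP/homotopic_rev; exact: hpath_repr. Qed.

Lemma hcatA x y z w (p : hpath x y) (q : hpath y z) (r : hpath z w) :
  hcat p (hcat q r) = hcat (hcat p q) r.
Proof.
rewrite -[p]reprK -[q]reprK -[r]reprK !hcatE; apply/hpath_eqP.
move: (repr p) (repr q) (repr r) => {p q r} b c d.
pose phi (t : R) := Num.min (Num.min (2 * t) (t + 4^-1)) (2^-1 * (t + 1)).
have cl (u v : R) : continuous (fun t : R => u * (t + v)).
  move=> t; apply: cvgM; first exact: cvg_cst.
  by apply: cvgD; [exact: cvg_id | exact: cvg_cst].
have cphi : continuous phi.
  apply: continuous_minR; first apply: continuous_minR.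
  - by have := cl 2 0; under eq_fun do rewrite addr0.
  - by have := cl 1 4^-1; under eq_fun do rewrite mul1r.
  - exact: cl.
apply: (@reparam_homotopic _ _ _ _ id phi _ _ _ _ _ (cpath_cat b (cpath_cat c d))) => //.
- by move=> ?; exact: cvg_id.
- move=> t; rewrite /phi !in_itv /= => t01; split; first by [].
  by case: (leP (2 * t) (t + 4^-1)) => ?; case: (leP _ (2^-1 * (t + 1))) => ?; lra.
- by rewrite /phi; case: (leP (2 * 0) (0 + 4^-1 : R)) => ?; case: (leP _ (2^-1 * (0 + 1) : R)) => ?; lra.
- by rewrite /phi; case: (leP (2 * 1) (1 + 4^-1 : R)) => ?; case: (leP _ (2^-1 * (1 + 1) : R)) => ?; lra.
- exact: cpath_cts.
- move=> t; rewrite in_itv /= => t01; rewrite /cat_fun /= /cat_fun /phi.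
  case: (leP (2 * t) (t + 4^-1)) => ?; case: (leP _ (2^-1 * (t + 1))) => ?; do ! case: ifPn => //;
  rewrite -?ltNge => *; try (exfalso; lra); congr (cpath_fun _ _); lra.
Qed.

Lemma hcat1p x y (p : hpath x y) : hcat (hcst x) p = p.
Proof.
rewrite -[p]reprK hcatE; apply/hpath_eqP; move: (repr p) => {p} c.
pose phi (t : R) := Num.max 0 (2 * t - 1).
apply: (@reparam_homotopic _ _ _ _ phi id _ _ _ _ _ c) => //.
- apply: continuous_maxR => t; first exact: cvg_cst.
  apply: cvgB; last exact: cvg_cst.
  by apply: cvgM; [exact: cvg_cst | exact: cvg_id].
- by move=> ?; exact: cvg_id.
- move=> t t01; split => //; move: t01; rewrite /phi !in_itv /=.
  by case: (leP (0 : R) (2 * t - 1)) => ?; lra.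
- by rewrite /phi; case: (leP (0 : R) (2 * 0 - 1)) => ?; lra.
- by rewrite /phi; case: (leP (0 : R) (2 * 1 - 1)) => ?; lra.
- exact: cpath_cts.
- move=> t; rewrite in_itv /= => t01; rewrite /cat_fun /phi.
  case: ifPn => th.
    have -> : Num.max 0 (2 * t - 1) = 0 by case: (leP (0 : R) (2 * t - 1)) => ?; lra.
    by rewrite cpath0.
  have -> // : Num.max 0 (2 * t - 1) = 2 * t - 1.
  by move: th; rewrite -ltNge => th; case: (leP (0 : R) (2 * t - 1)) => ?; lra.
Qed.

Lemma hcatp1 x y (p : hpath x y) : hcat p (hcst y) = p.
Proof.
rewrite -[p]reprK hcatE; apply/hpath_eqP; move: (repr p) => {p} c.
pose phi (t : R) := Num.min 1 (2 * t).
apply: (@reparam_homotopic _ _ _ _ phi id _ _ _ _ _ c) => //.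
- apply: continuous_minR => t; first exact: cvg_cst.
  by apply: cvgM; [exact: cvg_cst | exact: cvg_id].
- by move=> ?; exact: cvg_id.
- move=> t t01; split => //; move: t01; rewrite /phi !in_itv /=.
  by case: (leP (1 : R) (2 * t)) => ?; lra.
- by rewrite /phi; case: (leP (1 : R) (2 * 0)) => ?; lra.
- by rewrite /phi; case: (leP (1 : R) (2 * 1)) => ?; lra.
- exact: cpath_cts.
- move=> t; rewrite in_itv /= => t01; rewrite /cat_fun /phi.
  case: ifPn => th.
    by have -> // : Num.min 1 (2 * t) = 2 * t by case: (leP (1 : R) (2 * t)) => ?; lra.
  have -> : Num.min 1 (2 * t) = 1.
    by move: th; rewrite -ltNge => th; case: (leP (1 : R) (2 * t)) => ?; lra.
  by rewrite cpath1.
Qed.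

Lemma hcatpV x y (p : hpath x y) : hcat p (hrev p) = hcst x.
Proof.
rewrite -[p]reprK hrevE hcatE; apply/hpath_eqP; move: (repr p) => {p} c.
pose phi (t : R) := Num.min (2 * t) (2 - 2 * t).
have c2 : continuous (fun t : R => 2 * t).
  by move=> t; apply: cvgM; [exact: cvg_cst | exact: cvg_id].
apply: (@reparam_homotopic _ _ _ _ phi (fun=> 0) _ _ _ _ _ c).
- apply: continuous_minR => t; first exact: c2.
  by apply: cvgB; [exact: cvg_cst | exact: c2].
- by move=> ?; exact: cvg_cst.
- move=> t; rewrite /phi !in_itv /= => t01.
  by case: (leP (2 * t) (2 - 2 * t)) => ?; lra.
- by rewrite /phi; case: (leP (2 * 0 : R) (2 - 2 * 0)) => ?; lra.
- by rewrite /phi; case: (leP (2 * 1 : R) (2 - 2 * 1)) => ?; lra.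
- exact: cpath_cts.
- move=> t; rewrite in_itv /= => t01; rewrite /cat_fun /phi.
  case: ifPn => th /=; congr (cpath_fun _ _); first by case: (leP (2 * t) (2 - 2 * t)) => ?; lra.
  by move: th; rewrite -ltNge => th; case: (leP (2 * t) (2 - 2 * t)) => ?; lra.
- by move=> t _ /=; rewrite cpath0.
Qed.

Lemma hrevK x y (p : hpath x y) : hrev (hrev p) = p.
Proof.
rewrite -[p]reprK !hrevE; apply/hpath_eqP; move: (repr p) => {p} c.
apply: (@reparam_homotopic _ _ _ _ id id _ _ _ _ _ c) => //.
- by move=> ?; exact: cvg_id.
- by move=> ?; exact: cvg_id.
- exact: cpath_cts.
- by move=> t _ /=; rewrite subKr.
Qed.

Lemma hcatVp x y (p : hpath x y) : hcat (hrev p) p = hcst y.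
Proof. by rewrite -{2}[p]hrevK hcatpV. Qed.

Definition pi1 x := hpath x x.
HB.instance Definition _ x := Choice.on (pi1 x).
HB.instance Definition _ x := isGroup.Build (pi1 x)
  (@hcatA x x x x) (@hcat1p x x) (@hcatp1 x x) (@hcatVp x x) (@hcatpV x x).

End path.

Section smooth_functions.
Context {F K : numFieldType} (iota : {rmorphism F -> K}).
Context {V : normedModType F} {W : normedModType K}.

(* Directional derivatives of a function from an F-vector space to a K-vector
   space along a field embedding iota : F -> K; for iota = idfun they are
   convertible to the library's [derivable] and ['D_v f x]. The embedding of
   the reals into the complex numbers serves complex-valued forms on a real
   manifold. *)
Definition dirderivable (f : V -> W) (x v : V) : Prop :=
  cvg ((fun h : F => (iota h)^-1 *: (f (h *: v + x) - f x)) @ 0^').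

Definition dirderive (f : V -> W) (x v : V) : W :=
  lim ((fun h : F => (iota h)^-1 *: (f (h *: v + x) - f x)) @ 0^').

Definition iter_dirderive (vs : seq V) (f : V -> W) : V -> W :=
  foldr (fun v g x => dirderive g x v) f vs.

(* On an open U: all iterated directional derivatives exist and are continuous;
   for F = K = R[i] these are the holomorphic functions. *)
Definition smooth_on (U : set V) (f : V -> W) : Prop :=
  forall (vs : seq V) (x : V), U x ->
    {for x, continuous (iter_dirderive vs f)} /\
    forall v, dirderivable (iter_dirderive vs f) x v.

End smooth_functions.

Section manifolds.
Context {K : numFieldType}.

Record atlas (V : normedModType K) (M : topologicalType) := Atlas {
  chart :> Type;
  chart_dom : chart -> set M;
  chart_coord : chart -> M -> V;
  chart_param : chart -> V -> M }.

Definition chart_img V M (A : atlas V M) (i : A) (U : set M) : set V :=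
  chart_coord i @` (chart_dom i `&` U).

Definition is_smooth_atlas V M (A : atlas V M) : Prop :=
  [/\ forall x, exists i : A, chart_dom i x,
      forall i : A, open (chart_dom i) /\ open (chart_img i setT),
      forall (i : A) x, chart_dom i x -> chart_param i (chart_coord i x) = x,
      forall i : A, {within chart_dom i, continuous (chart_coord i)} /\
                    {within chart_img i setT, continuous (chart_param i)} &
      forall i j : A, smooth_on idfun (chart_img i (chart_dom j))
                        (chart_coord j \o chart_param i)].

Definition is_smooth_manifold V M (A : atlas V M) : Prop :=
  [/\ hausdorff_space M, @second_countable M & is_smooth_atlas A].

Definition prod_atlas V1 V2 M1 M2 (A1 : atlas V1 M1) (A2 : atlas V2 M2) :
    atlas (V1 * V2)%type (M1 * M2)%type :=
  @Atlas (V1 * V2)%type (M1 * M2)%type (A1 * A2)%type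
    (fun i => chart_dom i.1 `*` chart_dom i.2)
    (fun i x => (chart_coord i.1 x.1, chart_coord i.2 x.2))
    (fun i y => (chart_param i.1 y.1, chart_param i.2 y.2)).

Definition smooth_map V1 V2 M1 M2 (A1 : atlas V1 M1) (A2 : atlas V2 M2)
    (f : M1 -> M2) : Prop :=
  continuous f /\
  forall (i : A1) (j : A2),
    smooth_on idfun (chart_img i (f @^-1` chart_dom j))
      (chart_coord j \o f \o chart_param i).

End manifolds.

Definition transition_jacobian (K : numFieldType) (n : nat) (M : topologicalType)
    (A : atlas 'rV[K]_n M) (i j : A) (x : M) : 'M[K]_n :=
  'J (chart_coord j \o chart_param i) (chart_coord i x).

(* The atlas carries the orientation. *)
Record closed_oriented_manifold (R : realType) (n : nat) := ClosedOrientedManifold {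
  com_space :> topologicalType;
  com_atlas : atlas 'rV[R]_n com_space;
  com_smooth : is_smooth_manifold com_atlas;
  com_compact : compact [set: com_space];
  com_connected : connected [set: com_space];
  com_oriented : forall (i j : com_atlas) x, chart_dom i x -> chart_dom j x ->
    0 < \det (transition_jacobian i j x) }.

#[short(type="topologicalGroupType")]
HB.structure Definition TopologicalGroup := {G of Group G & Topological G}.

Record lie_group (K : numFieldType) (n : nat) := LieGroup {
  lie_space :> topologicalGroupType;
  lie_atlas : atlas 'rV[K]_n lie_space;
  lie_smooth : is_smooth_manifold lie_atlas;
  lie_mul : smooth_map (prod_atlas lie_atlas lie_atlas) lie_atlas
              (fun p => p.1 * p.2)%g;
  lie_inv : smooth_map lie_atlas lie_atlas (fun g => g^-1)%g;
  lie_chart1 : lie_atlas;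
  lie_chart1P : chart_dom lie_chart1 1%g }.

Section lie_algebra.
Context {K : numFieldType} {n : nat} (G : lie_group K n).

(* The Lie algebra T_1 G is identified with 'rV[K]_n by the chart at 1. *)
Let phi : G -> 'rV[K]_n := chart_coord (lie_chart1 G).
Let psi : 'rV[K]_n -> G := chart_param (lie_chart1 G).

(* The matrix of Ad g, acting on row vectors: Ad g X = X *m Ad_mx g. *)
Definition Ad_mx (g : G) : 'M[K]_n :=
  'J (fun y => phi (g * psi y * g^-1)%g) (phi 1%g).

(* [X, Y] = ad X Y, where ad is the differential of Ad at 1. *)
Definition lie_bracket (X Y : 'rV[K]_n) : 'rV[K]_n :=
  'D_X (fun y => Y *m Ad_mx (psi y)) (phi 1%g).

Definition lie_ideal (I : {vspace 'rV[K]_n}) : Prop :=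
  forall X Y, Y \in I -> lie_bracket X Y \in I.

Definition derived_algebra (U : {vspace 'rV[K]_n}) : {vspace 'rV[K]_n} :=
  <<[seq lie_bracket X Y | X <- vbasis U, Y <- vbasis U]>>%VS.

Definition lie_solvable (U : {vspace 'rV[K]_n}) : Prop :=
  exists k, iter k derived_algebra U = 0%VS.

Definition semisimple : Prop :=
  connected [set: G] /\ forall I, lie_ideal I -> lie_solvable I -> I = 0%VS.

End lie_algebra.

Section flat_bundle.
Context {R : realType} {K : numFieldType} (iota : {rmorphism R -> K}).
Context {n : nat} {M : topologicalType} (A : atlas 'rV[R]_n M) (x0 : M).
Context {W : normedModType K} (rho : pi1 R x0 -> W -> W).

Definition univ_cover := {y : M & hpath R x0 y}.

Definition deck (g : pi1 R x0) (z : univ_cover) : univ_cover :=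
  existT _ (tag z) (hcat g (tagged z)).

(* The point [z, w] of E_rho = pi1 \ (univ_cover * W), as a pi1-orbit; its
   projection to M is the end point [tag z]. *)
Definition bundle_point (z : univ_cover) (w : W) : set (univ_cover * W) :=
  range (fun g => (deck g z, rho g w)).

(* Continuous local sections y |-> existT _ y (lift y) of univ_cover -> M over
   an open set; basic neighbourhoods of a class z over x consist of the
   continuations of z by paths inside a neighbourhood of x. The values of lift
   outside lift_dom are irrelevant. Each of them gives the flat trivialization
   (y, w) |-> bundle_point (existT _ y (lift y)) w of E_rho over lift_dom. *)
Record local_lift := LocalLift {
  lift_dom : set M;
  lift :> forall y, hpath R x0 y;
  lift_open : open lift_dom;
  lift_continuous : forall x, lift_dom x -> forall V, open V -> V x ->
    \forall y \near x, exists c : cpath R x y,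
      (forall t, t \in `[0, 1] -> V (c t)) /\
      lift y = hcat (lift x) (\pi_(hpath R x y) c) }.

Definition set_row k m (v : 'M[R]_(k, m)) (i : 'I_k) (u : 'rV[R]_m) :=
  \matrix_(a, b) (if a == i then u 0 b else v a b).

(* Arguments of k-forms are k-tuples of vectors, given as the rows of a matrix. *)
Definition alternating_multilinear k m (f : 'M[R]_(k, m) -> W) : Prop :=
  (forall v i a u u', f (set_row v i (a *: u + u')) =
     iota a *: f (set_row v i u) + f (set_row v i u')) /\
  (forall v i j, i != j -> row i v = row j v -> f v = 0).

(* E_rho-valued k-forms on M, read in all flat trivializations of E_rho and
   all charts of M. *)
Definition preform k := local_lift -> A -> 'rV[R]_n -> 'M[R]_(k, n) -> W.

Definition is_form k (omega : preform k) : Prop :=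
  [/\ forall s i y, chart_img i (lift_dom s) y ->
        alternating_multilinear (omega s i y),
      forall s i v,
        smooth_on iota (chart_img i (lift_dom s)) (fun y => omega s i y v) &
      forall s t i j x, lift_dom s x -> lift_dom t x ->
        chart_dom i x -> chart_dom j x -> forall v,
        bundle_point (existT _ x (s x)) (omega s i (chart_coord i x) v) =
        bundle_point (existT _ x (t x))
          (omega t j (chart_coord j x) (v *m transition_jacobian i j x))].

Definition form_eq k (omega eta : preform k) : Prop :=
  forall s i y, chart_img i (lift_dom s) y -> omega s i y = eta s i y.

(* For constant vector fields v_0, ..., v_k in a chart,
   dw (v_0, ..., v_k) = \sum_i (-1)^i D_{v_i} (w (v_0, .., ^v_i, .., v_k)). *)
Definition ext_d k (omega : preform k) : preform k.+1 := fun s i y v =>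
  \sum_(a < k.+1) (-1) ^+ a *:
    dirderive iota (fun y' => omega s i y' (row' a v)) y (row a v).

Definition closed_form k (omega : preform k) : Prop :=
  form_eq (ext_d omega) (fun _ _ _ _ => 0).

Definition exact_form k : preform k -> Prop :=
  match k with
  | 0 => fun omega => form_eq omega (fun _ _ _ _ => 0)
  | k'.+1 => fun omega =>
      exists eta : preform k', is_form eta /\ form_eq omega (ext_d eta)
  end.

Definition cohomology_eq0 k : Prop :=
  forall omega : preform k, is_form omega -> closed_form omega ->
    exact_form omega.

End flat_bundle.

Arguments preform {R K n M} A x0 W k.

Section adjoint_bundle.
Context {R : realType} {K : numFieldType} (iota : {rmorphism R -> K}).
Context {n m : nat} (M : closed_oriented_manifold R n) (x0 : M).
Context (G : lie_group K m) (h : {multiplicative pi1 R x0 -> G}).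

Definition Ad_rep (g : pi1 R x0) (X : 'rV[K]_m) : 'rV[K]_m :=
  X *m Ad_mx (h g).

Definition acyclic : Prop :=
  forall k, (k <= n)%N -> cohomology_eq0 iota (com_atlas M) Ad_rep k.

(* The tensor square of 'rV_m is 'M_m, with X (x) Y = X^T *m Y; the
   exchange of the two factors is the transposition. *)
Definition Ad_tensor_rep (g : pi1 R x0) (Z : 'M[K]_m) : 'M[K]_m :=
  (Ad_mx (h g))^T *m Z *m Ad_mx (h g).

Definition swap_form k (omega : preform (com_atlas M) x0 ('M[K]_m) k) :
    preform (com_atlas M) x0 ('M[K]_m) k :=
  fun s i y v => (omega s i y v)^T.

(* A class [omega] <> 0 in H^k(M; E (x) E) with T^* [omega] = - [omega]. *)
Definition cohomology_minus_neq0 k : Prop :=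
  exists omega : preform (com_atlas M) x0 ('M[K]_m) k,
    [/\ is_form iota Ad_tensor_rep omega, closed_form iota omega,
        exact_form iota Ad_tensor_rep
          (fun s i y v => swap_form omega s i y v + omega s i y v) &
        ~ exact_form iota Ad_tensor_rep omega].

End adjoint_bundle.

Definition base_field (R : realType) (is_complex : bool) : numFieldType :=
  if is_complex then (R[i] : numFieldType) else (R : numFieldType).

Definition base_embedding (R : realType) (is_complex : bool) :
    {rmorphism R -> base_field R is_complex} :=
  if is_complex return {rmorphism R -> base_field R is_complex}
  then real_complex R else idfun.

(* Main.v *)
(* Take M = R^3/Z^3 and G = SO(3) x SO(3), and let n in Z^3 act through (D, D),
   D being the half-turn diag((-1)^n0, (-1)^n1, (-1)^(n0+n1)).  The adjoint
   bundle E is then a sum of six flat line bundles with characters chi = +-1,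
   none of them trivial, and every character occurs twice.

   Acyclicity: if chi(u) = -1, a form F with values in the line bundle changes
   sign under the translation by u, so integrating Cartan's formula along the
   translation flow over one period gives, for closed F,
   F = d(-1/2 int_0^1 i_u F(x + tu) dt).

   Nonvanishing: if p and q index the two copies of a character, then
   E_pq - E_qp is a parallel section of Lambda^2 E, and dx0 /\ dx1 times it is
   closed and anti-invariant; it is not exact since its integral over a
   2-torus is not zero.

   Forms on M with values in a flat bundle are handled as equivariant forms on
   R^3, through the end points of lifted paths. *)

Require Import Defs.
From HB Require Import structures.
From mathcomp Require Import all_boot all_order all_algebra.
From mathcomp Require Import generic_quotient.
From mathcomp Require Import all_classical all_reals all_analysis.
From mathcomp Require Import ring lra zify.

Set Implicit Arguments.
Unset Strict Implicit.
Unset Printing Implicit Defensive.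

Import Order.TTheory GRing.Theory Num.Theory.
Import numFieldNormedType.Exports.

Local Open Scope classical_set_scope.
Local Open Scope ring_scope.
Local Open Scope quotient_scope.

(** * Smooth functions *)

(** A single factor SO(3) would not do: its three characters are distinct and the product of any two
    is the third, so Lambda^2 of that bundle is acyclic again. Doubling the factor repeats each
    character, and chi^2 = 1 puts a trivial line into Lambda^2 E, which contributes the whole H^2 of
    the torus. Acyclicity only asks that every chi take the value -1 somewhere, on a period that may
    depend on chi. Smoothness means that all iterated directional derivatives exist and are
    continuous. The maps are therefore chosen so that no chain rule is needed: chart changes of the
    torus are locally translations, and everything on the group is rational in Cayley coordinates.
    The Cayley chart moreover turns conjugation into a linear map, so that Ad is read off without
    differentiation and the bracket becomes twice the cross product in each factor. *)

Section smooth.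
Context {R : realType}.

(** The case [iota = idfun] of [iter_dirderive], written with ['D_v] so that the usual rules for
    derivatives apply to it directly. *)
Definition iterD {V W : normedModType R} (vs : seq V) (f : V -> W) : V -> W :=
  foldr (fun v g x => 'D_v g x) f vs.

Definition smooth {V W : normedModType R} (U : set V) (f : V -> W) : Prop :=
  forall vs x, U x ->
    {for x, continuous (iterD vs f)} /\ forall v, derivable (iterD vs f) x v.

Lemma smooth_onE (V W : normedModType R) (U : set V) (f : V -> W) :
  smooth_on idfun U f = smooth U f.
Proof. by []. Qed.

Section general.
Context {V W : normedModType R}.
Implicit Types (U : set V) (f g : V -> W).

Lemma open_near U x : open U -> U x -> \forall y \near x, U y.
Proof. by move=> oU Ux; exact: open_nbhs_nbhs. Qed.

Lemma iterD_eq U f g vs : open U -> (forall x, U x -> f x = g x) ->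
  forall x, U x -> iterD vs f x = iterD vs g x.
Proof.
move=> oU fg; elim: vs => [|v vs IH] x Ux /=; first exact: fg.
have [->|v0] := eqVneq v 0; first by rewrite !derive0.
by apply: near_eq_derive => //; apply: filterS (open_near oU Ux) => y /IH.
Qed.

Lemma smooth_eq U f g : open U -> (forall x, U x -> f x = g x) ->
  smooth U f -> smooth U g.
Proof.
move=> oU fg sf vs x Ux.
have e : {near x, iterD vs f =1 iterD vs g}.
  by apply: filterS (open_near oU Ux) => y; exact: iterD_eq.
have [cf df] := sf vs x Ux; split.
  by rewrite /prop_for /continuous_at -(iterD_eq vs oU fg Ux); apply: cvg_trans cf;
    exact: near_eq_cvg.
move=> v; have [->|v0] := eqVneq v 0; first exact: derivable0.
exact: near_eq_derivable e (df v).
Qed.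

Lemma smooth_sub U U' f : U `<=` U' -> smooth U' f -> smooth U f.
Proof. by move=> UU s vs x /UU; exact: s. Qed.

(** [foldr] applies the last direction of the list first, so appending v turns the iterated
    derivatives of ['D_v f] into iterated derivatives of f. *)
Lemma smooth_derive U f v : smooth U f -> smooth U (fun x => 'D_v f x).
Proof. by move=> s vs; have := s (rcons vs v); rewrite /iterD foldr_rcons. Qed.

Lemma continuous_addr (a : V) : continuous (fun y => y + a).
Proof. by move=> x; apply: cvgD; [exact: cvg_id | exact: cvg_cst]. Qed.

Lemma near_translate (x : V) (P : set V) : nbhs x P -> \forall h \near (0 : V), P (h + x).
Proof.
have c : continuous (fun h : V => h + x) := @continuous_addr x.
by move=> nP; have := c 0; rewrite /continuous_at add0r => /(_ _ nP).
Qed.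

Lemma derive_translate f (a v x : V) : 'D_v (fun y => f (y + a)) x = 'D_v f (x + a).
Proof. by rewrite /derive; under eq_fun do rewrite /= -addrA. Qed.

Lemma iterD_translate f (a : V) vs x :
  iterD vs (fun y => f (y + a)) x = iterD vs f (x + a).
Proof.
elim: vs x => [//|v vs IH] x /=; rewrite -derive_translate; congr ('D_v _ x).
exact/funext.
Qed.

Lemma smooth_translate U f (a : V) : smooth U f ->
  smooth [set x | U (x + a)] (fun y => f (y + a)).
Proof.
move=> s vs x Ux; have [cf df] := s vs _ Ux.
rewrite (_ : iterD vs _ = (fun y => iterD vs f (y + a))); last first.
  by apply/funext => y; exact: iterD_translate.
split; last first.
  by move=> v; rewrite /derivable; under eq_fun do rewrite /= -addrA; exact: df.
apply: (@continuous_comp _ _ _ (fun y => y + a) (iterD vs f)) => //.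
exact: continuous_addr.
Qed.

End general.
End smooth.

(** * Matrix-valued functions, entry by entry *)

Section mx.
Context {R : realType}.

Lemma continuous_mx (T : topologicalType) m n (f : T -> 'M[R]_(m, n)) x :
  (forall i j, {for x, continuous (fun y => f y i j)}) -> {for x, continuous f}.
Proof.
move=> cf; apply/cvgrPdist_le => e e0; near=> y.
rewrite /Num.Def.normr/= mx_normrE (bigmax_le _ (ltW e0))//= => i _.
rewrite !mxE/=.
move: i; near: y; apply: filter_forall => /= i.
exact: ((cvgrPdist_le _ _).1 (cf i.1 i.2)).
Unshelve. all: by end_near. Qed.

Context {V : normedModType R}.

(** A matrix-valued derivative may be taken entrywise once it is known to exist; smoothness of the
    entries supplies this existence at each stage of the induction. *)
Lemma iterD_mx m n (U : set V) (f : V -> 'M[R]_(m, n)) vs i j : open U ->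
  (forall i j, smooth U (fun x => f x i j)) ->
  forall x, U x -> iterD vs f x i j = iterD vs (fun x => f x i j) x.
Proof.
move=> oU sf; elim: vs i j => [//|v vs IH] i j x Ux /=.
have e i' j' : {near x, (fun y => iterD vs (fun x => f x i' j') y) =1
    (fun y => iterD vs f y i' j')}.
  by apply: filterS (open_near oU Ux) => y Uy; rewrite IH.
rewrite derive_mx.
  by rewrite mxE -(near_eq_derive _ (e i j)).
apply/derivable_mxP => i' j'; apply: near_eq_derivable (e i' j') _.
by have [_] := sf i' j' vs x Ux; exact.
Qed.

Lemma smooth_mx m n (U : set V) (f : V -> 'M[R]_(m, n)) : open U ->
  (forall i j, smooth U (fun x => f x i j)) -> smooth U f.
Proof.
move=> oU sf vs x Ux.
have e i j : {near x, iterD vs (fun x => f x i j) =1 (fun y => iterD vs f y i j)}.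
  by apply: filterS (open_near oU Ux) => y Uy; rewrite (iterD_mx _ _ _ oU sf).
split.
  apply: continuous_mx => i j; have [cf _] := sf i j vs x Ux.
  rewrite /prop_for /continuous_at (iterD_mx _ _ _ oU sf)//.
  by apply: cvg_trans cf; exact: near_eq_cvg (e i j).
move=> v; apply/derivable_mxP => i j.
by apply: near_eq_derivable (e i j) _; have [_] := sf i j vs x Ux; exact.
Qed.

Lemma iterD_coord m n (U : set V) (f : V -> 'M[R]_(m, n)) vs i j : open U ->
  smooth U f ->
  forall x, U x -> iterD vs (fun x => f x i j) x = iterD vs f x i j.
Proof.
move=> oU sf; elim: vs => [//|v vs IH] x Ux /=.
have e : {near x, iterD vs (fun x => f x i j) =1 (fun y => iterD vs f y i j)}.
  by apply: filterS (open_near oU Ux) => y Uy; rewrite IH.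
rewrite (near_eq_derive _ e) derive_mx ?mxE//.
by have [_] := sf vs x Ux; exact.
Qed.

Lemma smooth_coord m n (U : set V) (f : V -> 'M[R]_(m, n)) i j : open U ->
  smooth U f -> smooth U (fun x => f x i j).
Proof.
move=> oU sf vs x Ux; have [cf df] := sf vs x Ux.
have e : {near x, (fun y => iterD vs f y i j) =1 iterD vs (fun x => f x i j)}.
  by apply: filterS (open_near oU Ux) => y Uy; rewrite (iterD_coord _ _ _ oU sf).
split; last by move=> v; apply: near_eq_derivable e _; move/derivable_mxP: (df v).
rewrite /prop_for /continuous_at (iterD_coord _ _ _ oU sf)//.
apply: cvg_trans (near_eq_cvg e) _.
exact: (@continuous_comp _ _ _ (iterD vs f) (fun M => M i j) x cf (@coord_continuous _ _ _ i j _)).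
Qed.

End mx.

(** * Rational functions *)

Section ratfun.
Context {R : realType} {V : normedModType R}.
Implicit Types (U : set V) (f g : V -> R).

(** A class stable under directional derivatives, whose members are continuous on U: one induction
    on the list of directions then gives smoothness. Continuous linear forms take the place of
    coordinates, so that V may be a space of matrices, a product or the line. *)
Inductive ratfun U : (V -> R) -> Prop :=
| ratfun_cst c : ratfun U (fun=> c)
| ratfun_lin f : continuous f -> (forall a x y, f (a *: x + y) = a * f x + f y) ->
    ratfun U f
| ratfunD f g : ratfun U f -> ratfun U g -> ratfun U (fun x => f x + g x)
| ratfunM f g : ratfun U f -> ratfun U g -> ratfun U (fun x => f x * g x)
| ratfunV f : ratfun U f -> (forall x, U x -> f x != 0) ->
    ratfun U (fun x => (f x)^-1).

Lemma is_derive_lin f x v : (forall a x y, f (a *: x + y) = a * f x + f y) ->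
  is_derive x v f (f v).
Proof.
move=> lf.
have c : h^-1 *: (f (h *: v + x) - f x) @[h --> 0^'] --> f v.
  apply: (@cvg_trans _ ((fun=> f v) @ (0 : R)^')); last exact: cvg_cst.
  apply: near_eq_cvg; near=> h.
  have h0 : h != 0 by near: h; exact: nbhs_dnbhs_neq.
  by rewrite lf addrK /GRing.scale /= mulKf.
apply: DeriveDef; first by apply/cvg_ex; exists (f v).
exact/cvg_lim.
Unshelve. all: by end_near. Qed.

Lemma ratfun_continuous U f x : ratfun U f -> U x -> {for x, continuous f}.
Proof.
move=> + Ux; elim => {f}.
- by move=> c; exact: cvg_cst.
- by move=> f cf _; exact: cf.
- by move=> f g _ cf _ cg; exact: cvgD.
- by move=> f g _ cf _ cg; exact: cvgM.
- by move=> f _ cf f0; apply: cvgV => //; exact: f0.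
Qed.

Lemma ratfun_derive U f v : ratfun U f ->
  exists2 g, ratfun U g & forall x, U x -> is_derive x v f (g x).
Proof.
elim => {f}.
- by move=> c; exists (fun=> 0) => [|x _]; [exact: ratfun_cst | exact: is_derive_cst].
- move=> f cf lf; exists (fun=> f v); first exact: ratfun_cst.
  by move=> x _; exact: is_derive_lin.
- move=> f g _ [f' rf' df] _ [g' rg' dg]; exists (fun x => f' x + g' x).
    exact: ratfunD.
  by move=> x Ux; apply: is_deriveD; [exact: df | exact: dg].
- move=> f g rf [f' rf' df] rg [g' rg' dg].
  exists (fun x => f x * g' x + g x * f' x).
    by apply: ratfunD; exact: ratfunM.
  by move=> x Ux; apply: is_deriveM; [exact: df | exact: dg].
- move=> f rf [f' rf' df] f0.
  (* The derivative of the inverse, written with products and a constant only, so that it is visibly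
     in the class. *)
  exists (fun x => - 1 * ((f x)^-1 * (f x)^-1) * f' x).
    by apply: ratfunM => //; apply: ratfunM; [exact: ratfun_cst | apply: ratfunM;
      exact: ratfunV].
  move=> x Ux; have [dfx <-] := df x Ux; apply: DeriveDef.
    by apply: derivableV => //; exact: f0.
  rewrite deriveV//; last exact: f0.
  by rewrite /GRing.scale /= mulN1r -exprVn expr2.
Qed.

Lemma ratfun_iterD U f vs : open U -> ratfun U f ->
  exists2 g, ratfun U g & forall x, U x -> iterD vs f x = g x.
Proof.
move=> oU rf; elim: vs => [|v vs [g rg eg]]; first by exists f.
have [g' rg' dg] := ratfun_derive v rg; exists g' => // x Ux /=.
have [_ <-] := dg x Ux; apply: near_eq_derive.
by apply: filterS (open_near oU Ux) => y; exact: eg.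
Qed.

Lemma ratfun_smooth U f : open U -> ratfun U f -> smooth U f.
Proof.
move=> oU rf vs x Ux; have [g rg eg] := ratfun_iterD vs oU rf.
have e : {near x, g =1 iterD vs f}.
  by apply: filterS (open_near oU Ux) => y Uy; rewrite eg.
split.
  rewrite /prop_for /continuous_at eg//.
  by apply: cvg_trans (ratfun_continuous rg Ux); exact: near_eq_cvg.
move=> v; apply: near_eq_derivable e _.
by have [g' _ /(_ x Ux) []] := ratfun_derive v rg.
Qed.

Lemma ratfunN U f : ratfun U f -> ratfun U (fun x => - f x).
Proof.
move=> rf; rewrite (_ : (fun _ => _) = (fun x => -1 * f x)).
  exact: ratfunM (ratfun_cst _ _) rf.
by apply/funext => x; rewrite mulN1r.
Qed.

Lemma ratfunB U f g : ratfun U f -> ratfun U g -> ratfun U (fun x => f x - g x).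
Proof. by move=> rf rg; apply: ratfunD => //; exact: ratfunN. Qed.

Lemma ratfun_sum U (I : Type) (r : seq I) (P : pred I) (F : I -> V -> R) :
  (forall i, ratfun U (F i)) -> ratfun U (fun x => \sum_(i <- r | P i) F i x).
Proof.
move=> rF; elim: r => [|i r IH].
  rewrite (_ : (fun _ => _) = fun=> 0); first exact: ratfun_cst.
  by apply/funext => x; rewrite big_nil.
have [Pi|nPi] := boolP (P i).
  rewrite (_ : (fun _ => _) = fun x => F i x + \sum_(i <- r | P i) F i x).
    exact: ratfunD.
  by apply/funext => x; rewrite big_cons Pi.
by under eq_fun do rewrite big_cons (negbTE nPi).
Qed.

Definition ratmx m n U (f : V -> 'M[R]_(m, n)) :=
  forall i j, ratfun U (fun x => f x i j).

Lemma ratmx_smooth m n U (f : V -> 'M[R]_(m, n)) :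
  open U -> ratmx U f -> smooth U f.
Proof. by move=> oU rf; apply: smooth_mx => // i j; exact: ratfun_smooth. Qed.

Lemma ratmx_cst m n U (A : 'M[R]_(m, n)) : ratmx U (fun=> A).
Proof. by move=> i j; exact: ratfun_cst. Qed.

Lemma ratmxM m n p U (f : V -> 'M[R]_(m, n)) (g : V -> 'M[R]_(n, p)) :
  ratmx U f -> ratmx U g -> ratmx U (fun x => f x *m g x).
Proof.
move=> rf rg i j; under eq_fun do rewrite mxE.
by apply: ratfun_sum => k; exact: ratfunM.
Qed.

Lemma ratmx_tr m n U (f : V -> 'M[R]_(m, n)) :
  ratmx U f -> ratmx U (fun x => (f x)^T).
Proof. by move=> rf i j; under eq_fun do rewrite mxE; exact: rf. Qed.

Lemma ratfun_sub U U' f :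
  U `<=` U' -> ratfun U' f -> ratfun U f.
Proof.
move=> UU; elim => {f}.
- by move=> c; exact: ratfun_cst.
- by move=> f cf lf; exact: ratfun_lin.
- by move=> f g _ rf _ rg; exact: ratfunD.
- by move=> f g _ rf _ rg; exact: ratfunM.
- by move=> f _ rf f0; apply: ratfunV => // x /UU; exact: f0.
Qed.

Lemma ratmx_linear m n (f : V -> 'M[R]_(m, n)) U :
  continuous f -> (forall a x y, f (a *: x + y) = a *: f x + f y) -> ratmx U f.
Proof.
move=> cf lf i j; apply: ratfun_lin; last by move=> a x y; rewrite lf !mxE.
move=> x; exact: (@continuous_comp _ _ _ f (fun M => M i j) x (cf x) (@coord_continuous _ _ _ i j _)).
Qed.

Lemma ratmx_continuous m n U (f : V -> 'M[R]_(m, n)) x :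
  ratmx U f -> U x -> {for x, continuous f}.
Proof. by move=> rf Ux; apply: continuous_mx => i j;
  exact: ratfun_continuous (rf i j) Ux. Qed.

End ratfun.

(** * Averages along segments *)

Section average.
Context {R : realType} {V : normedModType R}.
Implicit Types (f g : V -> R) (u v x : V).
Local Notation mu := (@lebesgue_measure R).
Local Notation I01 := (`[0 : R, 1 : R]%classic).

Lemma continuous_integrable01 (g : R -> R) : continuous g ->
  mu.-integrable I01 (EFin \o g).
Proof.
move=> cg; apply: continuous_compact_integrable; first exact: segment_compact.
exact: continuous_subspaceT.
Qed.

Lemma measurable01 : measurable (I01 : set (measurableTypeR R)).
Proof. exact: measurable_itv. Qed.

Lemma Rintegral01_dist (g h : R -> R) e : continuous g -> continuous h ->
  (forall t, t \in `[0, 1] -> `|g t - h t| <= e) ->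
  `|\int[mu]_(t in I01) g t - \int[mu]_(t in I01) h t| <= e.
Proof.
move=> cg ch gh.
have ig := continuous_integrable01 cg; have ih := continuous_integrable01 ch.
rewrite -(RintegralB measurable01 ig ih).
have cgh : continuous (fun t => g t - h t) by move=> t; apply: cvgB;
  [exact: cg | exact: ch].
apply: (le_trans (le_normr_Rintegral measurable01 (continuous_integrable01 cgh))).
have -> : e = \int[mu]_(t in I01) cst e t.
  rewrite (Rintegral_cst _ measurable01).
  have := @lebesgue_measure_itv R `[0, 1]; rewrite /= lte_fin ltr01 /= => -> /=.
  by rewrite oppr0 addr0 mulr1.
apply: (le_Rintegral measurable01).
- apply: (@continuous_integrable01 (fun t => `|g t - h t|)) => t.
  by apply: (@continuous_comp _ _ _ (fun t => g t - h t) Num.norm);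
    [exact: cgh | exact: norm_continuous].
- exact/(@continuous_integrable01 (cst e))/cst_continuous.
- by move=> t t01; apply: gh.
Qed.

Definition avg u f x : R := \int[mu]_(t in I01) f (x + t *: u).

Lemma continuous_line f u x : continuous f -> continuous (fun t : R => f (x + t *: u)).
Proof.
move=> cf t; apply: (@continuous_comp _ _ _ (fun t : R => x + t *: u) f); last exact: cf.
by apply: cvgD; [exact: cvg_cst | apply: cvgZr_tmp; exact: cvg_id].
Qed.

(** Compactness of [0, 1] makes continuity at the points of the segment uniform in t, as passing to
    the limit under the integral requires. *)
Lemma near_line_dist f u x e : continuous f -> 0 < e ->
  \forall y \near x, forall t, t \in `[0, 1] -> `|f (y + t *: u) - f (x + t *: u)| <= e.
Proof.
move=> cf e0.
have /compact_near_coveringP nc := @segment_compact R 0 1.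
pose P (y : V) (t : R) := `|f (y + t *: u) - f (x + t *: u)| <= e.
suff : \forall y \near x, `[0, 1]%classic `<=` P y.
  by apply: filterS => y H t t01; exact: H.
apply: nc => t _.
pose h (p : R * V) := f (p.2 + p.1 *: u) - f (x + p.1 *: u).
have ch : continuous h.
  move=> p; apply: cvgB.
    apply: (@continuous_comp _ _ _ (fun p : R * V => p.2 + p.1 *: u) f); last exact: cf.
    by apply: cvgD; [exact: cvg_snd | apply: cvgZr_tmp; exact: cvg_fst].
  apply: (@continuous_comp _ _ _ (fun p : R * V => x + p.1 *: u) f); last exact: cf.
  by apply: cvgD; [exact: cvg_cst | apply: cvgZr_tmp; exact: cvg_fst].
have h0 : h (t, x) = 0 by rewrite /h subrr.
have := ch (t, x); rewrite /continuous_at h0 => /cvgr0Pnorm_le /(_ _ e0).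
apply: filterS => p; rewrite /P /h /= => Hp; exact: Hp.
Qed.

Lemma continuous_avg f u : continuous f -> continuous (avg u f).
Proof.
move=> cf x; apply/cvgrPdist_le => e e0; near=> y.
rewrite distrC; apply: Rintegral01_dist; try exact: continuous_line.
by near: y; exact: near_line_dist.
Unshelve. all: by end_near. Qed.

Lemma is_derive_line f z v s : derivable f (z + s *: v) v ->
  is_derive s 1 (fun s : R => f (z + s *: v)) ('D_v f (z + s *: v)).
Proof.
move=> df.
have e : (fun h : R => h^-1 *: (f (z + (h *: 1 + s) *: v) - f (z + s *: v))) =
         (fun h : R => h^-1 *: (f (h *: v + (z + s *: v)) - f (z + s *: v))).
  by apply/funext => h; rewrite [_%:A]mulr1 scalerDl addrCA.
by apply: DeriveDef; rewrite /derivable /derive /= e.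
Qed.

(** Turns a difference quotient into a derivative at a displaced point; since the displacement is
    bounded by |h| whatever z is, the estimate can be made uniform along a segment. *)
Lemma MVT_line f z v (h : R) : (forall x, derivable f x v) ->
  exists2 c, `|c| <= `|h| & f (z + h *: v) - f z = h * 'D_v f (z + c *: v).
Proof.
move=> df.
have dl s := is_derive_line (df (z + s *: v)).
have cl a b : {within `[a, b], continuous (fun s => f (z + s *: v))}.
  apply: continuous_subspaceT => s; apply: differentiable_continuous.
  by apply/derivable1_diffP; have [] := dl s.
have [h0|h0] := leP 0 h.
  have [c] := MVT_segment h0 (fun s _ => dl s) (@cl _ _).
  rewrite in_itv /= => /andP[c0 ch]; rewrite scale0r addr0 subr0 mulrC => E.
  by exists c => //; rewrite !ger0_norm.
have [c] := MVT_segment (ltW h0) (fun s _ => dl s) (@cl _ _).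
rewrite in_itv /= => /andP[hc c0]; rewrite scale0r addr0 sub0r mulrN => E.
exists c; first by rewrite !ler0_norm ?lerN2 // ltW.
by rewrite -[LHS]opprB E opprK mulrC.
Qed.

(** Differentiation under the integral sign. For each t the quotient is ['D_v f] at a point
    displaced by some c v with |c| <= |h|, which is close to its limit uniformly in t. *)
Lemma cvg_avg f u v x : continuous f -> (forall x, derivable f x v) ->
  continuous (fun x => 'D_v f x) ->
  h^-1 *: (avg u f (h *: v + x) - avg u f x) @[h --> 0^'] -->
    avg u (fun x => 'D_v f x) x.
Proof.
move=> cf df cdf; apply/cvgrPdist_le => e e0.
have N := near_line_dist u x cdf e0.
have N' : \forall c \near (0 : R), forall t, t \in `[0, 1] ->
   `|'D_v f (c *: v + x + t *: u) - 'D_v f (x + t *: u)| <= e.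
  have cc : (c *: v + x) @[c --> (0 : R)] --> x.
    rewrite -[X in _ --> X]add0r -(scale0r v); apply: cvgD; last exact: cvg_cst.
    by apply: cvgZr_tmp; exact: cvg_id.
  exact: cc _ N.
have [d d0 Nd] := N'.
near=> h.
have h0 : h != 0 by near: h; exact: nbhs_dnbhs_neq.
have hd : `|h| < d by near: h; apply: dnbhs0_lt.
rewrite distrC.
have -> : h^-1 *: (avg u f (h *: v + x) - avg u f x) =
  \int[mu]_(t in I01) (h^-1 * (f (h *: v + x + t *: u) - f (x + t *: u))).
  have c1 := @continuous_line _ u (h *: v + x) cf.
  have c2 := @continuous_line _ u x cf.
  rewrite (RintegralZl _ measurable01); last first.
    apply: (@continuous_integrable01 (fun t => f (h *: v + x + t *: u) - f (x + t *: u))) => t.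
    by apply: cvgB; [exact: c1 | exact: c2].
  by rewrite (RintegralB measurable01) //; exact: continuous_integrable01.
apply: Rintegral01_dist.
- move=> t; apply: cvgM; first exact: cvg_cst.
  apply: cvgB; first exact: (@continuous_line _ u (h *: v + x) cf).
  exact: (@continuous_line _ u x cf).
- exact: (@continuous_line _ u x cdf).
move=> t t01; have [c ch] := MVT_line (x + t *: u) h df.
have E1 (k : R) : x + t *: u + k *: v = k *: v + x + t *: u by rewrite addrC addrA.
rewrite !E1 => ->; rewrite mulKf //.
apply: Nd => //=; rewrite sub0r normrN; exact: le_lt_trans hd.
Unshelve. all: by end_near. Qed.

Lemma derivable_avg f u v x : continuous f -> (forall x, derivable f x v) ->
  continuous (fun x => 'D_v f x) -> derivable (avg u f) x v.
Proof.
by move=> cf df cdf; apply/cvg_ex; eexists; exact: cvg_avg.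
Qed.

Lemma derive_avg f u v x : continuous f -> (forall x, derivable f x v) ->
  continuous (fun x => 'D_v f x) -> 'D_v (avg u f) x = avg u (fun x => 'D_v f x) x.
Proof. by move=> cf df cdf; apply: cvg_lim => //; exact: cvg_avg. Qed.

Lemma smooth_continuous f : smooth setT f -> continuous f.
Proof. by move=> s x; have [] := s [::] x I. Qed.

Lemma smooth_derivable f v x : smooth setT f -> derivable f x v.
Proof. by move=> s; have [_] := s [::] x I; exact. Qed.

Lemma iterD_avg f u vs : smooth setT f -> iterD vs (avg u f) = avg u (iterD vs f).
Proof.
move=> sf; elim: vs => [//|v vs IH]; apply/funext => x /=.
rewrite IH derive_avg //.
- by move=> y; have [] := sf vs y I.
- by move=> y; have [_] := sf vs y I; exact.
- by move=> y; have [] := sf (v :: vs) y I.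
Qed.

Lemma smooth_avg f u : smooth setT f -> smooth setT (avg u f).
Proof.
move=> sf vs x _; rewrite iterD_avg //; split.
  by apply: continuous_avg => y; have [] := sf vs y I.
move=> v; apply: derivable_avg.
- by move=> y; have [] := sf vs y I.
- by move=> y; have [_] := sf vs y I; exact.
- by move=> y; have [] := sf (v :: vs) y I.
Qed.

(** The fundamental theorem of calculus along the segment. It serves twice: the right-hand side is 0
    for a function with period u and - 2 f x for one that changes sign under u. *)
Lemma avg_derive f u x : (forall x, derivable f x u) ->
  continuous (fun x => 'D_u f x) ->
  avg u (fun x => 'D_u f x) x = f (x + u) - f x.
Proof.
move=> df cdf.
have dl s := is_derive_line (df (x + s *: u)).
have cl : continuous (fun s : R => f (x + s *: u)).
  move=> s; apply: differentiable_continuous.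
  by apply/derivable1_diffP; have [] := dl s.
rewrite /avg /Rintegral.
rewrite (@continuous_FTC2 R (fun t => 'D_u f (x + t *: u)) (fun t => f (x + t *: u)) 0 1) //.
- by rewrite /= scale1r scale0r addr0.
- exact: continuous_subspaceT (@continuous_line _ _ _ cdf).
- split.
  + by move=> t _; have [] := dl t.
  + exact: cvg_at_right_filter (cl _).
  + exact: cvg_at_left_filter (cl _).
- by move=> t _; rewrite derive1E; have [_] := dl t.
Qed.

Lemma eq_avg f g u x : f =1 g -> avg u f x = avg u g x.
Proof. by move=> /funext ->. Qed.

Lemma avgD f g u x : continuous f -> continuous g ->
  avg u (fun y => f y + g y) x = avg u f x + avg u g x.
Proof.
move=> cf cg; rewrite /avg (RintegralD measurable01) //;
exact: (continuous_integrable01 (@continuous_line _ _ _ _)).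
Qed.

Lemma continuous_mull f (a : R) : continuous f -> continuous (fun y => a * f y).
Proof. by move=> cf y; apply: cvgM; [exact: cvg_cst | exact: cf]. Qed.

Lemma continuous_sum (I : Type) (r : seq I) (F : I -> V -> R) :
  (forall i, continuous (F i)) -> continuous (fun y => \sum_(i <- r) F i y).
Proof.
move=> cF; elim: r => [|i r IH].
  by under eq_fun do rewrite big_nil; exact: cst_continuous.
under eq_fun do rewrite big_cons.
by move=> y; apply: cvgD; [exact: cF | exact: IH].
Qed.

Lemma avg_sum (I : Type) (r : seq I) (F : I -> V -> R) u x :
  (forall i, continuous (F i)) ->
  avg u (fun y => \sum_(i <- r) F i y) x = \sum_(i <- r) avg u (F i) x.
Proof.
move=> cF; elim: r => [|i r IH].
  under eq_avg do rewrite big_nil.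
  by rewrite big_nil /avg (Rintegral_cst _ measurable01) mul0r.
under eq_avg do rewrite big_cons.
by rewrite big_cons -IH avgD //; exact: continuous_sum.
Qed.

Lemma avgZ f (a : R) u x : continuous f ->
  avg u (fun y => a * f y) x = a * avg u f x.
Proof.
move=> cf; rewrite /avg (RintegralZl _ measurable01) //;
exact: (continuous_integrable01 (@continuous_line _ _ _ _)).
Qed.

Lemma avg_translate f u x (a : V) : avg u f (x + a) = avg u (fun y => f (y + a)) x.
Proof. by rewrite /avg; apply: eq_Rintegral => t _; rewrite addrAC. Qed.

Lemma avg_cst (c : R) u x : avg u (fun=> c) x = c.
Proof.
rewrite /avg (Rintegral_cst _ measurable01).
have := @lebesgue_measure_itv R `[0, 1]; rewrite /= lte_fin ltr01 /= => -> /=.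
by rewrite oppr0 addr0 mulr1.
Qed.

End average.

(** * Point-set topology *)

Lemma second_countableP (T : topologicalType) :
  @second_countable T <-> exists2 B : set (set T), countable B &
    (forall b, B b -> open b) /\
    (forall x U, open U -> U x -> exists2 b, B b & b x /\ b `<=` U).
Proof.
split=> -[B cB [oB bB]]; exists B => //; split=> //.
  move=> x U oU Ux; have [b [Bb bx] bU] := bB x U (open_nbhs_nbhs (conj oU Ux)).
  by exists b.
move=> x U; rewrite nbhsE => -[V [oV Vx] VU].
by have [b Bb [bx bV]] := bB x V oV Vx; exists b => //; exact: subset_trans VU.
Qed.

Lemma second_countable_mx (R : realType) m n :
  @second_countable 'M[R]_(m, n).
Proof.
pose box (ab : 'M[rat]_(m, n) * 'M[rat]_(m, n)) : set 'M[R]_(m, n) :=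
  [set y | forall i j, ratr (ab.1 i j) < y i j < ratr (ab.2 i j)].
apply/second_countableP; exists (range box).
  exact: card_le_trans (card_image_le _ _) (@countableP _ _).
split.
  move=> _ [ab _ <-]; rewrite openE => y boxy.
  rewrite /interior /box; near=> z => i j.
  suff : `]ratr (ab.1 i j), ratr (ab.2 i j)[%classic (z i j).
    by rewrite /= in_itv.
  move: i j; near: z; apply: filter_forall => i; apply: filter_forall => j.
  apply: (@coord_continuous R m n i j y).
  apply: open_nbhs_nbhs; split; first exact: interval_open.
  by rewrite /= in_itv; exact: boxy.
move=> x U oU Ux; have /nbhs_ballP[e /= e0 eU] := open_nbhs_nbhs (conj oU Ux).
have ra i j : exists q : rat, x i j - e < ratr q < x i j.
  have /rat_in_itvoo[q] : x i j - e < x i j by rewrite ltrBlDr ltrDl.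
  by rewrite in_itv /= => ?; exists q.
have rb i j : exists q : rat, x i j < ratr q < x i j + e.
  have /rat_in_itvoo[q] : x i j < x i j + e by rewrite ltrDl.
  by rewrite in_itv /= => ?; exists q.
exists (box (\matrix_(i, j) sval (cid (ra i j)), \matrix_(i, j) sval (cid (rb i j)))).
  by eexists.
split=> [i j|y /= boxy]; rewrite ?mxE /=.
  by have /andP[_ ->] := svalP (cid (ra i j)); have /andP[-> _] := svalP (cid (rb i j)).
apply: eU; split=> // i j; move: (boxy i j); rewrite !mxE => /andP[h1 h2].
have /andP[h3 _] := svalP (cid (ra i j)); have /andP[_ h4] := svalP (cid (rb i j)).
by rewrite /ball /= ltr_norml; apply/andP; split; lra.
Unshelve. all: by end_near. Qed.

Lemma second_countable_prod (S T : topologicalType) :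
  @second_countable S -> @second_countable T -> @second_countable (S * T)%type.
Proof.
move=> /second_countableP[B cB [oB bB]] /second_countableP[C cC [oC bC]].
apply/second_countableP; exists [set p.1 `*` p.2 | p in B `*` C].
  apply: card_le_trans (card_image_le _ _) _; exact: countableX.
split.
  move=> _ [[b c] [/= Bb Cc] <-].
  rewrite openE => -[x y] [/= bx cy]; exists (b, c) => //=.
  by split; apply: open_nbhs_nbhs; split => //; [exact: oB | exact: oC].
move=> [x y] U oU Uxy.
have [[P Q] /= [Px Qy] PQU] := open_nbhs_nbhs (conj oU Uxy).
move: Px Qy; rewrite !nbhsE => -[P' [oP' P'x] PP] [Q' [oQ' Q'y] QQ].
have [b Bb [bx bP]] := bB x P' oP' P'x.
have [c Cc [cy cQ]] := bC y Q' oQ' Q'y.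
exists (b `*` c); first by exists (b, c).
split=> // -[u v] [/= bu cv]; apply: PQU; split => /=.
  exact/PP/bP.
exact/QQ/cQ.
Qed.

Lemma second_countable_initial (S : choiceType) (T : topologicalType) (f : S -> T) :
  @second_countable T -> @second_countable (initial_topology f).
Proof.
move=> /second_countableP[B cB [oB bB]].
apply/second_countableP; exists [set f @^-1` b | b in B].
  exact: card_le_trans (card_image_le _ _) cB.
split=> [_ [b Bb <-]|x U [V oV <-] Vx]; first by exists b => //; exact: oB.
have [b Bb [bx bV]] := bB (f x) V oV Vx.
by exists (f @^-1` b); [exists b | split => // y; exact: bV].
Qed.

Lemma second_countable_open_map (S T : topologicalType) (f : S -> T) :
  continuous f -> (forall U, open U -> open (f @` U)) ->
  (forall y, exists x, f x = y) ->
  @second_countable S -> @second_countable T.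
Proof.
move=> /continuousP cf of_ sf /second_countableP[B cB [oB bB]].
apply/second_countableP; exists [set f @` b | b in B].
  exact: card_le_trans (card_image_le _ _) cB.
split=> [_ [b Bb <-]|y U oU]; first exact/of_/oB.
have [x <-] := sf y => Ufx.
have [b Bb [bx bU]] := bB x _ (cf U oU) Ufx.
exists (f @` b); first by exists b.
by split; [exists x | move=> _ [z bz <-]; exact: bU].
Qed.

Lemma hausdorff_injective (S T : topologicalType) (f : S -> T) :
  continuous f -> injective f -> hausdorff_space T -> hausdorff_space S.
Proof.
move=> cf fI hT p q pq; apply: fI; apply: hT => P Q fP fQ.
have [x [Px Qx]] := pq _ _ (cf p P fP) (cf q Q fQ).
by exists (f x).
Qed.

Lemma connected_normed (R : realType) (V : normedModType R) : connected [set: V].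
Proof.
have -> : [set: V] = \bigcup_(x in [set: V]) [set t *: x | t in `[0 : R, 1]%classic].
  apply/seteqP; split => // x _; exists x => //; exists 1; last by rewrite scale1r.
  by rewrite /= in_itv /= ler01 lexx.
apply: bigcup_connected.
  by exists 0 => x _; exists 0; [rewrite /= in_itv /= ler01 lexx | rewrite scale0r].
move=> x _; apply: connected_continuous_connected; first exact: segment_connected.
by apply: continuous_subspaceT => t; apply: cvgZr_tmp; exact: cvg_id.
Qed.

Lemma connected_prod (S T : topologicalType) :
  connected [set: S] -> connected [set: T] -> connected [set: S * T].
Proof.
move=> cS cT; have [[[a b]]|nx] := pselect (inhabited (S * T)%type); last first.
  rewrite (_ : setT = set0); first exact: connected0.
  by apply/seteqP; split => // x _; apply: nx; exists.
(* The fibre over s together with the horizontal line at height b: a connected cross, and all these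
   crosses contain (a, b). *)
pose E s : set (S * T) := range (fun t => (s, t)) `|` range (fun s => (s, b)).
have -> : [set: S * T] = \bigcup_(s in [set: S]) E s.
  by apply/seteqP; split => // -[s t] _; exists s => //; left; exists t.
apply: bigcup_connected; first by exists (a, b) => s _; right; exists a.
move=> s _; apply: connectedU.
- by exists (s, b); split; [exists b | exists s].
- apply: connected_continuous_connected => //; apply: continuous_subspaceT.
  by move=> t; apply: cvg_pair; [exact: cvg_cst | exact: cvg_id].
- apply: connected_continuous_connected => //; apply: continuous_subspaceT.
  by move=> t; apply: cvg_pair; [exact: cvg_id | exact: cvg_cst].
Qed.

Section aux.
Context {R : realType}.

Lemma coord_le_norm m n (A : 'M[R]_(m, n)) i j : `|A i j| <= `|A|.
Proof. by rewrite [leRHS]/Num.Def.normr/= mx_normrE (le_bigmax _ (fun k => `|A k.1 k.2|) (i, j)). Qed.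

Lemma continuous_mulmxr m n p (C : 'M[R]_(n, p)) : continuous (fun A : 'M[R]_(m, n) => A *m C).
Proof.
move=> A; apply: continuous_mx => i j.
apply: (@ratfun_continuous _ _ setT) => //.
apply: ratmxM; last exact: ratmx_cst.
move=> k l; apply: ratfun_lin; first exact: coord_continuous.
by move=> a x y; rewrite !mxE.
Qed.

Lemma jacobian_affine n m (f : 'rV[R]_n -> 'rV[R]_m) (x : 'rV[R]_n) (C : 'M[R]_(n, m)) :
  (\forall y \near x, f y = f x + (y - x) *m C) -> 'J f x = C.
Proof.
move=> fC; rewrite /jacobian.
have -> : 'd f x = mulmxr C :> (_ -> _).
  apply: diff_unique; first exact: continuous_mulmxr.
  apply/eqaddoP => e e0.
  have /near_translate : nbhs (x : 'rV[R]_n : normedModType R) [set y | f y = f x + (y - x) *m C] := fC.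
  apply: filterS => h /=; rewrite addrK => fh.
  rewrite -[X in `|X|]/(f (h + x) - (f x + h *m C)) fh subrr normr0.
  by rewrite mulr_ge0 // ltW.
by apply/row_matrixP => i; rewrite rowE mul_rV_lin1 /= -rowE.
Qed.

Lemma jacobian_affineT p m (f : 'rV[R]_p -> 'rV[R]_m) (z : 'rV[R]_p) (C : 'M[R]_(p, m)) :
  (forall w, f w = f z + (w - z) *m C) -> 'J f z = C.
Proof.
move=> H; apply: jacobian_affine.
exact: (@filterS _ _ (nbhs_filter (z : 'rV[R]_p)) setT _ (fun w _ => H w) filterT).
Qed.

(** [U'] need not lie in U, because the iterated derivatives are those of the total function f and
    do not refer to the set. *)
Lemma smooth_local (V W : normedModType R) (U : set V) (f : V -> W) :
  (forall x, U x -> exists2 U', U' x & smooth U' f) -> smooth U f.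
Proof. by move=> H vs x /H [U' Ux s]; exact: s. Qed.

Lemma smooth_idD n (a : 'rV[R]_n) : smooth setT (fun x => x + a).
Proof.
apply: ratmx_smooth; first exact: openT.
move=> i j; under eq_fun do rewrite mxE.
apply: ratfunD; last exact: ratfun_cst.
apply: ratfun_lin; first exact: coord_continuous.
by move=> c x y; rewrite !mxE.
Qed.

End aux.

(** * The torus *)

Section torus.
Context {R : realType} {d : nat}.
Implicit Types x y a n : 'rV[R]_d.

Definition lattice x : bool := [forall i, x 0 i \is a Num.int].

Lemma latticeP x : reflect (forall i, x 0 i \is a Num.int) (lattice x).
Proof. exact: forallP. Qed.

Lemma lattice0 : lattice 0.
Proof. by apply/latticeP => i; rewrite mxE rpred0. Qed.

Lemma latticeD x y : lattice x -> lattice y -> lattice (x + y).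
Proof. by move=> /latticeP lx /latticeP ly; apply/latticeP => i; rewrite mxE rpredD. Qed.

Lemma latticeN x : lattice (- x) = lattice x.
Proof. by apply/latticeP/latticeP => l i; have := l i; rewrite mxE rpredN. Qed.

Lemma lattice_small x : lattice x -> `|x| < 1 -> x = 0.
Proof.
move=> /latticeP lx x1; apply/rowP => i; rewrite mxE; apply/eqP; apply: contraTT isT => xi.
have := norm_intr_ge1 (lx i) xi; rewrite leNgt => /negP; case.
exact: le_lt_trans (coord_le_norm _ _ _) x1.
Qed.

Definition torus_rel x y := lattice (x - y).

Lemma torus_refl : reflexive torus_rel.
Proof. by move=> x; rewrite /torus_rel subrr lattice0. Qed.

Lemma torus_sym : symmetric torus_rel.
Proof. by move=> x y; rewrite /torus_rel -latticeN opprB. Qed.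

Lemma torus_trans : transitive torus_rel.
Proof.
by move=> y x z xy yz; rewrite /torus_rel -(subrKA y); apply: latticeD.
Qed.

Canonical torus_equiv := EquivRel torus_rel torus_refl torus_sym torus_trans.

Definition torus_quot := {eq_quot torus_equiv}.
HB.instance Definition _ := Choice.on torus_quot.
HB.instance Definition _ := EqQuotient.on torus_quot.
Definition torus := quotient_topology torus_quot.
HB.instance Definition _ := Topological.on torus.

Definition tproj x : torus := \pi_torus x.

Lemma tproj_eqP x y : tproj x = tproj y <-> lattice (x - y).
Proof. by split=> [/eqmodP//|xy]; apply/eqmodP. Qed.

Lemma tproj_surj (p : torus) : exists x, tproj x = p.
Proof. by exists (repr p); rewrite /tproj reprK. Qed.

Lemma tproj_lattice x n : lattice n -> tproj (x + n) = tproj x.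
Proof. by move=> ln; apply/tproj_eqP; rewrite addrAC subrr add0r. Qed.

Lemma tproj_continuous : continuous tproj.
Proof. exact: pi_continuous. Qed.

Lemma preimage_tproj_image (U : set 'rV[R]_d) x :
  (tproj @` U) (tproj x) <-> exists2 n, lattice n & U (x + n).
Proof.
split=> [[y Uy /esym/tproj_eqP]|[n ln Un]].
  by rewrite -latticeN opprB => l; exists (y - x) => //; rewrite addrC subrK.
by exists (x + n) => //; exact: tproj_lattice.
Qed.

(** The preimage of the image is the union of the lattice translates of U. *)
Lemma tproj_open (U : set 'rV[R]_d) : open U -> open (tproj @` U).
Proof.
move=> oU; rewrite /open/= /quotient_open.
have -> : tproj @^-1` (tproj @` U) = \bigcup_(n in [set n | lattice n]) [set x | U (x + n)].
  apply/seteqP; split=> x; first by case/preimage_tproj_image => n ? ?; exists n.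
  by case=> n ? ?; apply/preimage_tproj_image; exists n.
apply: bigcup_open => n _.
have /continuousP : continuous (fun x => x + n).
  exact: continuous_addr.
exact.
Qed.

Lemma torus_second_countable : @second_countable torus.
Proof.
apply: (second_countable_open_map tproj_continuous tproj_open tproj_surj).
exact: second_countable_mx.
Qed.

Lemma torus_connected : connected [set: torus].
Proof.
have -> : [set: torus] = tproj @` setT.
  by apply/seteqP; split => // p _; have [x <-] := tproj_surj p; exists x.
apply: connected_continuous_connected; first exact: connected_normed.
exact: continuous_subspaceT tproj_continuous.
Qed.

Lemma torus_compact : compact [set: torus].
Proof.
pose K : set 'rV[R]_d := [set v | forall i, v ord0 i \in `[0, 1]].
have cK : compact K.
  rewrite /K; apply: (@rV_compact R d (fun=> `[0, 1]%classic)).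
  by move=> _; exact: segment_compact.
have -> : [set: torus] = tproj @` K.
  apply/seteqP; split => // p _; have [x <-] := tproj_surj p.
  exists (x - \row_i (Num.floor (x 0 i))%:~R); last first.
    rewrite tproj_lattice // latticeN; apply/latticeP => i; rewrite mxE; exact: intr_int.
  move=> i; rewrite !mxE in_itv /=.
  have /andP[h1 h2] := mem_rg1_floor (x 0 i).
  by rewrite subr_ge0 h1 lerBlDr addrC ltW.
apply: continuous_compact => //.
exact: continuous_subspaceT tproj_continuous.
Qed.

(** If x and y are not congruent, some coordinate r of x - y is strictly between two consecutive
    integers. Balls of half the distance from r to the nearest integer keep that coordinate of all
    differences strictly between them, hence never integral. *)
Lemma torus_hausdorff : hausdorff_space torus.
Proof.
rewrite open_hausdorff => p q; have [x <-] := tproj_surj p; have [y <-] := tproj_surj q.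
move=> /eqP xy.
have [i ni] : exists i, (x - y) 0 i \isn't a Num.int.
  apply/existsP; rewrite -negb_forall; apply: contra_notN xy => /forallP l.
  by apply/tproj_eqP/latticeP.
set r := (x - y) 0 i in ni; pose f : R := (Num.floor r)%:~R.
have /andP[h1 h2] := mem_rg1_floor r.
have h3 : f < r by rewrite lt_neqAle h1 andbT; move: ni; rewrite intrEfloor => ->.
pose e := Num.min (r - f) (f + 1 - r) / 2.
have m0 : 0 < Num.min (r - f) (f + 1 - r) by rewrite lt_min !subr_gt0 h3.
have e0 : 0 < e by rewrite divr_gt0.
have em : e * 2 = Num.min (r - f) (f + 1 - r) by rewrite divfK.
have e1 : e * 2 <= r - f by rewrite em ge_min lexx.
have e2 : e * 2 <= f + 1 - r by rewrite em ge_min lexx orbT.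
exists (tproj @` ball x e, tproj @` ball y e).
  by split; apply/mem_set; [exists x | exists y] => //; exact: ballxx.
split; try exact/tproj_open/ball_open.
apply/eqP/seteqP; split => // _ [[z [_ zx] <-] [w [_ wy] /tproj_eqP /latticeP /(_ i)]].
have := zx 0 i; have := wy 0 i;
  rewrite /ball /= !ltr_norml !mxE => /andP[a1 a2] /andP[b1 b2].
move=> /intrP[k kE]; rewrite /r !mxE in e1 e2 h3 *.
have k1 : f < (- k)%:~R by rewrite intrN -kE; lra.
have k2 : (- k)%:~R < f + 1 by rewrite intrN -kE; lra.
move: k1 k2; rewrite /f -intrD1 !ltr_int ltzD1 => k1 k2.
by have := lt_le_trans k1 k2; rewrite ltxx.
Qed.

End torus.

(** * Charts and orientation of the torus *)

Section torus_atlas.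
Context {R : realType} {d : nat}.
Local Notation V := 'rV[R]_d.
Local Notation torus := (@torus R d).
Implicit Types x y a n : V.

(** Radius 1/2 for the sup norm: two points of the ball differ by less than 1 in every coordinate,
    so they are congruent modulo the lattice only if equal. *)
Definition half_ball a : set V := [set x | `|x - a| < 2^-1].

Lemma half_ball_open a : open (half_ball a).
Proof.
have -> : half_ball a = ball a 2^-1.
  rewrite -ball_normE; apply/seteqP; split => x; rewrite /half_ball /ball_ /= distrC //.
exact: ball_open.
Qed.

Lemma half_ball_center a : half_ball a a.
Proof. by rewrite /half_ball /= subrr normr0 invr_gt0. Qed.

(** The default value [repr p] also projects to p, so [tcoordK] holds outside the chart domain as
    well. *)
Definition tcoord a (p : torus) : V :=
  xget (repr p) [set x | tproj x = p /\ half_ball a x].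

Lemma tcoordK a p : tproj (tcoord a p) = p.
Proof.
by rewrite /tcoord; case: xgetP => [x _ []//|_]; rewrite /tproj reprK.
Qed.

Lemma half_ball_inj a x y : half_ball a x -> half_ball a y ->
  tproj x = tproj y -> x = y.
Proof.
rewrite /half_ball /= => xa ya /tproj_eqP l.
apply/eqP; rewrite -subr_eq0; apply/eqP; apply: lattice_small l _.
have := ler_distD a x y; rewrite [`|a - y|]distrC; move: xa ya; lra.
Qed.

Lemma tcoord_id a x : half_ball a x -> tcoord a (tproj x) = x.
Proof.
move=> xa; rewrite /tcoord; case: xgetP => [y _ []|/(_ x)[]//].
by move=> yx ya; exact: half_ball_inj ya xa yx.
Qed.

(** One chart for each centre a. All of them share the parametrization [tproj], which is why
    transitions are locally lattice translations. *)
Definition torus_atlas : atlas V torus :=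
  @Atlas R V torus V (fun a => tproj @` half_ball a) tcoord (fun=> tproj).

Lemma torus_chart_dom (a : torus_atlas) x :
  half_ball a x -> chart_dom a (tproj x).
Proof. by move=> xa; exists x. Qed.

Lemma torus_chart_img (a : torus_atlas) U :
  chart_img a U = half_ball a `&` tproj @^-1` U.
Proof.
apply/seteqP; split => [_ [p [[x xa <-] Ux] <-]|x [xa Ux]].
  by rewrite /chart_coord /= tcoord_id.
by exists (tproj x); [split => //; exists x | rewrite /chart_coord /= tcoord_id].
Qed.

Lemma open_torus_chart_img (a : torus_atlas) U : open U -> open (chart_img a U).
Proof.
move=> oU; rewrite torus_chart_img; apply: openI; first exact: half_ball_open.
by move/continuousP : (@tproj_continuous R d); exact.
Qed.

Lemma tcoord_continuous a : {within tproj @` half_ball a, continuous (tcoord a)}.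
Proof.
apply/subspace_continuousP => _ [x xa <-] W /=;
  rewrite /from_subspace tcoord_id // nbhsE => -[W' [oW W'x] WW].
change (nbhs (tproj x) [set u | (tproj @` half_ball a) u -> W (tcoord a u)]).
rewrite nbhsE; exists (tproj @` (W' `&` half_ball a)).
  split; last by exists x.
  by apply: tproj_open; apply: openI => //; exact: half_ball_open.
by move=> _ [y [Wy ya] <-] _; rewrite tcoord_id //; exact: WW.
Qed.

(** The translation n is only locally constant: the overlap of two charts can have several
    components with different n. *)
Lemma torus_transition a b x : (tproj @` half_ball b) (tproj x) ->
  exists2 n, lattice n & exists2 U, open_nbhs x U &
    forall y, U y -> tcoord b (tproj y) = y + n.
Proof.
move=> /preimage_tproj_image [n ln bn]; exists n => //.
exists [set y | half_ball b (y + n)].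
  split=> //; have /continuousP : continuous (fun x : V => x + n) by exact: continuous_addr.
  by move=> cn; exact: cn _ (@half_ball_open b).
by move=> y yn; rewrite -(tproj_lattice y ln) tcoord_id.
Qed.

Lemma torus_smooth_manifold : is_smooth_manifold torus_atlas.
Proof.
split; [exact: torus_hausdorff | exact: torus_second_countable | split].
- move=> p; have [x <-] := tproj_surj p; exists x.
  exact/torus_chart_dom/half_ball_center.
- move=> a; split; first exact/tproj_open/half_ball_open.
  exact/open_torus_chart_img/openT.
- by move=> a p _; exact: tcoordK.
- move=> a; split; first exact: tcoord_continuous.
  exact: continuous_subspaceT tproj_continuous.
- move=> a b; rewrite smooth_onE; apply: smooth_local => x.
  rewrite torus_chart_img => -[_ /(torus_transition a) [n _ [U [oU Ux] Un]]].
  exists U => //; apply: (@smooth_eq _ _ _ U (fun y => y + n)) => //.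
    by move=> y Uy; rewrite /= /chart_coord /= Un.
  exact: smooth_sub (smooth_idD n).
Qed.

Lemma torus_jacobian (a b : torus_atlas) p : chart_dom a p -> chart_dom b p ->
  transition_jacobian a b p = 1%:M.
Proof.
move=> [x xa <-] xb; rewrite /transition_jacobian /chart_coord /chart_param /=.
rewrite tcoord_id //; have [n _ [U oU Un]] := torus_transition a xb.
apply: jacobian_affine; apply: filterS (open_nbhs_nbhs oU) => y Uy.
by rewrite mulmx1 /= (Un y Uy) (Un x oU.2) addrAC subrKC.
Qed.

Lemma torus_oriented (a b : torus_atlas) p : chart_dom a p -> chart_dom b p ->
  0 < \det (transition_jacobian a b p).
Proof. by move=> pa pb; rewrite torus_jacobian // det1. Qed.

Definition torus_manifold : closed_oriented_manifold R d :=
  ClosedOrientedManifold torus_smooth_manifold torus_compact torus_connected torus_oriented.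

End torus_atlas.

(** * Lifting paths to the universal cover *)

Section lifting.
Context {R : realType} {d : nat}.
Local Notation V := 'rV[R]_d.
Local Notation torus := (@torus R d).
Implicit Types (x y z a n : V) (p q : torus).

(** The displacement from p to a close point q. It is computed at a representative of p, but by
    [short_id] it is the same at any other. *)
Definition short p q : V := tcoord (repr p) q - repr p.

Definition close p q := exists x y, [/\ tproj x = p, tproj y = q & half_ball x y].

Lemma tproj_short x p q : tproj x = p -> tproj (x + short p q) = q.
Proof.
move=> xp; have /tproj_eqP l : tproj x = tproj (repr p) by rewrite {2}/tproj reprK.
rewrite /short addrCA tproj_lattice //; exact: tcoordK.
Qed.

Lemma short_id x y : half_ball x y -> short (tproj x) (tproj y) = y - x.
Proof.
move=> xy; set r := repr (tproj x).
have /tproj_eqP l : tproj r = tproj x by rewrite /tproj reprK.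
have -> : tproj y = tproj (y + (r - x)) by rewrite tproj_lattice.
have e : y + (r - x) - r = y - x by apply/rowP => i; rewrite !mxE; ring.
by rewrite /short -/r tcoord_id ?e // /half_ball /= e.
Qed.

Lemma shortpp p : short p p = 0.
Proof.
have [x <-] := tproj_surj p.
by rewrite short_id ?subrr //; exact: half_ball_center.
Qed.

Lemma short_continuous (u : torus * torus) : close u.1 u.2 ->
  {for u, continuous (fun u => short u.1 u.2)}.
Proof.
move: u => [p q] /= [x [y [<- <-]]] xy.
apply/cvgrPdist_le => /= eps eps0; rewrite short_id //.
(* Moving both ends by less than e must keep their distance below 1/2, so that [short_id] still
   applies, and change their difference by at most eps. *)
have [e e0 [he hee]] : exists2 e, 0 < e & `|y - x| + e + e < 2^-1 /\ e + e <= eps.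
  exists (Num.min ((2^-1 - `|y - x|) / 3) (eps / 2)).
    by rewrite lt_min; move: xy; rewrite /half_ball /=; lra.
  move: xy; rewrite /half_ball /= => xy; set m := Num.min _ _.
  have m1 : m <= (2^-1 - `|y - x|) / 3 by rewrite ge_min lexx.
  have m2 : m <= eps / 2 by rewrite ge_min lexx orbT.
  by clearbody m; split; lra.
exists (tproj @` ball x e, tproj @` ball y e) => /=.
  split; apply: open_nbhs_nbhs; split; try exact/tproj_open/ball_open.
    by exists x => //; exact: ballxx.
  by exists y => //; exact: ballxx.
move=> [_ _] [/= [x' xx <-] [y' yy <-]].
move: xx yy; rewrite -!ball_normE /half_ball /= => xx yy.
have h1 : `|y' - x'| < 2^-1.
  rewrite -(subrKA y) (le_lt_trans (ler_normD _ _)) //.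
  have := ler_normD (y - x) (x - x'); rewrite subrKA [`|y' - y|]distrC; lra.
rewrite short_id //.
rewrite (_ : y - x - (y' - x') = y - y' - (x - x')).
  by have := ler_normB (y - y') (x - x'); lra.
by apply/rowP => i; rewrite !mxE; ring.
Qed.

Section star.
Context {E : normedModType R} (K : set E) (f : E -> torus).
Hypothesis compactK : compact K.
Hypothesis boundK : forall u, K u -> `|u| <= 1.
Hypothesis starK : forall (t : R) u, t \in `[0, 1] -> K u -> K (t *: u).
Hypothesis cf : {within K, continuous f}.

(** A Lebesgue number for f: near each u the values of f lift to a ball of radius 1/4, and two
    points of such a ball are less than 1/2 apart. The star-shaped K will be the interval, for
    paths, and the square, for homotopies. *)
Lemma uniformly_close : exists N : nat,
  forall u v, K u -> K v -> `|u - v| <= N.+1%:R^-1 -> close (f u) (f v).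
Proof.
have /compact_near_coveringP/near_covering_withinP nc := compactK.
pose P (N : nat) (u : E) := forall v, K v -> `|u - v| <= N.+1%:R^-1 -> close (f u) (f v).
suff [N _ HN] : \forall N \near \oo, K `<=` P N.
  by exists N => u v Ku; apply: (HN N (leqnn N)) Ku v.
apply: nc => u Ku.
have [x xu] := tproj_surj (f u).
move/subspace_continuousP : cf => /(_ u Ku) cfu.
have U4 : nbhs (f u) (tproj @` ball x 4^-1).
  apply: open_nbhs_nbhs; split; first exact/tproj_open/ball_open.
  by exists x => //; apply: ballxx.
have [r /= r0 Hr] : nbhs_ball u [set v | K v -> (tproj @` ball x 4^-1) (f v)].
  by rewrite nbhs_ballE; exact: cfu _ U4.
have r0' : 0 < r := r0.
have H v : K v -> `|u - v| < r -> exists2 y, `|x - y| < 4^-1 & tproj y = f v.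
  move=> Kv uv; have := Hr v; rewrite -ball_normE /ball_ /= => /(_ uv Kv) [y].
  by rewrite -ball_normE => ? <-; exists y.
exists (ball u (r / 2), [set N : nat | N.+1%:R^-1 < r / 2]) => /=.
  split; first by apply: nbhsx_ballx; rewrite divr_gt0.
  by near=> N => /=; near: N;
    apply: near_infty_natSinv_lt (PosNum (divr_gt0 r0 (ltr0n _ 2))).
move=> [v N] [/= uv Nr] Kv w Kw vw.
move: uv; rewrite -ball_normE /ball_ /= => uv.
have [y yx <-] : exists2 y, `|x - y| < 4^-1 & tproj y = f v by apply: H => //;
  move: uv r0'; lra.
have [z zx <-] : exists2 y, `|x - y| < 4^-1 & tproj y = f w.
  apply: H => //; have vw' : `|v - w| < r / 2 := le_lt_trans vw Nr.
  by have := ler_distD v u w; lra.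
exists y, z; split=> //; rewrite /half_ball /=.
by have := ler_distD x z y; rewrite [`|z - x|]distrC; lra.
Unshelve. all: by end_near. Qed.

(* The lift is a telescoping sum of short displacements along the segment
   from the base point, hence continuous without any gluing. *)
Lemma lift_star (x0 : V) : K 0 -> tproj x0 = f 0 ->
  exists g : E -> V, [/\ {within K, continuous g}, g 0 = x0 &
    forall u, K u -> tproj (g u) = f u].
Proof.
move=> K0 fx0; have [N HN] := uniformly_close.
pose s (k : nat) : R := k%:R / N.+1%:R.
have s01 k : (k <= N.+1)%N -> s k \in `[0, 1].
  by move=> kN; rewrite in_itv /= divr_ge0 // ler_pdivrMr // mul1r ler_nat.
pose g := fix g k u := if k is k'.+1 then
  g k' u + short (f (s k' *: u)) (f (s k'.+1 *: u)) else x0.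
have gl k u : K u -> (k <= N.+1)%N -> tproj (g k u) = f (s k *: u).
  move=> Ku; elim: k => [_|k IH kN] /=; first by rewrite /s mul0r scale0r.
  by apply: tproj_short; apply: IH; exact: ltnW.
have gc k : (k <= N.+1)%N -> {within K, continuous (g k)}.
  elim: k => [_|k IH kN]; first exact/continuous_subspaceT/cst_continuous.
  have c1 (t : R) : t \in `[0, 1] -> {within K, continuous (fun u => f (t *: u))}.
    move=> t01; apply: (comp_within _ _ cf) => [|u Ku]; last exact: starK.
    by apply: continuous_subspaceT => u; apply: cvgZl_tmp; exact: cvg_id.
  have /subspace_continuousP ck := IH (ltnW kN).
  have /subspace_continuousP c2 := c1 _ (s01 _ (ltnW kN)).
  have /subspace_continuousP c3 := c1 _ (s01 _ kN).
  apply/subspace_continuousP => u Ku; apply: cvgD; first exact: ck.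
  have cl : close (f (s k *: u)) (f (s k.+1 *: u)).
    apply: HN; [exact/starK/Ku/s01/ltnW | exact/starK/Ku/s01 |].
    rewrite -scalerBl normrZ distrC /s -mulrBl -natrB // subSnn mul1r.
    rewrite ger0_norm ?invr_ge0 // ler_piMr ?invr_ge0 //; exact: boundK.
  have cp : (f (s k *: v), f (s k.+1 *: v)) @[v --> within K (nbhs u)] -->
      (f (s k *: u), f (s k.+1 *: u)).
    exact: (@cvg_pair _ _ _ _ _ _ _ _ _ _ _ (c2 u Ku) (c3 u Ku)).
  have sc : short v.1 v.2 @[v --> (f (s k *: u), f (s k.+1 *: u))] -->
      short (f (s k *: u)) (f (s k.+1 *: u)).
    exact: (short_continuous (u := (_, _)) cl).
  exact: (@cvg_comp _ _ _ _ _ _ _ _ cp sc).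
exists (g N.+1); split; first exact: gc.
  elim: N.+1 => [//|k IH] /=; by rewrite IH !scaler0 shortpp addr0.
by move=> u Ku; rewrite gl // /s divff // scale1r.
Qed.

End star.

Local Notation I01 := (`[0 : R, 1 : R]%classic).

(** Each coordinate of a - b is continuous, integral and 0 at the start. Were it nonzero at 1, it
    would take the value 1/2 or -1/2 by the intermediate value theorem. *)
Lemma unique_path_lift (a b : R -> V) :
  {within I01, continuous a} -> {within I01, continuous b} -> a 0 = b 0 ->
  (forall t, t \in `[0, 1] -> tproj (a t) = tproj (b t)) -> a 1 = b 1.
Proof.
move=> ca cb ab0 ab; apply/rowP => i; apply/eqP; rewrite -subr_eq0.
pose phi t := a t 0 i - b t 0 i.
have z01 : (0 : R) \in `[0, 1] by rewrite in_itv /= lexx ler01.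
have cphi : {within I01, continuous phi}.
  move/subspace_continuousP : ca => ca; move/subspace_continuousP : cb => cb.
  apply/subspace_continuousP => t t01; apply: cvgB.
    apply: (@cvg_comp _ _ _ a (fun M : V => M 0 i)); first exact: ca.
    exact: coord_continuous.
  apply: (@cvg_comp _ _ _ b (fun M : V => M 0 i)); first exact: cb.
  exact: coord_continuous.
have iphi t : t \in `[0, 1] -> phi t \is a Num.int.
  by move=> /ab /tproj_eqP /latticeP /(_ i); rewrite !mxE.
have phi0 : phi 0 = 0 by rewrite /phi ab0 subrr.
have half (v : R) : v \is a Num.int -> `|v| = 2^-1 -> False.
  move=> iv v2; have v0 : v != 0 by rewrite -normr_eq0 v2 invr_eq0 pnatr_eq0.
  by have := norm_intr_ge1 iv v0; rewrite v2; lra.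
apply: contraTT isT => phi1.
have o01 : (1 : R) \in `[0, 1] by rewrite in_itv /= lexx ler01.
have n1 := norm_intr_ge1 (iphi _ o01) phi1.
have [p0|p0] := leP 0 (phi 1).
  rewrite ger0_norm // in n1.
  have [|c c01 pc] := @IVT R phi 0 1 2^-1 ler01 cphi.
    by rewrite phi0 ge_min le_max; apply/andP; split; apply/orP; [left|right]; lra.
  by case: (half _ (iphi c c01)); rewrite pc ger0_norm // invr_ge0.
rewrite ltr0_norm // in n1.
have [|c c01 pc] := @IVT R phi 0 1 (- 2^-1) ler01 cphi.
  by rewrite phi0 ge_min le_max; apply/andP; split; apply/orP; [right|left]; lra.
by case: (half _ (iphi c c01)); rewrite pc normrN ger0_norm // invr_ge0.
Qed.

End lifting.

(** * Lifts of homotopy classes of paths *)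

Section hlift.
Context {R : realType} {d : nat}.
Local Notation V := 'rV[R]_d.
Local Notation torus := (@torus R d).
Local Notation I01 := (`[0 : R, 1 : R]%classic).
Implicit Types (x y z a n : V) (p q r : torus).

Definition lifts p q (c : cpath R p q) x y := exists ct : R -> V,
  [/\ {within I01, continuous ct}, ct 0 = x, ct 1 = y &
      forall t, t \in `[0, 1] -> tproj (ct t) = c t].

(** A relation, stated through some representative; [hlift_exists] and [hlift_unique] make the end
    point a function of the class and of the starting point. *)
Definition hlift p q (P : hpath R p q) x y :=
  exists2 c : cpath R p q, P = \pi_(hpath R p q) c & lifts c x y.

Let z01 : (0 : R) \in `[0, 1]. Proof. by rewrite in_itv /= lexx ler01. Qed.
Let o01 : (1 : R) \in `[0, 1]. Proof. by rewrite in_itv /= lexx ler01. Qed.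

Lemma hlift_ends p q (P : hpath R p q) x y : hlift P x y -> tproj x = p /\ tproj y = q.
Proof.
by move=> [c _ [ct [_ <- <- ctE]]]; rewrite !ctE // cpath0 cpath1.
Qed.

(** R^d is simply connected: the straight-line homotopy between the two lifts projects to one
    between the paths. *)
Lemma lifts_homotopic p q (c c' : cpath R p q) x y :
  lifts c x y -> lifts c' x y -> path_homotopic c c'.
Proof.
move=> [a [ca a0 a1 ac]] [b [cb b0 b1 bc]].
pose H (u : R * R) := a u.2 + u.1 *: (b u.2 - a u.2).
exists (tproj \o H); split.
- apply: (@comp_within _ _ _ _ setT) => //; last first.
    exact: continuous_subspaceT tproj_continuous.
  have proj2 (g : R -> V) : {within I01, continuous g} ->
      {within I01 `*` I01, continuous (g \o snd)}.
    move=> cg; apply: (comp_within _ _ cg); last by move=> u [].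
    by apply: continuous_subspaceT => u; exact: cvg_snd.
  have /subspace_continuousP ca2 := proj2 a ca.
  have /subspace_continuousP cb2 := proj2 b cb.
  apply/subspace_continuousP => u K; apply: cvgD; first exact: ca2.
  apply: cvgZ; last by apply: cvgB; [exact: cb2 | exact: ca2].
  by apply: cvg_within_filter; exact: cvg_fst.
- by move=> t t01; rewrite /H /= scale0r addr0 scale1r subrKC ac ?bc.
- by move=> s s01; rewrite /H /= a0 b0 a1 b1 !subrr !scaler0 !addr0 -a0 -a1 !ac // cpath0 cpath1.
Qed.

Lemma hlift_eq p q (P Q : hpath R p q) x y : hlift P x y -> hlift Q x y -> P = Q.
Proof.
move=> [c -> lc] [c' -> lc']; apply/hpath_eqP; exact: lifts_homotopic lc lc'.
Qed.

Lemma hlift_cat p q r (P : hpath R p q) (Q : hpath R q r) x y z :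
  hlift P x y -> hlift Q y z -> hlift (hcat P Q) x z.
Proof.
move=> [c -> [a [ca a0 a1 ac]]] [c' -> [b [cb b0 b1 bc]]].
rewrite hcatE; exists (cpath_cat c c') => //.
exists (cpath_cat (CPath ca a0 a1) (CPath cb b0 b1)).
split; [exact: cpath_cts | exact: cpath0 | exact: cpath1 |].
move=> t; rewrite in_itv /= /cat_fun => t01; case: ifPn => th.
  by rewrite ac // in_itv /=; lra.
by rewrite bc // in_itv /=; move: th; rewrite -ltNge; lra.
Qed.

Lemma hlift_translate p q (P : hpath R p q) x y n : lattice n ->
  hlift P x y -> hlift P (x + n) (y + n).
Proof.
move=> ln [c -> [a [ca a0 a1 ac]]]; exists c => //.
exists (fun t => a t + n); split; rewrite ?a0 ?a1 //.
  move/subspace_continuousP : ca => ca.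
  by apply/subspace_continuousP => t t01; apply: cvgD; [exact: ca | exact: cvg_cst].
by move=> t t01; rewrite tproj_lattice // ac.
Qed.

Lemma hlift_exists p q (P : hpath R p q) x : tproj x = p -> exists y, hlift P x y.
Proof.
move=> xp; rewrite -[P]reprK; move: (repr P) => c.
have [g [cg g0 gc]] : exists g : R -> V, [/\ {within I01, continuous g}, g 0 = x &
    forall u, I01 u -> tproj (g u) = c u].
  apply: (@lift_star _ _ R^o I01 c).
  - exact: segment_compact.
  - by move=> u /=; rewrite in_itv /= => /andP[u0 u1]; rewrite ger0_norm.
  - move=> t u /=; rewrite !in_itv /= => /andP[t0 t1] /andP[u0 u1].
    by rewrite mulr_ge0 //= mulr_ile1.
  - exact: cpath_cts.
  - exact: z01.
  - by rewrite cpath0.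
by exists (g 1); exists c => //; exists g.
Qed.

(** The homotopy is lifted over the square. On the two sides where it is constant so is the lift,
    and the other two sides lift the two representatives; uniqueness of path lifts on the four sides
    matches the end points. *)
Lemma hlift_unique p q (P : hpath R p q) x y y' : hlift P x y -> hlift P x y' -> y = y'.
Proof.
move=> [c -> [a [ca a0 a1 ac]]] [c' /hpath_eqP [H [cH H0 H1]] [b [cb b0 b1 bc]]].
have [g [cg g0 gH]] : exists g : R * R -> V,
    [/\ {within I01 `*` I01, continuous g}, g 0 = x &
    forall u, (I01 `*` I01) u -> tproj (g u) = H u].
  apply: lift_star => //.
  - by apply: compact_setX; exact: segment_compact.
  - move=> [s t] [/=]; rewrite !in_itv /= => /andP[s0 s1] /andP[t0 t1].
    by rewrite /Num.norm /= ge_max !ger0_norm // s1.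
  - move=> k [s t] /=; rewrite !in_itv /= => /andP[k0 k1] [/andP[s0 s1] /andP[t0 t1]].
    by split; rewrite mulr_ge0 //= mulr_ile1.
  - by have [-> _] := H0 0 z01; rewrite -a0 ac.
have cline (h : R -> R * R) : continuous h -> (forall t, I01 t -> (I01 `*` I01) (h t)) ->
    {within I01, continuous (fun t => g (h t))}.
  by move=> ch hI; apply: (comp_within _ hI cg); exact: continuous_subspaceT.
have c1 (s : R) : continuous (fun t : R => (s, t)).
  by apply: continuous_pair; [exact: cst_continuous | move=> ?; exact: cvg_id].
have c2 (s : R) : continuous (fun t : R => (t, s)).
  by apply: continuous_pair; [move=> ?; exact: cvg_id | exact: cst_continuous].
have ccst (v : V) : {within I01, continuous (fun=> v)}.
  exact/continuous_subspaceT/cst_continuous.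
have e1 : g (1, 0) = x.
  apply: (unique_path_lift (cline (fun t => (t, 0)) (c2 0) _) (ccst x)) => //.
  by move=> t t01; rewrite gH //= (H1 t t01).1 -a0 ac // cpath0.
have e2 : g (1, 1) = g (0, 1).
  apply: (unique_path_lift (cline (fun t => (t, 1)) (c2 1) _) (ccst (g (0, 1)))) => //.
  by move=> t t01; rewrite !gH //= (H1 t t01).2 (H1 0 z01).2.
have e3 : a 1 = g (0, 1).
  apply: (unique_path_lift ca (cline (fun t => (0, t)) (c1 0) _)) => //.
    by rewrite a0 -g0.
  by move=> t t01; rewrite gH //= (H0 t t01).1 ac.
have e4 : b 1 = g (1, 1).
  apply: (unique_path_lift cb (cline (fun t => (1, t)) (c1 1) _)) => //.
    by rewrite b0 e1.
  by move=> t t01; rewrite gH //= (H0 t t01).2 bc.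
by rewrite -a1 -b1 e3 e4 e2.
Qed.

Lemma straight_path p q x y : tproj x = p -> tproj y = q ->
  exists2 c : cpath R p q, lifts c x y &
    forall t, c t = tproj (x + t *: (y - x)).
Proof.
move=> xp yq; pose ct (t : R) := x + t *: (y - x).
have cct : continuous ct.
  move=> t; apply: cvgD; first exact: cvg_cst.
  by apply: cvgZr_tmp; exact: cvg_id.
have ct0 : ct 0 = x by rewrite /ct scale0r addr0.
have ct1 : ct 1 = y by rewrite /ct scale1r subrKC.
have cc : {within I01, continuous (tproj \o ct)}.
  apply: continuous_subspaceT => t; apply: continuous_comp;
    [exact: cct | exact: tproj_continuous].
have c0 : (tproj \o ct) 0 = p by rewrite /= ct0.
have c1 : (tproj \o ct) 1 = q by rewrite /= ct1.
exists (CPath cc c0 c1) => //.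
by exists ct; split => //; exact: continuous_subspaceT.
Qed.

Lemma hlift_path p q x y : tproj x = p -> tproj y = q ->
  exists P : hpath R p q, hlift P x y.
Proof.
move=> xp yq; have [c lc _] := straight_path xp yq.
by exists (\pi_(hpath R p q) c), c.
Qed.

End hlift.

(** * The universal cover as R^d, through end points of lifts *)

Section endpoints.
Context {R : realType} {d : nat}.
Local Notation V := 'rV[R]_d.
Local Notation torus := (@torus R d).
Local Notation x0 := (tproj (0 : V)).
Implicit Types (x y z a n : V) (p q r : torus).

(** The base point is lifted to 0. This identifies the fibre of the universal cover over p with the
    points of R^d above p, and the fundamental group with the lattice acting by translations. *)
Definition endp p (P : hpath R x0 p) : V := sval (cid (hlift_exists P erefl)).

Lemma endpP p (P : hpath R x0 p) : hlift P 0 (endp P).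
Proof. exact: svalP (cid (hlift_exists P erefl)). Qed.

Lemma tproj_endp p (P : hpath R x0 p) : tproj (endp P) = p.
Proof. by have [] := hlift_ends (endpP P). Qed.

Lemma endp_eq p (P : hpath R x0 p) x : hlift P 0 x -> endp P = x.
Proof. exact: hlift_unique (endpP P). Qed.

Lemma endp_inj p (P Q : hpath R x0 p) : endp P = endp Q -> P = Q.
Proof. by move=> e; apply: hlift_eq (endpP P) _; rewrite e; exact: endpP. Qed.

Lemma endp_lattice (g : pi1 R x0) : lattice (endp g).
Proof. by rewrite -[endp g]subr0; apply/tproj_eqP; rewrite tproj_endp. Qed.

(** The lift of P that starts at the lattice vector [endp g] is the translate of the one that starts
    at 0. *)
Lemma endp_hcat (g : pi1 R x0) p (P : hpath R x0 p) :
  endp (hcat g P) = endp g + endp P.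
Proof.
apply: endp_eq; apply: hlift_cat (endpP g) _.
by rewrite addrC -{1}[endp g]add0r; apply: hlift_translate (endpP P); exact: endp_lattice.
Qed.

Lemma endpM (g h : pi1 R x0) : endp (g * h)%g = endp g + endp h.
Proof. exact: endp_hcat. Qed.

Lemma endp1 : endp (1%g : pi1 R x0) = 0.
Proof. by apply: (addrI (endp (1%g : pi1 R x0))); rewrite -endpM mulg1 addr0. Qed.

Lemma endp_surj n : lattice n -> exists g : pi1 R x0, endp g = n.
Proof.
move=> ln; have [|g hg] := @hlift_path R d x0 x0 0 n erefl.
  by apply/tproj_eqP; rewrite subr0.
by exists g; exact: endp_eq.
Qed.

Lemma slift_subproof a p : exists P : hpath R x0 p, hlift P 0 (tcoord a p).
Proof. by apply: hlift_path => //; exact: tcoordK. Qed.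

Definition slift_fun a p : hpath R x0 p := sval (cid (slift_subproof a p)).

Lemma slift_funP a p : hlift (slift_fun a p) 0 (tcoord a p).
Proof. exact: svalP (cid (slift_subproof a p)). Qed.

(** The continuation is along the projected segment from x to y, which stays in U because balls are
    convex. *)
Lemma slift_cts a p : (tproj @` half_ball a) p -> forall U, open U -> U p ->
  \forall q \near p, exists c : cpath R p q,
    (forall t, t \in `[0, 1] -> U (c t)) /\
    slift_fun a q = hcat (slift_fun a p) (\pi_(hpath R p q) c).
Proof.
move=> [x xa <-] U oU Ux.
have oU' : open (tproj @^-1` U `&` half_ball a).
  apply: openI; last exact: half_ball_open.
  by move/continuousP : (@tproj_continuous R d); exact.
have /nbhs_ballP [e /= e0 eU] := open_nbhs_nbhs (conj oU' (conj Ux xa)).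
have : nbhs (tproj x) (tproj @` ball x e).
  apply: open_nbhs_nbhs; split; first exact/tproj_open/ball_open.
  by exists x => //; exact: ballxx.
apply: filterS => _ [y xy <-].
have [c lc cE] := @straight_path R d _ _ x y erefl erefl.
exists c; split.
  move=> t t01; rewrite cE; have [] // := eU (x + t *: (y - x)).
  move: xy t01; rewrite -ball_normE /ball_ /= in_itv /= => xy /andP[t0 t1].
  rewrite opprD addrA subrr add0r normrN normrZ distrC ger0_norm //.
  by apply: le_lt_trans xy; rewrite ler_piMl.
have [_ ya] := eU y xy.
apply: hlift_eq (slift_funP a (tproj y)) _; rewrite (tcoord_id ya).
apply: hlift_cat (slift_funP a (tproj x)) _; rewrite (tcoord_id xa).
by exists c.
Qed.

(** The branch over the chart at a for which the end point of the lift is the chart coordinate, so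
    that the flat trivialization and the chart agree. *)
Definition slift a : @local_lift R torus x0 :=
  @LocalLift R torus x0 (tproj @` half_ball a) (slift_fun a)
    (tproj_open (@half_ball_open R d a)) (@slift_cts a).

Lemma slift_domc a : lift_dom (slift a) (tproj a).
Proof. by exists a => //; exact: half_ball_center. Qed.

Lemma endp_slift a x : half_ball a x -> endp (slift a (tproj x)) = x.
Proof. by move=> xa; apply: endp_eq; have := slift_funP a (tproj x); rewrite tcoord_id. Qed.

Lemma endp_slift_tproj a x : tproj x = tproj a -> endp (slift a (tproj x)) = a.
Proof. by move=> ->; apply: endp_slift; exact: half_ball_center. Qed.

(** Near x any branch is the chart coordinate shifted by a constant lattice vector: a short
    continuing path lifts inside [half_ball x], and the lift is then translated to start at e. *)
Lemma endp_local (s : @local_lift R torus x0) x : lift_dom s (tproj x) ->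
  \forall y \near x, endp (s (tproj y)) = y + (endp (s (tproj x)) - x).
Proof.
move=> sx; set e := endp (s (tproj x)).
have le : lattice (e - x) by apply/tproj_eqP; rewrite tproj_endp.
have oU : open (tproj @` half_ball x) by exact/tproj_open/half_ball_open.
have Ux : (tproj @` half_ball x) (tproj x) by exists x => //; exact: half_ball_center.
have := lift_continuous sx oU Ux => /(@tproj_continuous R d x) n1.
have n2 : nbhs x (half_ball x).
  by apply: open_nbhs_nbhs; split; [exact: half_ball_open | exact: half_ball_center].
have n3 : nbhs x _ := @filterI _ _ (nbhs_filter (x : V)) _ _ n1 n2.
apply: (@filterS _ _ (nbhs_filter (x : V)) _ _ _ n3) => y [[c [cU ->]] yx].
apply: endp_eq; apply: hlift_cat (endpP _) _; rewrite -/e.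
have -> : e = x + (e - x) by rewrite subrKC.
rewrite {2}subrKC; apply: hlift_translate => //.
exists c => //; exists (tcoord x \o c); split.
- exact: (comp_within (@cpath_cts _ _ _ _ c) cU (@tcoord_continuous R d x)).
- by rewrite /= cpath0 tcoord_id //; exact: half_ball_center.
- by rewrite /= cpath1 tcoord_id.
- by move=> t t01; rewrite /= tcoordK.
Qed.

End endpoints.

(** * Forms on the torus *)

Section forms.
Context {R : realType} {d : nat} {W : normedModType R}.
Local Notation V := 'rV[R]_d.
Local Notation torus := (@torus R d).
Local Notation x0 := (tproj (0 : V)).
Local Notation Pi1 := (@pi1 R torus x0).
Local Notation atl := (@torus_atlas R d).
Local Notation llift := (@local_lift R torus x0).
Variable rho : Pi1 -> W -> W.
Hypothesis rho1 : forall w, rho 1%g w = w.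
Hypothesis rhoM : forall g h w, rho (g * h)%g w = rho g (rho h w).
Local Notation preform k := (@preform R R d torus atl x0 W k).
Implicit Types (x y z a n : V) (p q r : torus).

Local Notation is_form := (@is_form R R idfun d torus atl x0 W rho _).

(** The deck action is free, an element being determined by its translation vector; hence an orbit
    contains a single vector over each point z of the cover. *)
Lemma bundle_point_inj (z : @univ_cover R torus x0) (w w' : W) :
  bundle_point rho z w = bundle_point rho z w' -> w = w'.
Proof.
move=> e; have : bundle_point rho z w (deck 1%g z, rho 1%g w) by exists 1%g.
rewrite e => -[g _ [gz gw]].
suff g1 : g = 1%g by move: gw; rewrite g1 !rho1.
apply: endp_inj; apply: (addIr (endp (tagged z))).
have := congr1 (fun z : univ_cover x0 => endp (tagged z)) gz.
by rewrite /= !endp_hcat.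
Qed.

Lemma bundle_point_deck (g : Pi1) (z : @univ_cover R torus x0) (w : W) :
  bundle_point rho (deck g z) (rho g w) = bundle_point rho z w.
Proof.
have deckM k : deck k (deck g z) = deck (k * g)%g z by rewrite /deck /= hcatA.
apply/seteqP; split => _ [k _ <-].
  by exists (k * g)%g => //; rewrite deckM rhoM.
exists (k * g^-1)%g => //.
by rewrite deckM -rhoM -mulgA mulVg mulg1.
Qed.

(** Translations have the identity as differential, so only the value is twisted and the arguments v
    are left alone. *)
Definition equivariant_form k (F : V -> 'M[R]_(k, d) -> W) : Prop :=
  [/\ forall x, alternating_multilinear idfun (F x),
      forall v, smooth setT (fun x => F x v) &
      forall (g : Pi1) x v, F (endp g + x) v = rho g (F x v)].

Definition dext k (F : V -> 'M[R]_(k, d) -> W) : V -> 'M[R]_(k.+1, d) -> W :=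
  fun x v => \sum_(a < k.+1) (-1) ^+ a *: 'D_(row a v) (fun y => F y (row' a v)) x.

Definition unroll k (omega : preform k) : V -> 'M[R]_(k, d) -> W :=
  fun x v => omega (slift x) x x v.

Definition roll k (F : V -> 'M[R]_(k, d) -> W) : preform k :=
  fun s _ y v => F (endp (s (tproj y))) v.

(** A relation and not an equality with [roll F], because a preform is arbitrary outside the chart
    images. *)
Definition rolls k (omega : preform k) (F : V -> 'M[R]_(k, d) -> W) : Prop :=
  forall (s : llift) (i : atl) y, half_ball i y -> lift_dom s (tproj y) ->
  forall v, omega s i y v = F (endp (s (tproj y))) v.

(** Compatibility compares the given branch and chart with those centred at the end point e; at this
    point the two branches coincide, so the values do too. *)
Lemma unroll_rolls k (omega : preform k) : is_form omega -> rolls omega (unroll omega).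
Proof.
move=> [_ _ comp] s i y iy sy v; set e := endp (s (tproj y)).
have ey : tproj e = tproj y by rewrite tproj_endp.
have sE : s (tproj y) = slift e (tproj y).
  by apply: endp_inj; rewrite endp_slift_tproj.
have de : (tproj @` half_ball e) (tproj y) by exists e => //; exact: half_ball_center.
have di : (tproj @` half_ball i) (tproj y) by exists y.
have te : tcoord e (tproj y) = e by rewrite -ey tcoord_id //; exact: half_ball_center.
have := comp s (slift e) i e (tproj y) sy de di de v.
rewrite torus_jacobian // mulmx1 /chart_coord /= (tcoord_id iy) te.
by rewrite sE => /bundle_point_inj.
Qed.

Lemma unroll_equivariant k (omega : preform k) :
  is_form omega -> equivariant_form (unroll omega).
Proof.
move=> fo; have [alt sm comp] := fo.
have cimg x : chart_img (x : atl) (lift_dom (slift x)) x.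
  by rewrite torus_chart_img; split; [exact: half_ball_center | exact: slift_domc].
split.
- by move=> x; exact: alt.
- move=> v; apply: smooth_local => a _; exists (half_ball a); first exact: half_ball_center.
  have aE y : half_ball a y -> omega (slift a) a y v = unroll omega y v.
    move=> ay; rewrite (unroll_rolls fo ay) ?endp_slift //; by exists y.
  apply: smooth_eq aE _; first exact: half_ball_open.
  apply: smooth_sub (sm (slift a) a v) => y ay.
  by rewrite torus_chart_img; split => //; exists y.
(* The branches centred at x and at [endp g + x] differ over their common point by the deck
   transformation g, so compatibility of omega there is equivariance. *)
- move=> g x v; set x' := endp g + x.
  have xx : tproj x' = tproj x by rewrite /x' addrC tproj_lattice //; exact: endp_lattice.
  have dx' : (tproj @` half_ball x') (tproj x) by exists x' => //; exact: half_ball_center.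
  have dx : (tproj @` half_ball x) (tproj x) by exists x => //; exact: half_ball_center.
  have te : tcoord x' (tproj x) = x' by rewrite -xx tcoord_id //; exact: half_ball_center.
  have := comp (slift x) (slift x') x x' (tproj x) dx dx' dx dx' v.
  rewrite torus_jacobian // mulmx1 /chart_coord /= tcoord_id; last exact: half_ball_center.
  rewrite te.
  have -> : slift_fun x' (tproj x) = hcat g (slift_fun x (tproj x)).
    by apply: endp_inj; rewrite endp_hcat (@endp_slift_tproj _ _ x') // (@endp_slift_tproj _ _ x).
  rewrite -(bundle_point_deck g (existT _ (tproj x) (slift_fun x (tproj x)))).
  by move/bundle_point_inj => ->.
Qed.

Lemma near_endp (s : llift) x : lift_dom s (tproj x) ->
  exists2 U, open_nbhs x U & exists c, forall y, U y -> endp (s (tproj y)) = y + c.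
Proof.
move=> sx; have := endp_local sx; rewrite -[X in X -> _]/(nbhs (x : V) _) nbhsE.
by move=> [U oU UE]; exists U => //; eexists => y Uy; exact: UE.
Qed.

Lemma roll_rolls k (F : V -> 'M[R]_(k, d) -> W) : rolls (roll F) F.
Proof. by []. Qed.

Lemma roll_is_form k (F : V -> 'M[R]_(k, d) -> W) :
  equivariant_form F -> is_form (roll F).
Proof.
move=> [alt sm eqv]; split.
- by move=> s i y _; exact: alt.
- move=> s i v; rewrite smooth_onE; apply: smooth_local => x.
  rewrite torus_chart_img => -[_ sx].
  have [U [oU Ux] [c Uc]] := near_endp sx; exists U => //.
  apply: (@smooth_eq _ _ _ U (fun y => F (y + c) v)) => //.
    by move=> y Uy; rewrite /roll Uc.
  have st : smooth setT (fun y : V => F (y + c) v) := @smooth_translate _ _ _ setT _ c (sm v).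
  exact: smooth_sub st.
- move=> s t i j p sp tp ip jp v.
  rewrite torus_jacobian // mulmx1 /roll /chart_coord /= !tcoordK.
  (* Two branches over p differ by a loop, whose action accounts for the change of vector. *)
  pose g : Pi1 := hcat (t p) (hrev (s p)).
  have tE : t p = hcat g (s p) by rewrite /g -hcatA hcatVp hcatp1.
  rewrite tE endp_hcat eqv.
  by rewrite -(bundle_point_deck g (existT _ p (s p))).
Qed.

(** Near y the end point is y + c with c constant, so differentiating in the chart is
    differentiating F at the end point. *)
Lemma ext_d_rolls k (omega : preform k) F :
  rolls omega F -> rolls (ext_d idfun omega) (dext F).
Proof.
move=> oF s i y iy sy v; rewrite /ext_d /dext; apply: eq_bigr => a _; congr (_ *: _).
have [U [oU Uy] [c Uc]] := near_endp sy.
rewrite -[LHS]/('D_(row a v) _ y) (Uc y Uy) -derive_translate.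
have N : nbhs y (U `&` chart_img i (lift_dom s)).
  apply: open_nbhs_nbhs; split.
    by apply: openI => //; apply: open_torus_chart_img; exact: lift_open.
  by split=> //; rewrite torus_chart_img.
apply: near_eq_derive; apply: (@filterS _ _ (nbhs_filter (y : V)) _ _ _ N) => z [Uz].
by rewrite torus_chart_img => -[iz sz]; rewrite oF // Uc.
Qed.

Lemma closed_formP k (omega : preform k) F : rolls omega F ->
  (closed_form idfun omega <-> forall x v, dext F x v = 0).
Proof.
move=> oF; have dF := ext_d_rolls oF; split=> [co x v|dF0 s i y].
  have := dF (slift x) x x (half_ball_center x) (slift_domc x) v.
  rewrite endp_slift_tproj // => <-; rewrite co // torus_chart_img.
  by split; [exact: half_ball_center | exact: slift_domc].
by rewrite torus_chart_img => -[iy sy]; apply/funext => v; rewrite dF.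
Qed.

Lemma exact_form0P (omega : preform 0) F : rolls omega F ->
  (forall x v, F x v = 0) -> exact_form idfun rho omega.
Proof.
move=> oF F0 s i y; rewrite torus_chart_img => -[iy sy].
by apply/funext => v; rewrite oF.
Qed.

Lemma exact_formSP k (omega : preform k.+1) F : rolls omega F ->
  (exact_form idfun rho omega <->
   exists2 P, equivariant_form P & forall x v, F x v = dext P x v).
Proof.
move=> oF; split=> [[eta [feta oe]]|[P eP FP]].
  exists (unroll eta); first exact: unroll_equivariant.
  move=> x v; have := unroll_rolls feta => /ext_d_rolls de.
  have hx := half_ball_center x; have dx := slift_domc x.
  have := oF _ _ _ hx dx v; rewrite endp_slift_tproj // => <-.
  have := de _ _ _ hx dx v; rewrite endp_slift_tproj // => <-.
  by rewrite oe // torus_chart_img.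
exists (roll P); split; first exact: roll_is_form.
move=> s i y; rewrite torus_chart_img => -[iy sy]; apply/funext => v.
by rewrite oF // (ext_d_rolls (@roll_rolls _ P)) // FP.
Qed.

End forms.

(** * Cohomology of sums of flat line bundles *)

Section rows.
Context {R : realType} {d : nat}.

Lemma col_mx_ord0 k (u : 'rV[R]_d) (v : 'M[R]_(k, d)) j :
  (col_mx u v : 'M[R]_(k.+1, d)) ord0 j = u 0 j.
Proof.
have -> : (ord0 : 'I_k.+1) = lshift k (0 : 'I_1) by apply/val_inj.
exact: (col_mxEu u v).
Qed.

Lemma col_mx_lift k (u : 'rV[R]_d) (v : 'M[R]_(k, d)) i j :
  (col_mx u v : 'M[R]_(k.+1, d)) (fintype.lift ord0 i) j = v i j.
Proof.
have -> : fintype.lift ord0 i = rshift 1 i by apply/val_inj.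
exact: (col_mxEd u v).
Qed.

Lemma row_col_mx0 k (u : 'rV[R]_d) (v : 'M[R]_(k, d)) :
  row ord0 (col_mx u v : 'M[R]_(k.+1, d)) = u.
Proof. by apply/rowP => j; rewrite mxE col_mx_ord0. Qed.

Lemma row_col_mxS k (u : 'rV[R]_d) (v : 'M[R]_(k, d)) i :
  row (fintype.lift ord0 i) (col_mx u v : 'M[R]_(k.+1, d)) = row i v.
Proof. by apply/rowP => j; rewrite mxE col_mx_lift mxE. Qed.

Lemma row'_col_mx0 k (u : 'rV[R]_d) (v : 'M[R]_(k, d)) :
  row' ord0 (col_mx u v : 'M[R]_(k.+1, d)) = v.
Proof. by apply/matrixP => i j; rewrite mxE col_mx_lift. Qed.

Lemma row'_col_mxS k (u : 'rV[R]_d) (v : 'M[R]_(k.+1, d)) i :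
  row' (fintype.lift ord0 i) (col_mx u v : 'M[R]_(k.+2, d)) =
    col_mx u (row' i v) :> 'M[R]_(k.+1, d).
Proof.
apply/matrixP => a j; rewrite mxE; case: (unliftP ord0 a) => [b|] ->.
  rewrite (_ : fintype.lift (fintype.lift ord0 i) (fintype.lift ord0 b) =
                 fintype.lift ord0 (fintype.lift i b)).
    by rewrite !col_mx_lift mxE.
  apply/val_inj => /=; rewrite /bump /= !add1n ltnS; by case: leqP.
rewrite (_ : fintype.lift (fintype.lift ord0 i) ord0 = ord0); first by rewrite !col_mx_ord0.
exact/val_inj.
Qed.

Lemma col_mx_set_row k (u : 'rV[R]_d) (v : 'M[R]_(k, d)) i (w : 'rV[R]_d) :
  col_mx u (set_row v i w) =
    set_row (col_mx u v : 'M[R]_(k.+1, d)) (fintype.lift ord0 i) w :> 'M[R]_(k.+1, d).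
Proof.
apply/matrixP => a j; rewrite [RHS]mxE; case: (unliftP ord0 a) => [b|] ->.
  by rewrite !col_mx_lift mxE (inj_eq lift_inj).
by rewrite !col_mx_ord0.
Qed.

End rows.

(** * Vanishing when every character takes the value -1 *)

Section acyclic.
Context {R : realType} {d m : nat}.
Local Notation V := 'rV[R]_d.
Local Notation W := 'rV[R]_m.
Local Notation torus := (@torus R d).
Local Notation x0 := (tproj (0 : V)).
Local Notation Pi1 := (@pi1 R torus x0).
Variables (rho : Pi1 -> W -> W) (chi : 'I_m -> Pi1 -> R).
Hypothesis rhoE : forall g w j, rho g w 0 j = chi j g * w 0 j.
Variable g_ : 'I_m -> Pi1.
Hypothesis chi_g : forall j, chi j (g_ j) = - 1.
Implicit Types (x : V).

Let u j : V := endp (g_ j).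

Lemma derive_coord k (F : V -> 'M[R]_(k, d) -> W) v w x j :
  smooth setT (fun x => F x v) ->
  ('D_w (fun y => F y v) x) 0 j = 'D_w (fun y => F y v 0 j) x.
Proof. by move=> s; rewrite derive_mx ?mxE //; have [_] := s [::] x I; exact. Qed.

Lemma dext_coord k (F : V -> 'M[R]_(k, d) -> W) v x j :
  (forall v, smooth setT (fun x => F x v)) ->
  dext F x v 0 j = \sum_(a < k.+1) (-1) ^+ a * 'D_(row a v) (fun y => F y (row' a v) 0 j) x.
Proof.
by move=> s; rewrite /dext summxE; apply: eq_bigr => a _; rewrite mxE derive_coord.
Qed.

(** The increment over a period at which the j-th component changes sign: (-1 - 1) times the
    component. This is the origin of the factor -1/2 in [primitive]. *)
Lemma avg_derive_equivariant k (F : V -> 'M[R]_(k, d) -> W) v x j :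
  equivariant_form rho F ->
  avg (u j) (fun y => 'D_(u j) (fun y => F y v 0 j) y) x = - 2 * F x v 0 j.
Proof.
move=> [_ sF eF]; have sj := smooth_coord (0 : 'I_1) j openT (sF v).
rewrite avg_derive; last 2 first.
- by move=> y; exact: smooth_derivable.
- exact/smooth_continuous/smooth_derive.
by rewrite /u [x + _]addrC eF rhoE chi_g; ring.
Qed.

(** The derivative along [u j] of a closed 0-form vanishes, and so does its average, which is -2
    times the component itself. *)
Lemma closed0_eq0 (F : V -> 'M[R]_(0, d) -> W) : equivariant_form rho F ->
  (forall x v, dext F x v = 0) -> forall x v, F x v = 0.
Proof.
move=> eqF dF x v; have [_ sF _] := eqF; apply/rowP => j; rewrite mxE.
have := avg_derive_equivariant v x j eqF.
have -> : (fun y => 'D_(u j) (fun y => F y v 0 j) y) = (fun y => 0 * F y v 0 j).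
  apply/funext => y; have := dF y (u j); move/rowP/(_ j).
  rewrite dext_coord // big_ord1 expr0 mul1r mxE mul0r.
  rewrite (_ : row ord0 (u j) = u j); last by apply/rowP => i; rewrite mxE.
  by rewrite (_ : row' ord0 (u j) = v) //; apply/matrixP => -[].
rewrite avgZ; last exact/smooth_continuous/smooth_coord/sF/openT.
by rewrite mul0r => /esym/eqP; rewrite mulf_eq0 oppr_eq0 pnatr_eq0 => /eqP.
Qed.

(* Cartan's homotopy formula for the translation flow along u, integrated over
   one period, at which a chi-equivariant function with chi u = -1 changes sign. *)
Definition primitive k (F : V -> 'M[R]_(k.+1, d) -> W) : V -> 'M[R]_(k, d) -> W :=
  fun x v => \row_j (- 2^-1 * avg (u j) (fun y => F y (col_mx (u j) v) 0 j) x).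

Lemma smooth_avg_coord k (F : V -> 'M[R]_(k, d) -> W) v j w :
  (forall v, smooth setT (fun x => F x v)) ->
  smooth setT (fun x => - 2^-1 * avg w (fun y => F y v 0 j) x).
Proof.
move=> sF; have s := smooth_avg w (smooth_coord (0 : 'I_1) j openT (sF v)).
move=> vs x _.
have e : iterD vs (fun x => - 2^-1 * avg w (fun y => F y v 0 j) x) =
   (fun x => - 2^-1 * iterD vs (avg w (fun y => F y v 0 j)) x).
  elim: vs => [//|z vs IH]; apply/funext => y /=; rewrite IH.
  by rewrite deriveZ //; have [_] := s vs y I; exact.
have [c D] := s vs x I; rewrite e; split.
  exact: (@cvgM _ _ _ (nbhs_filter x) (fun=> - 2^-1) _ _ _ (cvg_cst _) c).
by move=> z; apply: derivableZ; exact: D.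
Qed.

(** Averaging commutes with translations. The direction [u j] varies with the component j, which is
    harmless because the action is diagonal. *)
Lemma primitive_equivariant k (F : V -> 'M[R]_(k.+1, d) -> W) :
  equivariant_form rho F -> equivariant_form rho (primitive F).
Proof.
move=> [alt sF eF].
have cF v j : continuous (fun y => F y v 0 j).
  exact/smooth_continuous/smooth_coord/sF/openT.
split.
- move=> x; split.
    move=> v i a w w'; apply/rowP => j; rewrite !mxE.
    rewrite (@eq_avg _ _ _ (fun y => a * F y (col_mx (u j) (set_row v i w)) 0 j +
        F y (col_mx (u j) (set_row v i w')) 0 j)); last first.
      move=> y; rewrite !col_mx_set_row; have [lin _] := alt y.
      by rewrite lin !mxE.
    rewrite avgD; last 2 first.
    - by apply: continuous_mull; exact: cF.
    - exact: cF.
    rewrite avgZ; last exact: cF.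
    by rewrite mulrDr; congr (_ + _); rewrite mulrCA.
  move=> v i j ij rij; apply/rowP => l; rewrite !mxE.
  rewrite (@eq_avg _ _ _ (fun y => 0 * F y (col_mx (u l) v) 0 l)); last first.
    move=> y; have [_ altF] := alt y.
    rewrite (altF _ (fintype.lift ord0 i) (fintype.lift ord0 j)) ?mxE ?mul0r //.
    by rewrite !row_col_mxS.
  by rewrite avgZ ?mul0r ?mulr0 //; exact: cF.
- move=> v; apply: smooth_mx openT _ => i j; rewrite (ord1 i).
  by under eq_fun do rewrite mxE; exact: smooth_avg_coord.
- move=> g x v; apply/rowP => j; rewrite rhoE !mxE addrC avg_translate.
  rewrite (@eq_avg _ _ _ (fun y => chi j g * F y (col_mx (u j) v) 0 j)).
    by rewrite avgZ; [exact: mulrCA | exact: cF].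
  by move=> y; rewrite addrC eF rhoE.
Qed.

Lemma dext_primitive k (F : V -> 'M[R]_(k.+1, d) -> W) : equivariant_form rho F ->
  (forall x v, dext F x v = 0) -> forall x v, F x v = dext (primitive F) x v.
Proof.
move=> eqF dF x v; have [_ sF _] := eqF.
have [_ sP _] := primitive_equivariant eqF.
have sj w j := smooth_coord (0 : 'I_1) j openT (sF w).
apply/rowP => j; rewrite dext_coord //.
have E1 a : 'D_(row a v) (fun y => primitive F y (row' a v) 0 j) x =
    - 2^-1 * avg (u j) (fun y => 'D_(row a v) (fun y => F y (col_mx (u j) (row' a v)) 0 j) y) x.
  under eq_fun do rewrite mxE.
  have sa := sj (col_mx (u j) (row' a v)) j.
  rewrite deriveZ; last by apply: smooth_derivable; exact: smooth_avg.
  rewrite derive_avg //; first exact: smooth_continuous.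
    by move=> y; exact: smooth_derivable.
  exact/smooth_continuous/smooth_derive.
under eq_bigr do rewrite E1 mulrCA.
rewrite -mulr_sumr.
set S := \sum_(_ < _) _.
suff -> : S = - 2 * F x v 0 j by rewrite mulrA mulrNN mulVf ?mul1r // pnatr_eq0.
rewrite -(avg_derive_equivariant v x j eqF) /S.
pose f (a : 'I_k.+1) y := (-1) ^+ a * 'D_(row a v) (fun y => F y (col_mx (u j) (row' a v)) 0 j) y.
have cf a : continuous (f a).
  apply: continuous_mull; exact: (smooth_continuous (smooth_derive _ (sj _ _))).
transitivity (avg (u j) (fun y => \sum_(a < k.+1) f a y) x).
  rewrite avg_sum //; apply: eq_bigr => a _; rewrite avgZ //.
  exact: (smooth_continuous (smooth_derive _ (sj _ _))).
(* Closedness at the arguments (u, v_0, ..., v_k) expresses the derivative of F(v) along u by the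
   derivatives along the v_a of F with u in front and v_a omitted. *)
apply: eq_avg => y; have := dF y (col_mx (u j) v); move/rowP/(_ j).
rewrite dext_coord // big_ord_recl expr0 mul1r row_col_mx0 row'_col_mx0 mxE => /eqP.
rewrite addr_eq0 => /eqP ->; rewrite -sumrN; apply: eq_bigr => a _.
by rewrite row_col_mxS row'_col_mxS /f lift0 exprS mulN1r mulNr opprK.
Qed.

End acyclic.

(** * A closed 2-form that is not exact *)

Section area_form.
Context {R : realType} {d m : nat}.
Local Notation V := 'rV[R]_d.
Local Notation W := 'M[R]_m.
Local Notation torus := (@torus R d).
Local Notation x0 := (tproj (0 : V)).
Local Notation Pi1 := (@pi1 R torus x0).
Variables (rho : Pi1 -> W -> W).
Implicit Types (x : V).

Lemma zero_equivariant k : (forall g, rho g 0 = 0) ->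
  equivariant_form rho (fun _ (_ : 'M[R]_(k, d)) => 0).
Proof.
move=> rho0; split=> [x|v|g x v]; last by rewrite rho0.
  by split => *; rewrite ?scaler0 ?addr0.
by apply: ratmx_smooth openT _; exact: ratmx_cst.
Qed.

Lemma dext_cst k (f : 'M[R]_(k, d) -> W) x v : dext (fun=> f) x v = 0.
Proof. by rewrite /dext big1 // => a _; rewrite derive_cst scaler0. Qed.

Variables (i0 i1 : 'I_d).
Hypothesis i01 : i0 != i1.

Definition area (v : 'M[R]_(2, d)) : R := v 0 i0 * v 1 i1 - v 0 i1 * v 1 i0.

Lemma area_equivariant (Z : W) : (forall g a, rho g (a *: Z) = a *: Z) ->
  equivariant_form rho (fun _ v => area v *: Z).
Proof.
move=> rhoZ; split=> [x|v|g x v]; last by rewrite rhoZ.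
  split=> [v i a w w'|v i j ij rij].
    rewrite scalerA -scalerDl; congr (_ *: _); rewrite /area !mxE.
    by case: i => -[|[|//]] ?; rewrite /= /eq_op /=; ring.
  have rE c : v i c = v j c by have := congr1 (fun M : V => M 0 c) rij; rewrite !mxE.
  suff -> : area v = 0 by rewrite scale0r.
  have {rE}rE c : v 0 c = v 1 c.
    case: i j ij rE {rij} => -[|[|//]] hi [] [|[|//]] hj //= _ rE.
      have := rE c; congr (v _ _ = v _ _); exact/val_inj.
    have := esym (rE c); congr (v _ _ = v _ _); exact/val_inj.
  by rewrite /area !rE; ring.
by apply: ratmx_smooth openT _; exact: ratmx_cst.
Qed.

Let e0 : V := delta_mx 0 i0.
Let e1 : V := delta_mx 0 i1.

Lemma lattice_delta i : lattice (delta_mx 0 i : V).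
Proof. by apply/latticeP => j; rewrite mxE natr_int. Qed.

(* Average over the unit square in the directions i0, i1: the differential of
   a periodic 1-form averages to 0, the area form to 1. *)
Lemma area_not_exact (Z : W) a b : Z a b = 1 ->
  (forall g w, rho g w a b = w a b) ->
  ~ exists2 P : V -> 'M[R]_(1, d) -> W, equivariant_form rho P &
      forall x v, area v *: Z = dext P x v.
Proof.
move=> Zab rhoab [P [_ sP eP] dP].
(* Only the entry (a, b) is kept: rho fixes it, so it is a periodic function. *)
pose A (w : V) y := P y w a b.
have sA w : smooth setT (A w) by apply: smooth_coord openT (sP w).
have dA w v x : ('D_v (fun y => P y w) x) a b = 'D_v (A w) x.
  by rewrite derive_mx ?mxE //; have [_] := sP w [::] x I; exact.
have pA w i y : A w (y + delta_mx 0 i) = A w y.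
  have [g gi] := endp_surj (lattice_delta i).
  by rewrite /A -gi addrC eP rhoab.
have dA1 x : 'D_e0 (A e1) x - 'D_e1 (A e0) x = 1.
  have := dP x (col_mx e0 e1); move/matrixP/(_ a b).
  rewrite /dext big_ord_recl big_ord1 expr0 scale1r row_col_mx0 row'_col_mx0 row_col_mxS.
  have -> : row' (fintype.lift ord0 ord0) (col_mx e0 e1 : 'M[R]_(2, d)) = e0.
    apply/matrixP => i j; rewrite mxE (ord1 i).
    rewrite (_ : fintype.lift _ _ = ord0); last exact/val_inj.
    by rewrite col_mx_ord0.
  rewrite (_ : row ord0 e1 = e1); last by apply/rowP => i; rewrite mxE.
  rewrite !mxE !dA lift0 expr1 mulN1r => <-; rewrite Zab mulr1.
  rewrite /area (_ : (0 : 'I_2) = ord0) // !col_mx_ord0.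
  rewrite (_ : (1 : 'I_2) = fintype.lift ord0 ord0); last exact/val_inj.
  rewrite !col_mx_lift !mxE !eqxx /=.
  by rewrite (eq_sym i1) (negbTE i01) !mulr1 !mulr0 subr0.
have c (w v : V) : continuous (fun x => 'D_v (A w) x).
  exact/smooth_continuous/smooth_derive.
have D (w v x : V) : derivable (A w) x v by exact: smooth_derivable.
have cA w : continuous (A w) by exact: smooth_continuous.
(* By [dA1] and the periodicity of [A e1], the derivative of B along e1 is -1 everywhere, although B
   is itself periodic in that direction. *)
pose B := avg e0 (A e0).
have sB : smooth setT B by exact: smooth_avg.
have dB x : 'D_e1 B x = - 1.
  rewrite /B derive_avg //.
  have -> : (fun x => 'D_e1 (A e0) x) = (fun x => 'D_e0 (A e1) x + - 1).
    by apply/funext => y; rewrite -(dA1 y); ring.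
  rewrite avgD //; last exact: cst_continuous.
  by rewrite avg_derive // pA subrr add0r avg_cst.
have := @avg_derive _ _ B e1 0 (fun x => @smooth_derivable _ _ _ e1 x sB)
  (smooth_continuous (@smooth_derive _ _ _ _ _ e1 sB)).
under eq_avg do rewrite dB.
rewrite avg_cst // /B avg_translate.
under eq_avg do rewrite pA.
by rewrite subrr => /eqP; rewrite oppr_eq0 oner_eq0.
Qed.

End area_form.

(** * The rotation group *)

Local Notation o0 := (@Ordinal 3 0 isT).
Local Notation o1 := (@Ordinal 3 1 isT).
Local Notation o2 := (@Ordinal 3 2 isT).

Section mx3.
Context {R : realType}.
Implicit Types (A B : 'M[R]_3) (v w : 'rV[R]_3).

Lemma forall3 (P : 'I_3 -> Prop) : P o0 -> P o1 -> P o2 -> forall i, P i.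
Proof.
move=> P0 P1 P2 [[|[|[|//]]] h];
  [rewrite (_ : Ordinal h = o0) | rewrite (_ : Ordinal h = o1) |
   rewrite (_ : Ordinal h = o2)] => //; exact/val_inj.
Qed.

Lemma sum3 (F : 'I_3 -> R) : \sum_i F i = F o0 + F o1 + F o2.
Proof.
rewrite !big_ord_recl big_ord0 addr0 addrA; congr (F _ + F _ + F _); exact/val_inj.
Qed.

Lemma mx3P A B :
  [/\ A o0 o0 = B o0 o0, A o0 o1 = B o0 o1 & A o0 o2 = B o0 o2] ->
  [/\ A o1 o0 = B o1 o0, A o1 o1 = B o1 o1 & A o1 o2 = B o1 o2] ->
  [/\ A o2 o0 = B o2 o0, A o2 o1 = B o2 o1 & A o2 o2 = B o2 o2] -> A = B.
Proof.
by move=> [? ? ?] [? ? ?] [? ? ?]; apply/matrixP; apply: forall3; apply: forall3.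
Qed.

Lemma rV3P v w : v 0 o0 = w 0 o0 -> v 0 o1 = w 0 o1 -> v 0 o2 = w 0 o2 -> v = w.
Proof. by move=> ? ? ?; apply/rowP; apply: forall3. Qed.

(** The matrix of w |-> v x w acting on columns. *)
Definition hat v : 'M[R]_3 := \matrix_(i, j)
  nth 0 (nth [::] [:: [:: 0; - v 0 o2; v 0 o1];
                      [:: v 0 o2; 0; - v 0 o0];
                      [:: - v 0 o1; v 0 o0; 0]] i) j.

(** Reads the skew part, without halving: [vee (hat v)] is 2 v, and symmetric matrices give 0. *)
Definition vee A : 'rV[R]_3 :=
  \row_j nth 0 [:: A o2 o1 - A o1 o2; A o0 o2 - A o2 o0; A o1 o0 - A o0 o1] j.

(* Compatibility with hat, i.e. with the cross product, replaces det A = 1. *)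
Definition is_so3 A : bool :=
  (A *m A^T == 1%:M) && `[< forall v, A *m hat v *m A^T = hat (v *m A^T) >].

Definition so3 := {A : 'M[R]_3 | is_so3 A}.
HB.instance Definition _ := Choice.on so3.

Lemma so3_orth (A : so3) : val A *m (val A)^T = 1%:M.
Proof. by have /andP[/eqP] := valP A. Qed.

Lemma so3_orthV (A : so3) : (val A)^T *m val A = 1%:M.
Proof. exact: mulmx1C (so3_orth A). Qed.

Lemma so3_hat (A : so3) v : val A *m hat v *m (val A)^T = hat (v *m (val A)^T).
Proof. by have /andP[_ /asboolP] := valP A. Qed.

Lemma is_so31 : is_so3 1%:M.
Proof.
apply/andP; split; first by rewrite trmx1 mulmx1.
by apply/asboolP => v; rewrite trmx1 !mulmx1 mul1mx.
Qed.

Lemma is_so3M (A B : so3) : is_so3 (val A *m val B).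
Proof.
apply/andP; split.
  by rewrite trmx_mul mulmxA -(mulmxA (val A)) so3_orth mulmx1 so3_orth.
apply/asboolP => v; rewrite trmx_mul !mulmxA -so3_hat -so3_hat.
by rewrite !mulmxA.
Qed.

Lemma is_so3V (A : so3) : is_so3 (val A)^T.
Proof.
apply/andP; split; first by rewrite trmxK so3_orthV.
apply/asboolP => v; rewrite trmxK.
have := so3_hat A (v *m val A); rewrite -(mulmxA v) so3_orth mulmx1 => <-.
by rewrite !mulmxA so3_orthV mul1mx -!mulmxA so3_orthV mulmx1.
Qed.

Definition so3_one : so3 := Sub _ is_so31.
Definition so3_mul (A B : so3) : so3 := Sub _ (is_so3M A B).
Definition so3_inv (A : so3) : so3 := Sub _ (is_so3V A).

Lemma so3_mulA : associative so3_mul.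
Proof. by move=> A B C; apply/val_inj; rewrite /= mulmxA. Qed.
Lemma so3_mul1 : left_id so3_one so3_mul.
Proof. by move=> A; apply/val_inj; rewrite /= mul1mx. Qed.
Lemma so3_mulr1 : right_id so3_one so3_mul.
Proof. by move=> A; apply/val_inj; rewrite /= mulmx1. Qed.
Lemma so3_mulV : left_inverse so3_one so3_inv so3_mul.
Proof. by move=> A; apply/val_inj; rewrite /= so3_orthV. Qed.
Lemma so3_mulrV : right_inverse so3_one so3_inv so3_mul.
Proof. by move=> A; apply/val_inj; rewrite /= so3_orth. Qed.

HB.instance Definition _ := isGroup.Build so3
  so3_mulA so3_mul1 so3_mulr1 so3_mulV so3_mulrV.
HB.instance Definition _ :=
  Topological.copy so3 (initial_topology (val : so3 -> 'M[R]_3)).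

Lemma val_so3M (A B : so3) : val (A * B)%g = val A *m val B. Proof. by []. Qed.
Lemma val_so31 : val (1%g : so3) = 1%:M. Proof. by []. Qed.

Definition mxs := (mxE, sum3).

Definition qf v : R := v 0 o0 ^+ 2 + v 0 o1 ^+ 2 + v 0 o2 ^+ 2.

(** The numerator is kept apart so that orthogonality and compatibility with [hat] become polynomial
    identities, within reach of [ring]. *)
Definition rot_num v : 'M[R]_3 := (1 - qf v)%:M + 2 *: (v^T *m v) + 2 *: hat v.

(* Rodrigues' formula for the Cayley transform of hat v, the rotation about v
   by the angle 2 arctan |v|; it misses only the half-turns, where tr A = -1. *)
Definition rot v : 'M[R]_3 := (1 + qf v)^-1 *: rot_num v.

Lemma qf_gt0 v : 0 < 1 + qf v.
Proof. by rewrite /qf; nra. Qed.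

Lemma qfE v : v *m v^T = (qf v)%:M.
Proof.
by apply/matrixP => i j; rewrite !ord1 !mxs /qf /=; ring.
Qed.

Lemma rot_numE v i j :
  rot_num v i j = (1 - qf v) * (i == j)%:R + 2 * (v 0 i * v 0 j) + 2 * hat v i j.
Proof. by rewrite /rot_num !mxE big_ord1 mxE mulr_natr. Qed.

(** The coefficients of w are 2 x 2 minors of A; this links compatibility with [hat] to
    cofactors. *)
Lemma conj_hatE A w i j : (A *m hat w *m A^T) i j =
  w 0 o0 * (A i o2 * A j o1 - A i o1 * A j o2) +
  w 0 o1 * (A i o0 * A j o2 - A i o2 * A j o0) +
  w 0 o2 * (A i o1 * A j o0 - A i o0 * A j o1).
Proof. by rewrite !mxs /=; ring. Qed.

Lemma hatZ a v : hat (a *: v) = a *: hat v.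
Proof. by apply: mx3P; split; rewrite !mxE /= ?mulr0 ?mulrN. Qed.

Lemma rot_num_orth v : rot_num v *m (rot_num v)^T = ((1 + qf v) ^+ 2)%:M.
Proof.
apply: mx3P; split; rewrite [LHS]mxE sum3 ![_^T _ _]mxE !rot_numE ![hat _ _ _]mxE [RHS]mxE /= /qf; ring.
Qed.

Lemma mul_trE w A i : (w *m A^T) 0 i = w 0 o0 * A i o0 + w 0 o1 * A i o1 + w 0 o2 * A i o2.
Proof. by rewrite !mxs. Qed.

Lemma rot_num_hat v w : rot_num v *m hat w *m (rot_num v)^T =
  (1 + qf v) *: hat (w *m (rot_num v)^T).
Proof.
apply: mx3P; split; rewrite conj_hatE [RHS]mxE [hat _ _ _]mxE /= ?mul_trE !rot_numE /qf ![hat _ _ _]mxE /=; ring.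
Qed.

End mx3.

(** * The Cayley transform and its inverse *)

Section cayley.
Context {R : realType}.
Local Notation so3 := (@so3 R).
Implicit Types (A B : 'M[R]_3) (v w : 'rV[R]_3).

Lemma is_so3_rot v : is_so3 (rot v).
Proof.
have s0 : 1 + qf v != 0 by rewrite gt_eqF // qf_gt0.
have trE : (rot v)^T = (1 + qf v)^-1 *: (rot_num v)^T by rewrite /rot linearZ.
apply/andP; split.
  rewrite trE /rot -scalemxAl -scalemxAr rot_num_orth !scale_scalar_mx.
  by apply/eqP; congr (_%:M); field.
apply/asboolP => w; rewrite trE /rot -!scalemxAl -!scalemxAr rot_num_hat !scalerA hatZ mulfVK //.
Qed.

Definition so3_rot v : so3 := Sub _ (is_so3_rot v).

(** For a rotation by the angle theta this is 4 cos^2 (theta / 2), which is 0 exactly at the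
    half-turns. *)
Definition tr1 A : R := 1 + (A o0 o0 + A o1 o1 + A o2 o2).

Definition cay A : 'rV[R]_3 := (tr1 A)^-1 *: vee A.

Lemma tr1_rot v : tr1 (rot v) = 4 / (1 + qf v).
Proof.
have s0 : 1 + qf v != 0 by rewrite gt_eqF // qf_gt0.
by move: s0; rewrite /tr1 /rot /rot_num !mxs ?big_ord1 ?mxE /= /qf => s0; field.
Qed.

Lemma tr1_rot_neq0 v : tr1 (rot v) != 0.
Proof. by rewrite tr1_rot mulf_neq0 ?pnatr_eq0 // invr_eq0 gt_eqF // qf_gt0. Qed.

Lemma cayK v : cay (rot v) = v.
Proof.
have s0 : 1 + qf v != 0 by rewrite gt_eqF // qf_gt0.
rewrite /cay tr1_rot; move: s0; rewrite /rot /rot_num /qf => s0.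
by apply: rV3P; rewrite !mxs ?big_ord1 ?mxE /=; field.
Qed.

(** Compatibility with [hat], tested on the basis vectors, says that A is its own cofactor matrix,
    as for an orthogonal matrix of determinant 1. *)
Lemma so3_cofactor (A : so3) (a := fun i j => val A i j) :
  [/\ a o0 o0 = a o1 o1 * a o2 o2 - a o1 o2 * a o2 o1,
      a o1 o1 = a o0 o0 * a o2 o2 - a o0 o2 * a o2 o0 &
      a o2 o2 = a o0 o0 * a o1 o1 - a o0 o1 * a o1 o0] /\
  [/\ a o0 o1 = a o1 o2 * a o2 o0 - a o1 o0 * a o2 o2,
      a o1 o0 = a o0 o2 * a o2 o1 - a o0 o1 * a o2 o2 &
      a o0 o2 = a o1 o0 * a o2 o1 - a o1 o1 * a o2 o0] /\
  [/\ a o2 o0 = a o0 o1 * a o1 o2 - a o0 o2 * a o1 o1,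
      a o1 o2 = a o2 o0 * a o0 o1 - a o0 o0 * a o2 o1 &
      a o2 o1 = a o1 o0 * a o0 o2 - a o0 o0 * a o1 o2].
Proof.
have E k i j : (val A *m hat (delta_mx 0 k) *m (val A)^T) i j =
    hat (delta_mx 0 k *m (val A)^T) i j by rewrite so3_hat.
rewrite /a.
have := E o0 o2 o1; have := E o0 o0 o2; have := E o0 o1 o0.
have := E o1 o2 o1; have := E o1 o0 o2; have := E o1 o1 o0.
have := E o2 o2 o1; have := E o2 o0 o2; have := E o2 o1 o0.
rewrite !conj_hatE ![hat _ _ _]mxE /= !mul_trE.
rewrite ![delta_mx _ _ _ _]mxE /= !mul1r !mul0r !addr0 !add0r.
by do 9 (move=> ?); split; [|split]; split; lra.
Qed.

Lemma so3_rows (A : so3) (a := fun i j => val A i j) i j :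
  a i o0 * a j o0 + a i o1 * a j o1 + a i o2 * a j o2 = (i == j)%:R.
Proof.
have := congr1 (fun M : 'M[R]_3 => M i j) (so3_orth A).
by rewrite !mxs /a => ->.
Qed.

Lemma so3_cols (A : so3) (a := fun i j => val A i j) i j :
  a o0 i * a o0 j + a o1 i * a o1 j + a o2 i * a o2 j = (i == j)%:R.
Proof.
have := congr1 (fun M : 'M[R]_3 => M i j) (so3_orthV A).
by rewrite !mxs /a => ->.
Qed.

(** If (c, s n) is a unit quaternion of the rotation, then t = 4 c^2 and w = 4 c s n, and these are
    the relations between products of its components. They are linear consequences, in the monomials
    of the entries, of the cofactor and orthogonality relations. *)
Lemma so3_vee (A : so3) (a := fun i j => val A i j) (w := vee (val A)) (t := tr1 (val A)) :
  [/\ w 0 o0 * w 0 o1 = t * (a o0 o1 + a o1 o0),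
      w 0 o0 * w 0 o2 = t * (a o0 o2 + a o2 o0) &
      w 0 o1 * w 0 o2 = t * (a o1 o2 + a o2 o1)] /\
  [/\ w 0 o0 ^+ 2 = t * (2 + 2 * a o0 o0 - t),
      w 0 o1 ^+ 2 = t * (2 + 2 * a o1 o1 - t) &
      w 0 o2 ^+ 2 = t * (2 + 2 * a o2 o2 - t)].
Proof.
rewrite /w /t /tr1 !mxE /= -/(a _ _).
have [[c00 c11 c22] [[c01 c10 c02] [c20 c12 c21]]] := so3_cofactor A.
have r i j := so3_rows A i j; have c i j := so3_cols A i j.
have := r o0 o0; have := r o1 o1; have := r o2 o2; have := c o0 o0.
have := c o1 o1; have := c o2 o2; have := r o0 o1; have := r o0 o2.
have := r o1 o2; have := c o0 o1; have := c o0 o2; have := c o1 o2.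
rewrite /a /=; move: c00 c11 c22 c01 c10 c02 c20 c12 c21.
move: (val A o0 o0) (val A o0 o1) (val A o0 o2) (val A o1 o0) (val A o1 o1)
 (val A o1 o2) (val A o2 o0) (val A o2 o1) (val A o2 o2) => a00 a01 a02 a10 a11 a12 a20 a21 a22.
do 21 (move=> ?); split; split; lra.
Qed.

Lemma rotK (A : so3) : tr1 (val A) != 0 -> rot (cay (val A)) = val A.
Proof.
move=> t0; have [[w01 w02 w12] [w00 w11 w22]] := so3_vee A.
have s4 : 1 + qf (cay (val A)) = 4 / tr1 (val A).
  rewrite /qf /cay ![(_ *: vee _) _ _]mxE !exprMn w00 w11 w22.
  by move: t0; rewrite /tr1 => t0; field.
have n4 : 1 - qf (cay (val A)) = 2 - 4 / tr1 (val A) by rewrite -s4; ring.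
have E i j : rot (cay (val A)) i j = tr1 (val A) / 4 * ((2 - 4 / tr1 (val A)) * (i == j)%:R +
   2 * (vee (val A) 0 i * vee (val A) 0 j / tr1 (val A) ^+ 2) +
   2 * (hat (vee (val A)) i j / tr1 (val A))).
  rewrite /rot mxE s4 invf_div rot_numE n4 /cay hatZ ![(_ *: vee _) _ _]mxE ![(_ *: hat _) _ _]mxE.
  by field; rewrite t0.
have v01 := mulrC (vee (val A) 0 o1) (vee (val A) 0 o0).
have v02 := mulrC (vee (val A) 0 o2) (vee (val A) 0 o0).
have v12 := mulrC (vee (val A) 0 o2) (vee (val A) 0 o1).
apply: mx3P; split; rewrite E /= ?v01 ?v02 ?v12 ?w01 ?w02 ?w12 -?expr2 ?w00 ?w11 ?w22
  [hat _ _ _]mxE /= ?[vee _ _ _]mxE /=; field; exact: t0.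
Qed.

(** Conjugating a rotation rotates its axis and keeps its angle: in Cayley coordinates conjugation
    by A is linear. *)
Lemma rot_conj (A : so3) v : val A *m rot v *m (val A)^T = rot (v *m (val A)^T).
Proof.
have q : qf (v *m (val A)^T) = qf v.
  have := qfE (v *m (val A)^T).
  rewrite trmx_mul trmxK mulmxA -(mulmxA v) so3_orthV mulmx1 qfE.
  by move/matrixP/(_ 0 0); rewrite !mxE eqxx !mulr1n.
rewrite /rot -scalemxAr -scalemxAl q; congr (_ *: _).
rewrite /rot_num q !mulmxDr !mulmxDl -!scalemxAr -!scalemxAl so3_hat.
rewrite trmx_mul trmxK !mulmxA; congr (_ + _ + _).
by rewrite scalar_mxC -mulmxA so3_orth mulmx1.
Qed.

Lemma cay_conj (A : so3) v : cay (val A *m rot v *m (val A)^T) = v *m (val A)^T.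
Proof. by rewrite rot_conj cayK. Qed.

Lemma rot0 : rot (0 : 'rV[R]_3) = 1%:M.
Proof.
rewrite /rot /rot_num (_ : qf (0 : 'rV[R]_3) = 0); last by rewrite /qf !mxE; ring.
rewrite addr0 invr1 scale1r subr0 mulmx0 scaler0 addr0.
rewrite (_ : hat (0 : 'rV[R]_3) = 0) ?scaler0 ?addr0 //.
by apply: mx3P; split; rewrite !mxE /= ?mxE ?oppr0.
Qed.

End cayley.

(** * Topology of SO(3) and its diagonal subgroup *)

Section so3_top.
Context {R : realType}.
Local Notation so3 := (@so3 R).

Lemma ratmx_hat (V : normedModType R) U (f : V -> 'rV[R]_3) :
  ratmx U f -> ratmx U (fun x => hat (f x)).
Proof.
move=> rf; apply: forall3; apply: forall3; under eq_fun do rewrite mxE /=;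
  by [exact: ratfun_cst | exact: rf | apply: ratfunN; exact: rf].
Qed.

Lemma ratmx_rot (V : normedModType R) U (f : V -> 'rV[R]_3) :
  ratmx U f -> ratmx U (fun x => rot (f x)).
Proof.
move=> rf i j; under eq_fun do rewrite mxE rot_numE.
have rq : ratfun U (fun x => qf (f x)).
  under eq_fun do rewrite /qf !expr2.
  by apply: ratfunD; [apply: ratfunD|]; apply: ratfunM; exact: rf.
apply: ratfunM.
  apply: ratfunV; first by apply: ratfunD => //; exact: ratfun_cst.
  by move=> x _; rewrite gt_eqF // qf_gt0.
apply: ratfunD; [apply: ratfunD|].
- apply: ratfunM; last exact: ratfun_cst.
  by apply: ratfunB => //; exact: ratfun_cst.
- apply: ratfunM; first exact: ratfun_cst.
  by apply: ratfunM; exact: rf.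
- apply: ratfunM; first exact: ratfun_cst.
  exact: ratmx_hat.
Qed.

Lemma ratfun_tr1 (V : normedModType R) U (f : V -> 'M[R]_3) :
  ratmx U f -> ratfun U (fun x => tr1 (f x)).
Proof.
move=> rf; rewrite /tr1; apply: ratfunD; first exact: ratfun_cst.
by apply: ratfunD; [apply: ratfunD|]; exact: rf.
Qed.

Lemma ratmx_cay (V : normedModType R) U (f : V -> 'M[R]_3) :
  ratmx U f -> (forall x, U x -> tr1 (f x) != 0) -> ratmx U (fun x => cay (f x)).
Proof.
move=> rf t0 i; rewrite (ord1 i) => j; under eq_fun do rewrite mxE.
apply: ratfunM; first by apply: ratfunV => //; exact: ratfun_tr1.
by move: j; apply: forall3; under eq_fun do rewrite mxE /=; apply: ratfunB; exact: rf.
Qed.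

Lemma val_so3_continuous : continuous (val : so3 -> 'M[R]_3).
Proof. exact: initial_continuous. Qed.

Lemma so3_continuous (T : topologicalType) (f : T -> so3) :
  continuous (fun x => val (f x)) -> continuous f.
Proof. exact: (@continuous_comp_initial _ _ _ (val : so3 -> 'M[R]_3)). Qed.

Lemma so3_second_countable : @second_countable so3.
Proof.
exact: (@second_countable_initial _ _ (val : so3 -> 'M[R]_3) (second_countable_mx R 3 3)).
Qed.

Lemma so3_rot_continuous (A : so3) : continuous (fun v : 'rV[R]_3 => (A * so3_rot v)%g).
Proof.
apply: so3_continuous => v; apply: (@ratmx_continuous _ _ _ _ setT) => //.
apply: ratmxM; first exact: ratmx_cst.
by apply: ratmx_rot; apply: ratmx_linear => // x; exact: cvg_id.
Qed.

Lemma is_so3_diag (a b : bool) :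
  is_so3 (diag_mx (\row_j nth 0 [:: (-1) ^+ a; (-1) ^+ b; (-1) ^+ (a (+) b)] j) : 'M[R]_3).
Proof.
have s2 (c : bool) : (-1) ^+ c * (-1) ^+ c = 1 :> R by rewrite -expr2 sqrr_sign.
set D := diag_mx _.
have DE i j : D i j = nth 0 [:: (-1) ^+ a; (-1) ^+ b; (-1) ^+ (a (+) b)] i * (i == j)%:R.
  by rewrite !mxE mulr_natr.
clearbody D; apply/andP; split.
  by apply/eqP; apply: mx3P; split; rewrite mxE sum3 ![_^T _ _]mxE !DE mxE /=
    ?mulr0 ?mul0r ?addr0 ?add0r ?mulr1 ?s2.
apply/asboolP => v; apply: mx3P; split; rewrite conj_hatE [hat _ _ _]mxE /= ?mul_trE !DE /=;
 by case: a {DE}; case: b => /=; rewrite ?expr0 ?expr1; ring.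
Qed.

(** The Klein four-group of diagonal rotations, [half_turn false false] being the identity. It
    carries the holonomy and also provides the cells for connectedness. *)
Definition half_turn a b : so3 := Sub _ (is_so3_diag a b).

Lemma half_turnE a b i j : val (half_turn a b) i j =
  nth 0 [:: (-1) ^+ a; (-1) ^+ b; (-1) ^+ (a (+) b)] i * (i == j)%:R.
Proof. by rewrite !mxE mulr_natr. Qed.

Lemma half_turnM a b c d :
  (half_turn a b * half_turn c d)%g = half_turn (a (+) c) (b (+) d).
Proof.
apply: val_inj; apply/matrixP => i j; rewrite val_so3M mxE sum3 !half_turnE.
by move: i j; apply: forall3; apply: forall3; rewrite /= ?mulr0 ?mul0r ?addr0 ?add0r
  ?mulr1 -?signr_addb // -addbA (addbCA b) addbA.
Qed.

Lemma half_turn1 : half_turn false false = 1%g.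
Proof.
by apply: val_inj; apply: mx3P; split; rewrite half_turnE val_so31 mxE /= ?mulr1 ?mulr0.
Qed.

(** The four diagonal matrices add up to 0, so the four values of [tr1] add up to 4 and cannot all
    vanish. *)
Lemma half_turn_tr1 (A : so3) : exists a b, tr1 (val (half_turn a b * A)%g) != 0.
Proof.
apply: contrapT => nex.
have t0 a b : tr1 (val (half_turn a b * A)%g) = 0.
  by apply/eqP; apply: contra_notT nex => t; exists a, b.
have := t0 false false; have := t0 false true; have := t0 true false; have := t0 true true.
rewrite /tr1 !val_so3M !mxE !sum3 !half_turnE /=; lra.
Qed.

(** The cyclic permutation of the axes has zero diagonal, and so have its products with diagonal
    matrices; [tr1] is 1 on all of them. It is thus common to the four cells in [so3_connected]. *)
Lemma cyclic_rot_subproof : is_so3 (\matrix_(i, j) (j == nth o0 [:: o1; o2;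
  o0] i)%:R : 'M[R]_3).
Proof.
set P := \matrix_(_, _) _.
have PE i j : P i j = (j == nth o0 [:: o1; o2; o0] i)%:R by rewrite mxE.
clearbody P; apply/andP; split.
  by apply/eqP; apply: mx3P; split; rewrite mxE sum3 ![_^T _ _]mxE !PE mxE /=; ring.
by apply/asboolP => v; apply: mx3P; split;
  rewrite conj_hatE [hat _ _ _]mxE /= ?mul_trE !PE /=; ring.
Qed.

(** Four translates of the Cayley cell cover the group. Each is an image of R^3, and they have a
    point in common. *)
Lemma so3_connected : connected [set: so3].
Proof.
pose C ab := range (fun v => half_turn ab.1 ab.2 * so3_rot v)%g.
have CP A a b : tr1 (val (half_turn a b * A)%g) != 0 -> C (a, b) A.
  move=> t0; set B := (half_turn a b * A)%g in t0 *.
  have e : so3_rot (cay (val B)) = B by apply: val_inj; exact: rotK t0.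
  by exists (cay (val B)) => //=; rewrite e mulgA half_turnM !addbb half_turn1 mul1g.
have -> : [set: so3] = \bigcup_(ab in setT) C ab.
  by apply/seteqP; split => // A _; have [a [b t0]] := half_turn_tr1 A;
    exists (a, b) => //; exact: CP.
apply: bigcup_connected; last first.
  move=> ab _; apply: connected_continuous_connected; first exact: connected_normed.
  exact/continuous_subspaceT/so3_rot_continuous.
exists (Sub _ cyclic_rot_subproof) => -[a b] _; apply: CP.
by rewrite /tr1 val_so3M !mxE !sum3 !half_turnE !mxE /= ?mulr0 ?mul0r ?addr0 oner_eq0.
Qed.

End so3_top.

(** * The Lie group SO(3) x SO(3) *)

Lemma open_neq0 (R : realType) (T : topologicalType) (f : T -> R) :
  continuous f -> open [set x | f x != 0].
Proof.
move=> cf; rewrite (_ : [set _ | _] = f @^-1` (~` [set 0])).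
  by move/continuousP : cf; apply; apply: closed_openC; exact: closed_eq.
by apply/seteqP; split => x /= /eqP.
Qed.

Definition so33 (R : realType) : Type := (@so3 R * @so3 R)%type.
HB.instance Definition _ (R : realType) := Group.on (so33 R).
HB.instance Definition _ (R : realType) := Topological.on (so33 R).

Section lie.
Context {R : realType}.
Local Notation so3 := (@so3 R).
Local Notation G := (so33 R).
Local Notation n := (3 + 3)%N.
Implicit Types (a b x : G) (y : 'rV[R]_n).

Definition so33_rot y : G := (so3_rot (lsubmx y), so3_rot (rsubmx y)).

Definition so33_cay x : 'rV[R]_n := row_mx (cay (val x.1)) (cay (val x.2)).

Definition so33_den x : R := tr1 (val x.1) * tr1 (val x.2).

(* Charts are the left translates of the Cayley chart. *)
Definition so33_atlas : atlas 'rV[R]_n G :=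
  @Atlas R 'rV[R]_n G G
    (fun a => [set x | so33_den (a^-1 * x)%g != 0])
    (fun a x => so33_cay (a^-1 * x)%g)
    (fun a y => (a * so33_rot y)%g).

Lemma so33_den_rot y : so33_den (so33_rot y) != 0.
Proof. by rewrite /so33_den mulf_neq0 // tr1_rot_neq0. Qed.

Lemma so33_cayK y : so33_cay (so33_rot y) = y.
Proof. by rewrite /so33_cay /= !cayK hsubmxK. Qed.

Lemma so33_rotK x : so33_den x != 0 -> so33_rot (so33_cay x) = x.
Proof.
rewrite /so33_den mulf_eq0 negb_or => /andP[t1 t2].
rewrite /so33_rot /so33_cay row_mxKl row_mxKr; case: x t1 t2 => A B /= t1 t2.
by congr (_, _); apply: val_inj; exact: rotK.
Qed.

Lemma so33_chart_dom (a : so33_atlas) x : chart_dom a x = (so33_den (a^-1 * x)%g != 0).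
Proof. by []. Qed.

Lemma so33_paramK (a : so33_atlas) x : chart_dom a x ->
  chart_param a (chart_coord a x) = x.
Proof. by move=> xa; rewrite /chart_param /chart_coord /= so33_rotK // mulgA mulgV mul1g. Qed.

Lemma so33_coordK (a : so33_atlas) y : chart_coord a (chart_param a y) = y.
Proof. by rewrite /chart_coord /chart_param /= mulgA mulVg mul1g so33_cayK. Qed.

Lemma so33_param_dom (a : so33_atlas) y : chart_dom a (chart_param a y).
Proof. by rewrite so33_chart_dom /chart_param /= mulgA mulVg mul1g so33_den_rot. Qed.

(** Each chart is onto R^6, so a chart image is simply a preimage under the parametrization. *)
Lemma so33_chart_img (a : so33_atlas) U :
  chart_img a U = [set y | U (chart_param a y)].
Proof.
apply/seteqP; split => [_ [x [xa Ux] <-]|y Uy].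
  by rewrite /mkset so33_paramK.
exists (chart_param a y); last exact: so33_coordK.
by split=> //; exact: so33_param_dom.
Qed.

Lemma so33_continuous (T : topologicalType) (f : T -> G) :
  continuous (fun t => val (f t).1) -> continuous (fun t => val (f t).2) -> continuous f.
Proof.
move=> c1 c2; rewrite (_ : f = fun t => ((f t).1, (f t).2)); last first.
  by apply/funext => t; case: (f t).
by apply: continuous_pair; exact: so3_continuous.
Qed.

Lemma val1_continuous : continuous (fun x : G => val x.1).
Proof.
move=> x; apply: (@continuous_comp _ _ _ (fun x : so3 * so3 => x.1) val);
  first exact: cvg_fst.
exact: val_so3_continuous.
Qed.

Lemma val2_continuous : continuous (fun x : G => val x.2).
Proof.
move=> x; apply: (@continuous_comp _ _ _ (fun x : so3 * so3 => x.2) val);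
  first exact: cvg_snd.
exact: val_so3_continuous.
Qed.

Lemma mulmx_continuous (T : topologicalType) (f g : T -> 'M[R]_3) :
  continuous f -> continuous g -> continuous (fun t => f t *m g t).
Proof.
move=> cf cg t.
apply: (@continuous_comp _ _ _ (fun t => (f t, g t)) (fun M : 'M[R]_3 * 'M[R]_3 => M.1 *m M.2)).
  by apply: continuous_pair.
apply: (@ratmx_continuous _ _ _ _ setT) => //.
by apply: ratmxM; apply: ratmx_linear => // y; [exact: cvg_fst | exact: cvg_snd].
Qed.

Lemma so33_mul_continuous (T : topologicalType) (f g : T -> G) :
  continuous f -> continuous g -> continuous (fun t => f t * g t)%g.
Proof.
move=> cf cg.
have c1 (h : T -> G) : continuous h -> continuous (fun t => val (h t).1).
  by move=> ch t; apply: (@continuous_comp _ _ _ h (fun z : G => val z.1));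
    [exact: ch | exact: val1_continuous].
have c2 (h : T -> G) : continuous h -> continuous (fun t => val (h t).2).
  by move=> ch t; apply: (@continuous_comp _ _ _ h (fun z : G => val z.2));
    [exact: ch | exact: val2_continuous].
apply: so33_continuous.
  exact: (mulmx_continuous (c1 _ cf) (c1 _ cg)).
exact: (mulmx_continuous (c2 _ cf) (c2 _ cg)).
Qed.

Lemma so33_inv_continuous : continuous (fun x : G => x^-1)%g.
Proof.
have ct : continuous (fun M : 'M[R]_3 => M^T).
  move=> M; apply: (@ratmx_continuous _ _ _ _ setT) => //.
  by apply: ratmx_tr; apply: ratmx_linear => // y; exact: cvg_id.
apply: so33_continuous => x.
  apply: (@continuous_comp _ _ _ (fun x : G => val x.1) (fun M => M^T));
    [exact: val1_continuous | exact: ct].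
apply: (@continuous_comp _ _ _ (fun x : G => val x.2) (fun M => M^T));
  [exact: val2_continuous | exact: ct].
Qed.

Lemma so33_den_continuous : continuous so33_den.
Proof.
have ct : continuous (fun M : 'M[R]_3 => tr1 M).
  move=> M; apply: (@ratfun_continuous _ _ setT) => //.
  by apply: ratfun_tr1; apply: ratmx_linear => // y; exact: cvg_id.
move=> x; apply: cvgM.
  apply: (@continuous_comp _ _ _ (fun x : G => val x.1) tr1);
    [exact: val1_continuous | exact: ct].
apply: (@continuous_comp _ _ _ (fun x : G => val x.2) tr1);
  [exact: val2_continuous | exact: ct].
Qed.

Lemma open_so33_dom (T : topologicalType) (p : T -> G) (a : so33_atlas) :
  continuous p -> open [set t | chart_dom a (p t)].
Proof.
move=> cp; apply: open_neq0 => t.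
apply: (@continuous_comp _ _ _ (fun t => a^-1 * p t)%g so33_den);
  last exact: so33_den_continuous.
by apply: so33_mul_continuous => //; exact: cst_continuous.
Qed.

Section rational_maps.
Context {V : normedModType R}.
Implicit Types (p q : V -> G).

(** Rational in the matrix entries of both factors. The class is stable under the group operations,
    and so covers multiplication, inversion and chart changes alike. *)
Definition ratG U p := ratmx U (fun v => val (p v).1) /\ ratmx U (fun v => val (p v).2).

Lemma ratG_mul U p q : ratG U p -> ratG U q -> ratG U (fun v => p v * q v)%g.
Proof. by move=> [p1 p2] [q1 q2]; split; apply: ratmxM. Qed.

Lemma ratG_inv U p : ratG U p -> ratG U (fun v => (p v)^-1)%g.
Proof. by move=> [p1 p2]; split; apply: ratmx_tr. Qed.

Lemma ratG_cst U a : ratG U (fun=> a).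
Proof. by split; exact: ratmx_cst. Qed.

Lemma ratG_rot U (f : V -> 'rV[R]_n) : ratmx U f -> ratG U (fun v => so33_rot (f v)).
Proof.
move=> rf; split; apply: ratmx_rot => i j; under eq_fun do rewrite mxE; exact: rf.
Qed.

Lemma ratG_continuous p : ratG setT p -> continuous p.
Proof.
by move=> [p1 p2]; apply: so33_continuous => v;
  [exact: ratmx_continuous p1 _ | exact: ratmx_continuous p2 _].
Qed.

(** Chart coordinates are rational in the matrix entries with denominators [tr1], which do not
    vanish on the chart domain. *)
Lemma ratG_smooth p (a : so33_atlas) : ratG setT p ->
  smooth [set v | chart_dom a (p v)] (chart_coord a \o p).
Proof.
move=> rp; apply: ratmx_smooth; first by apply: open_so33_dom; exact: ratG_continuous.
set U := [set v | _].
have [r1 r2] : ratG U (fun v => a^-1 * p v)%g.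
  apply: ratG_mul; first exact: ratG_cst.
  by case: rp => p1 p2; split => i j; apply: (@ratfun_sub _ _ _ setT).
have dom v : U v -> tr1 (val (a^-1 * p v)%g.1) != 0 /\ tr1 (val (a^-1 * p v)%g.2) != 0.
  by move=> Uv; apply/andP; rewrite -negb_or -mulf_eq0.
move=> i j; rewrite /chart_coord /= /so33_cay.
case: (splitP j) => k jk.
  rewrite (_ : j = lshift 3 k); last exact/val_inj.
  by under eq_fun do rewrite row_mxEl; apply: (ratmx_cay r1 _ i k) => v /dom [].
rewrite (_ : j = rshift 3 k); last exact/val_inj.
by under eq_fun do rewrite row_mxEr; apply: (ratmx_cay r2 _ i k) => v /dom [].
Qed.

End rational_maps.

Lemma ratG_param (V : normedModType R) U (a : so33_atlas) (f : V -> 'rV[R]_n) :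
  ratmx U f -> ratG U (fun v => chart_param a (f v)).
Proof. by move=> rf; apply: ratG_mul; [exact: ratG_cst | exact: ratG_rot]. Qed.

Lemma ratG_param_id U (a : so33_atlas) : ratG U (chart_param a).
Proof. by apply: (@ratG_param _ _ _ id); apply: ratmx_linear => // y; exact: cvg_id. Qed.

Lemma so33_hausdorff : hausdorff_space G.
Proof.
apply: (@hausdorff_injective _ _ (fun x : G => (val x.1, val x.2))).
- by apply: continuous_pair; [exact: val1_continuous | exact: val2_continuous].
- by move=> [A B] [C D] [/val_inj -> /val_inj ->].
- exact: norm_hausdorff.
Qed.

Lemma so33_den1 : so33_den 1%g != 0.
Proof. by rewrite /so33_den /= /tr1 !mxE /= mulf_neq0 //; lra. Qed.

Lemma so33_smooth_manifold : is_smooth_manifold so33_atlas.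
Proof.
split; first exact: so33_hausdorff.
  exact: second_countable_prod so3_second_countable so3_second_countable.
have cp a := ratG_continuous (ratG_param_id setT a).
split.
- by move=> x; exists x; rewrite so33_chart_dom mulVg so33_den1.
- move=> a; split.
    by apply: (@open_so33_dom _ id) => x; exact: cvg_id.
  by rewrite so33_chart_img; exact: openT.
- exact: so33_paramK.
- move=> a; split; last exact: continuous_subspaceT (cp a).
  apply/subspace_continuousP => x xa.
  apply: cvg_within_filter.
  have c : continuous (fun x : G => a^-1 * x)%g.
    by apply: so33_mul_continuous; [exact: cst_continuous | move=> ?; exact: cvg_id].
  apply: (@continuous_comp _ _ _ (fun x : G => a^-1 * x)%g so33_cay x (c x)).
  move: xa; rewrite so33_chart_dom; move: (a^-1 * x)%g => z.
  rewrite /so33_den mulf_eq0 negb_or => /andP[t1 t2].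
  have cc : forall M : 'M[R]_3, tr1 M != 0 -> {for M, continuous cay}.
    move=> M tM; apply: (@ratmx_continuous _ _ _ _ [set M | tr1 M != 0]) => //.
    by apply: ratmx_cay => //; apply: ratmx_linear => // y; exact: cvg_id.
  apply: continuous_mx => i j; rewrite /so33_cay.
  case: (splitP j) => k jk.
    rewrite (_ : j = lshift 3 k); last exact/val_inj.
    rewrite (_ : (fun y : G => row_mx _ _ _ _) = (fun y : G => cay (val y.1) i k));
      last first.
      by apply/funext => y; rewrite row_mxEl.
    apply: (@continuous_comp _ _ _ (fun x : G => val x.1) (fun M => cay M i k));
      first exact: val1_continuous.
    exact: (@continuous_comp _ _ _ cay (fun N => N i k) _ (cc _ t1) (@coord_continuous _ _ _ i k _)).
  rewrite (_ : j = rshift 3 k); last exact/val_inj.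
  rewrite (_ : (fun y : G => row_mx _ _ _ _) = (fun y : G => cay (val y.2) i k));
    last first.
    by apply/funext => y; rewrite row_mxEr.
  apply: (@continuous_comp _ _ _ (fun x : G => val x.2) (fun M => cay M i k));
    first exact: val2_continuous.
  exact: (@continuous_comp _ _ _ cay (fun N => N i k) _ (cc _ t2) (@coord_continuous _ _ _ i k _)).
- move=> a b; rewrite smooth_onE so33_chart_img.
  exact: ratG_smooth (ratG_param_id setT a).
Qed.

Lemma so33_mul_smooth :
  smooth_map (prod_atlas so33_atlas so33_atlas) so33_atlas (fun p => p.1 * p.2)%g.
Proof.
split.
  by apply: so33_mul_continuous => p; [exact: cvg_fst | exact: cvg_snd].
move=> [a b] c; rewrite smooth_onE.
have -> : chart_img ((a, b) : prod_atlas so33_atlas so33_atlas)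
    ((fun p : G * G => (p.1 * p.2)%g) @^-1` chart_dom c) =
    [set y | chart_dom c (chart_param a y.1 * chart_param b y.2)%g].
  apply/seteqP; split => [_ [[x x'] [[/= xa xb] xc] <-]|[y y'] /= yc].
    change (chart_dom c (chart_param a (chart_coord a x) * chart_param b (chart_coord b x'))%g).
    by rewrite !so33_paramK.
  exists (chart_param a y, chart_param b y').
    split; last exact: yc.
    by split; exact: so33_param_dom.
  by congr (_, _); exact: so33_coordK.
apply: (@ratG_smooth _ (fun y : 'rV[R]_n * 'rV[R]_n => chart_param a y.1 * chart_param b y.2)%g c).
by apply: ratG_mul; apply: ratG_param; apply: ratmx_linear => // y;
  [exact: cvg_fst | exact: cvg_snd].
Qed.

Lemma so33_inv_smooth : smooth_map so33_atlas so33_atlas (fun x => x^-1)%g.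
Proof.
split; first exact: so33_inv_continuous.
move=> a b; rewrite smooth_onE so33_chart_img.
apply: (@ratG_smooth _ (fun y => (chart_param a y)^-1)%g b).
exact/ratG_inv/ratG_param_id.
Qed.

Lemma so33_chart1P : chart_dom (1%g : so33_atlas) 1%g.
Proof. by rewrite so33_chart_dom mulVg so33_den1. Qed.

Definition so33_lie : lie_group R n :=
  @LieGroup R n G so33_atlas so33_smooth_manifold so33_mul_smooth so33_inv_smooth
    (1%g : so33_atlas) so33_chart1P.

Lemma so33_connected : connected [set: G].
Proof. exact: connected_prod so3_connected so3_connected. Qed.

(** Transposed blocks, because vectors are rows: [v *m A^T] is A applied to v. *)
Definition so33_Ad (x : G) : 'M[R]_n := block_mx (val x.1)^T 0 0 (val x.2)^T.

Lemma mul_so33_Ad (x : G) y :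
  y *m so33_Ad x = row_mx (lsubmx y *m (val x.1)^T) (rsubmx y *m (val x.2)^T).
Proof.
by rewrite -{1}[y]hsubmxK mul_row_block !mulmx0 addr0 add0r.
Qed.

Lemma so33_coord1 : so33_cay (1^-1 * 1 : G)%g = 0.
Proof.
rewrite mulVg -(so33_cayK 0); congr so33_cay; apply: (congr2 pair); apply: val_inj => /=;
by rewrite ?lsubmx0 ?rsubmx0 /= ?linear0 rot0.
Qed.

(** By [cay_conj], conjugation is already linear in the chart at 1, so its Jacobian matrix is its
    own matrix. *)
Lemma so33_Ad_mx (x : G) : Ad_mx (x : so33_lie) = so33_Ad x.
Proof.
apply: jacobian_affineT => y.
rewrite /chart_coord /chart_param /=.
have E z : so33_cay (1^-1 * (x * (1 * so33_rot z) * x^-1))%g = z *m so33_Ad x.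
  rewrite invg1 !mul1g mul_so33_Ad /so33_cay /=.
  by rewrite !cay_conj.
by rewrite so33_coord1 subr0 !E mul0mx add0r.
Qed.

End lie.

(** * The Lie bracket and semisimplicity *)

Section bracket.
Context {R : realType}.
Local Notation G := (so33 R).
Local Notation so33_lie := (@so33_lie R).
Local Notation n := (3 + 3)%N.
Implicit Types (v w : 'rV[R]_3) (X Y : 'rV[R]_n).

Definition cross v w : 'rV[R]_3 := w *m (hat v)^T.

Lemma crossE v w : cross v w = \row_j nth 0
  [:: v 0 o1 * w 0 o2 - v 0 o2 * w 0 o1;
      v 0 o2 * w 0 o0 - v 0 o0 * w 0 o2;
      v 0 o0 * w 0 o1 - v 0 o1 * w 0 o0] j.
Proof.
by apply: rV3P; rewrite /cross mul_trE ![hat _ _ _]mxE [RHS]mxE /=; ring.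
Qed.

Lemma hat0 : hat (0 : 'rV[R]_3) = 0.
Proof. by rewrite -(scale0r 0) hatZ scale0r. Qed.

Lemma rot_scale v w (h : R) : w *m (rot (h *: v))^T =
  (1 + h ^+ 2 * qf v)^-1 *: ((1 - h ^+ 2 * qf v) *: w +
   (2 * h ^+ 2) *: (w *m v^T *m v) + (2 * h) *: cross v w).
Proof.
have q : qf (h *: v) = h ^+ 2 * qf v by rewrite /qf !mxE; ring.
rewrite /rot /rot_num linearZ /= -scalemxAr q; congr (_ *: _).
have t : ((1 - h ^+ 2 * qf v)%:M + 2 *: ((h *: v)^T *m (h *: v)) + 2 *: hat (h *: v))^T =
    (1 - h ^+ 2 * qf v)%:M + (2 * h ^+ 2) *: (v^T *m v) + (2 * h) *: (hat v)^T.
  rewrite hatZ; move: (hat v) => H; apply/matrixP => i j.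
  by rewrite !mxE !big_ord1 !mxE eq_sym; ring.
rewrite t !mulmxDr mul_mx_scalar -!scalemxAr mulmxA //.
Qed.

Lemma rot_quotient (h q : R) w a b : h != 0 -> 1 + h ^+ 2 * q != 0 ->
  h^-1 *: ((1 + h ^+ 2 * q)^-1 *: ((1 - h ^+ 2 * q) *: w + (2 * h ^+ 2) *: a + (2 * h) *: b) - w) =
  (1 + h ^+ 2 * q)^-1 *: (2 *: b + h *: (2 *: a - (2 * q) *: w)) :> 'rV[R]_3.
Proof. by move=> h0 s0; apply/rowP => j; rewrite !mxE; field; rewrite h0 s0. Qed.

(** The factor 2 arises because [rot (h *: v)] turns by an angle 2 arctan (h |v|) for h > 0. *)
Lemma cvg_rot v w :
  h^-1 *: (w *m (rot (h *: v))^T - w) @[h --> (0 : R)^'] --> 2 *: cross v w.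
Proof.
set a := w *m v^T *m v.
pose K := 2 *: a - (2 * qf v) *: w.
(* The difference quotient with h cancelled; unlike the quotient it is continuous at 0, where it
   takes the limit value. *)
pose g (h : R) := (1 + h ^+ 2 * qf v)^-1 *: (2 *: cross v w + h *: K).
have g0 : g 0 = 2 *: cross v w by rewrite /g expr0n mul0r addr0 invr1 scale1r scale0r addr0.
have cg : g h @[h --> (0 : R)] --> g 0.
  apply: cvgZ.
    apply: (@ratfun_continuous _ R^o setT (fun h => (1 + h ^+ 2 * qf v)^-1) 0) => //.
    have rid : ratfun (setT : set R^o) (fun h : R^o => h : R).
      by apply: ratfun_lin => // h; exact: cvg_id.
    apply: ratfunV.
      apply: ratfunD; first exact: ratfun_cst.
      apply: ratfunM; last exact: ratfun_cst.
      by under eq_fun do rewrite expr2; exact: ratfunM.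
    move=> h _; rewrite gt_eqF // ltr_wpDr // mulr_ge0 ?sqr_ge0 //.
    by rewrite /qf !addr_ge0 ?sqr_ge0.
  by apply: cvgD; [exact: cvg_cst | apply: cvgZr_tmp; exact: cvg_id].
rewrite -g0; apply: (@cvg_trans _ (g @ (0 : R)^')).
  apply: near_eq_cvg; near=> h.
  have h0 : h != 0 by near: h; exact: nbhs_dnbhs_neq.
  rewrite rot_scale -/a /g /K.
  have s0 : 1 + h ^+ 2 * qf v != 0.
    rewrite gt_eqF // ltr_wpDr // mulr_ge0 ?sqr_ge0 //.
    by rewrite /qf !addr_ge0 ?sqr_ge0.
  by rewrite rot_quotient.
exact: cvg_within_filter cg.
Unshelve. all: by end_near. Qed.

Lemma so33_lie_bracket X Y : lie_bracket so33_lie X Y =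
  row_mx (2 *: cross (lsubmx X) (lsubmx Y)) (2 *: cross (rsubmx X) (rsubmx Y)).
Proof.
(* The two blocks are separated into a sum, so that the limit reduces to [cvg_rot] in each
   factor. *)
pose F y := (lsubmx Y *m (rot (lsubmx y))^T) *m row_mx 1%:M 0 +
    (rsubmx Y *m (rot (rsubmx y))^T) *m row_mx 0 1%:M : 'rV[R]_n.
have EF : (fun y => Y *m Ad_mx (chart_param (lie_chart1 so33_lie) y)) = F.
  apply/funext => y; transitivity (Y *m so33_Ad (so33_rot y)).
    by congr (Y *m _); rewrite -[so33_rot y]mul1g; exact: so33_Ad_mx.
  rewrite mul_so33_Ad /F /= !mul_mx_row !mulmx1 !mulmx0.
  by rewrite add_row_mx addr0 add0r.
have e1 : chart_coord (lie_chart1 so33_lie) 1%g = 0.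
  exact: so33_coord1.
rewrite /lie_bracket EF e1; apply: cvg_lim => //.
have -> : (fun h : R => h^-1 *: (F (h *: X + 0) - F 0)) =
  (fun h : R => (h^-1 *: (lsubmx Y *m (rot (h *: lsubmx X))^T - lsubmx Y)) *m row_mx 1%:M 0 +
     (h^-1 *: (rsubmx Y *m (rot (h *: rsubmx X))^T - rsubmx Y)) *m row_mx 0 1%:M).
  apply/funext => h; rewrite addr0 /F.
  have -> : lsubmx (h *: X) = h *: lsubmx X by exact: linearZ.
  have -> : rsubmx (h *: X) = h *: rsubmx X by exact: linearZ.
  have -> : lsubmx (0 : 'rV[R]_n) = 0 by exact: linear0.
  have -> : rsubmx (0 : 'rV[R]_n) = 0 by exact: linear0.
  rewrite rot0 trmx1 !mulmx1.
  by rewrite -!scalemxAl -scalerDr !mulmxBl opprD addrACA.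
have -> : row_mx (2 *: cross (lsubmx X) (lsubmx Y)) (2 *: cross (rsubmx X) (rsubmx Y)) =
  (2 *: cross (lsubmx X) (lsubmx Y)) *m row_mx 1%:M 0 +
  (2 *: cross (rsubmx X) (rsubmx Y)) *m row_mx 0 1%:M.
  by rewrite !mul_mx_row !mulmx1 !mulmx0 add_row_mx addr0 add0r.
apply: cvgD.
  apply: (@cvg_comp _ _ _ (fun h : R => h^-1 *: (lsubmx Y *m (rot (h *: lsubmx X))^T - lsubmx Y))
    (fun M => M *m row_mx 1%:M 0)); first exact: cvg_rot.
  exact: continuous_mulmxr.
apply: (@cvg_comp _ _ _ (fun h : R => h^-1 *: (rsubmx Y *m (rot (h *: rsubmx X))^T - rsubmx Y))
  (fun M => M *m row_mx 0 1%:M)); first exact: cvg_rot.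
exact: continuous_mulmxr.
Qed.

(* v x (v x a) = v (v . a) - a (v . v), summed over an orthonormal basis. *)
Lemma sum_cross_cross w :
  \sum_k cross (delta_mx 0 k) (cross (delta_mx 0 k) w) = - 2 *: w.
Proof.
rewrite !big_ord_recl big_ord0 addr0 (_ : ord0 = o0); last exact/val_inj.
rewrite (_ : fintype.lift o0 ord0 = o1); last exact/val_inj.
rewrite (_ : fintype.lift o0 (fintype.lift ord0 ord0) = o2); last exact/val_inj.
by apply: rV3P; rewrite !crossE !mxE /=; ring.
Qed.

Local Notation br := (lie_bracket so33_lie).

Lemma cross_linear v : forall a x y, cross v (a *: x + y) = a *: cross v x + cross v y.
Proof. by move=> a x y; rewrite /cross mulmxDl -scalemxAl. Qed.

Lemma br_linearr X a Y Y' : br X (a *: Y + Y') = a *: br X Y + br X Y'.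
Proof.
rewrite !so33_lie_bracket !linearP /= !cross_linear !scalerDr scale_row_mx add_row_mx.
by rewrite !scalerA ![2 * a]mulrC.
Qed.

Lemma crossC v w : cross v w = - cross w v.
Proof. by apply: rV3P; rewrite !crossE !mxE /=; ring. Qed.

Lemma brC X Y : br X Y = - br Y X.
Proof.
rewrite !so33_lie_bracket opp_row_mx.
by rewrite -!scalerN -!crossC.
Qed.

Lemma br_linearl Y a X X' : br (a *: X + X') Y = a *: br X Y + br X' Y.
Proof. by rewrite brC br_linearr opprD -scalerN -!brC. Qed.

Lemma br_suml (I : Type) (r : seq I) (c : I -> R) (F : I -> 'rV[R]_n) Y :
  br (\sum_(i <- r) c i *: F i) Y = \sum_(i <- r) c i *: br (F i) Y.
Proof.
have br0 : br 0 Y = 0.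
  by have := br_linearl Y 1 0 0;
    rewrite scaler0 addr0 scale1r => /esym/(canRL (addrK _)); rewrite subrr.
elim: r => [|i r IH]; first by rewrite !big_nil.
by rewrite !big_cons br_linearl IH.
Qed.

Lemma br_sumr (I : Type) (r : seq I) (c : I -> R) (F : I -> 'rV[R]_n) X :
  br X (\sum_(i <- r) c i *: F i) = \sum_(i <- r) c i *: br X (F i).
Proof. by rewrite brC br_suml -sumrN; apply: eq_bigr => i _;
  rewrite [in RHS]brC scalerN. Qed.

(** The derived algebra is spanned by brackets of basis vectors only; bilinearity extends this to
    all pairs. *)
Lemma br_derived (U : {vspace 'rV[R]_n}) X Y : X \in U -> Y \in U ->
  br X Y \in derived_algebra so33_lie U.
Proof.
move=> XU YU; rewrite (coord_vbasis XU) (coord_vbasis YU) br_suml.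
apply: rpred_sum => i _; apply: rpredZ; rewrite br_sumr.
apply: rpred_sum => j _; apply: rpredZ; apply: memv_span.
by apply: allpairs_f; apply: mem_nth; rewrite size_tuple.
Qed.

(** * One simple factor, embedded by [inj] and projected by [prj] *)

Section factor.
Variables (inj : 'rV[R]_3 -> 'rV[R]_n) (prj : 'rV[R]_n -> 'rV[R]_3).
Hypothesis inj_lin : forall a v w, inj (a *: v + w) = a *: inj v + inj w.
Hypothesis prjK : cancel inj prj.
Hypothesis br_inj : forall v Y, br (inj v) Y = inj (2 *: cross v (prj Y)).

Let inj0 : inj 0 = 0.
Proof. by have := inj_lin (-1) 0 0; rewrite scaler0 addr0 scaleN1r addNr. Qed.

Lemma inj_sum (F : 'I_3 -> 'rV[R]_3) : inj (\sum_k F k) = \sum_k inj (F k).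
Proof.
have D v w : inj (v + w) = inj v + inj w by rewrite -[v]scale1r inj_lin !scale1r.
exact: (big_morph inj D inj0).
Qed.

Lemma inj_scale a v : inj (a *: v) = a *: inj v.
Proof. by rewrite -[a *: v]addr0 inj_lin inj0 addr0. Qed.

(** Each bracket is twice a cross product, so the sum is 4 * (-2) times w, whence -1/8. The identity
    exhibits the factor as perfect and recovers a vector from its own brackets. *)
Lemma inj_double_bracket w : inj w =
  (- 8^-1) *: \sum_k br (inj (delta_mx 0 k)) (br (inj (delta_mx 0 k)) (inj w)).
Proof.
have -> : \sum_k br (inj (delta_mx 0 k)) (br (inj (delta_mx 0 k)) (inj w)) =
    inj (4 *: \sum_k cross (delta_mx 0 k) (cross (delta_mx 0 k) w)).
  rewrite scaler_sumr inj_sum; apply: eq_bigr => k _.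
  rewrite !br_inj !prjK; congr inj.
  by rewrite /cross -scalemxAl scalerA; congr (_ *: _); ring.
rewrite sum_cross_cross -inj_scale !scalerA.
by rewrite (_ : _ * _ = 1) ?scale1r //; field.
Qed.

Lemma factor_derived (U : {vspace 'rV[R]_n}) :
  (forall w, inj w \in U) -> forall w, inj w \in derived_algebra so33_lie U.
Proof.
move=> iU w; rewrite inj_double_bracket rpredZ // rpred_sum // => k _.
by apply: br_derived => //; rewrite br_inj.
Qed.

(** Brackets with Y put every x x a into the ideal, bracketing once more recovers a, and these
    vectors generate the whole factor. *)
Lemma factor_ideal (I : {vspace 'rV[R]_n}) Y : lie_ideal so33_lie I -> Y \in I ->
  prj Y != 0 -> forall w, inj w \in I.
Proof.
move=> idI YI; set a := prj Y => a0 w.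
have crossI x : inj (cross x a) \in I.
  have := idI (inj x) Y YI; rewrite br_inj inj_scale -/a => /(rpredZ 2^-1).
  by rewrite scalerA mulVf ?pnatr_eq0 // scale1r.
have aI : inj a \in I.
  rewrite inj_double_bracket rpredZ // rpred_sum // => k _; apply: idI.
  by rewrite br_inj prjK inj_scale rpredZ.
have d0 : (a *m a^T) 0 0 != 0.
  rewrite qfE mxE eqxx mulr1n; apply: contra_neq a0 => q0.
  by apply: rV3P; rewrite mxE; apply/eqP; rewrite -sqrf_eq0; apply/eqP;
    move: q0; rewrite /qf; have := sqr_ge0 (a 0 o0); have := sqr_ge0 (a 0 o1);
    have := sqr_ge0 (a 0 o2); lra.
(* The decomposition of w across and along a, from (a x w) x a = (a . a) w - (a . w) a. *)
have -> : w = ((a *m a^T) 0 0)^-1 *: (cross (cross a w) a + (a *m w^T) 0 0 *: a).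
  move: d0; rewrite ![(_ *m _) _ _]mxE !sum3 ![_^T _ _]mxE => d0.
  by apply: rV3P; rewrite !crossE !mxE /=; field.
by rewrite inj_scale rpredZ // addrC inj_lin rpredD // rpredZ.
Qed.

(** If the projection of Y were nonzero, the ideal would contain the factor, which is perfect and
    hence stays in every term of the derived series. *)
Lemma factor_not_solvable (I : {vspace 'rV[R]_n}) Y : lie_ideal so33_lie I -> Y \in I ->
  lie_solvable so33_lie I -> prj Y = 0.
Proof.
move=> idI YI [k Dk]; apply/eqP; apply: contraT => Y0.
have : inj (delta_mx 0 o0) \in iter k (derived_algebra so33_lie) I.
  move: (delta_mx _ _); elim: k {Dk} => [|k IH] w /=; first exact: factor_ideal idI YI Y0 w.
  exact: factor_derived.
rewrite Dk memv0 => /eqP e.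
have := prjK (delta_mx 0 o0); rewrite e -{1}inj0 prjK => /rowP /(_ o0) /eqP.
by rewrite !mxE eqxx eq_sym oner_eq0.
Qed.

End factor.

Lemma so33_semisimple : semisimple so33_lie.
Proof.
split; first exact: so33_connected.
move=> I idI sI; apply/eqP; rewrite -subv0; apply/subvP => Y YI; rewrite memv0.
have l0 : lsubmx Y = 0.
  apply: (@factor_not_solvable (fun v => row_mx v 0) lsubmx _ _ _ I) => //.
  - by move=> a v w; rewrite scale_row_mx add_row_mx scaler0 addr0.
  - by move=> v; rewrite row_mxKl.
  - by move=> v Z; rewrite so33_lie_bracket row_mxKl row_mxKr /cross hat0 trmx0 mulmx0 scaler0.
have r0 : rsubmx Y = 0.
  apply: (@factor_not_solvable (fun v => row_mx 0 v) rsubmx _ _ _ I) => //.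
  - by move=> a v w; rewrite scale_row_mx add_row_mx scaler0 addr0.
  - by move=> v; rewrite row_mxKr.
  - by move=> v Z; rewrite so33_lie_bracket row_mxKl row_mxKr /cross hat0 trmx0 mulmx0 scaler0.
by rewrite -[Y]hsubmxK l0 r0 row_mx0.
Qed.

End bracket.

(** * The holonomy representation *)

Section holonomy.
Context {R : realType}.
Local Notation G := (so33 R).
Local Notation so33_lie := (@so33_lie R).
Local Notation n := (3 + 3)%N.
Local Notation V := 'rV[R]_3.
Local Notation x0 := (tproj (0 : V)).
Local Notation Pi1 := (@pi1 R (@torus R 3) x0).

Definition parity (x : R) : bool := odd `|Num.floor x|%N.

Lemma parityD (x y : R) : x \is a Num.int -> y \is a Num.int ->
  parity (x + y) = parity x (+) parity y.
Proof.
move=> xi yi; rewrite /parity floorDzr //.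
move: (Num.floor x) (Num.floor y) => a b; lia.
Qed.

Definition holonomy (g : Pi1) : so33_lie :=
  (half_turn (parity (endp g 0 o0)) (parity (endp g 0 o1)),
   half_turn (parity (endp g 0 o0)) (parity (endp g 0 o1))).

Lemma holonomyM : {morph holonomy : g h / (g * h)%g}.
Proof.
move=> g h; have /latticeP lg := endp_lattice g; have /latticeP lh := endp_lattice h.
rewrite /holonomy endpM !mxE !parityD //.
by rewrite -half_turnM.
Qed.

HB.instance Definition _ := isMultiplicative.Build Pi1 so33_lie holonomy holonomyM.

Definition half_turn_sign (a b : bool) (k : 'I_3) : R :=
  nth 0 [:: (-1) ^+ a; (-1) ^+ b; (-1) ^+ (a (+) b)] k.

Definition chi (j : 'I_n) (g : Pi1) : R :=
  half_turn_sign (parity (endp g 0 o0)) (parity (endp g 0 o1))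
    (match fintype.split j with inl k => k | inr k => k end).

Lemma mul_half_turn a b (v : V) k :
  (v *m (val (half_turn a b))^T) 0 k = half_turn_sign a b k * v 0 k.
Proof.
rewrite mul_trE !half_turnE /half_turn_sign.
by move: k; apply: forall3; rewrite /= ?mulr0 ?mulr1 ?addr0 ?add0r mulrC.
Qed.

Lemma Ad_holonomy g (w : 'rV[R]_n) j : (w *m Ad_mx (holonomy g)) 0 j = chi j g * w 0 j.
Proof.
rewrite so33_Ad_mx mul_so33_Ad /chi; case: (splitP j) => k jk.
  rewrite (_ : j = lshift 3 k); last exact/val_inj.
  by rewrite row_mxEl mul_half_turn mxE.
rewrite (_ : j = rshift 3 k); last exact/val_inj.
by rewrite row_mxEr mul_half_turn mxE.
Qed.

Lemma Ad_holonomy_entry g i j : Ad_mx (holonomy g) i j = chi i g * (i == j)%:R.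
Proof.
have := Ad_holonomy g (delta_mx 0 i) j; rewrite -rowE !mxE eqxx /= => ->.
by rewrite eq_sym; case: eqP => [->|]; rewrite ?mulr0.
Qed.

Lemma Ad_holonomy1 : Ad_mx (holonomy 1%g) = 1%:M.
Proof.
apply/matrixP => i j; rewrite Ad_holonomy_entry mxE /chi endp1 !mxE /parity floor0 /=.
rewrite (_ : half_turn_sign _ _ _ = 1) ?mul1r //.
by move: (match _ with inl k => k | inr k => k end); apply: forall3.
Qed.

(** The order is reversed because matrices act on rows from the right; this makes [rho] a left
    action. *)
Lemma Ad_holonomyM g h :
  Ad_mx (holonomy (g * h)%g) = Ad_mx (holonomy h) *m Ad_mx (holonomy g).
Proof.
rewrite holonomyM !so33_Ad_mx /so33_Ad mulmx_block !mul0mx !mulmx0 !addr0 add0r.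
by rewrite /= !trmx_mul.
Qed.

Let rho := @Ad_rep R R 3 n (@torus_manifold R 3) x0 so33_lie holonomy.
Let rho2 := @Ad_tensor_rep R R 3 n (@torus_manifold R 3) x0 so33_lie holonomy.

Lemma rho1 w : rho 1%g w = w.
Proof. by rewrite /rho /Ad_rep Ad_holonomy1 mulmx1. Qed.

Lemma rhoM g h w : rho (g * h)%g w = rho g (rho h w).
Proof. by rewrite /rho /Ad_rep Ad_holonomyM mulmxA. Qed.

Lemma rho21 w : rho2 1%g w = w.
Proof. by rewrite /rho2 /Ad_tensor_rep Ad_holonomy1 trmx1 mulmx1 mul1mx. Qed.

Lemma rho2M g h w : rho2 (g * h)%g w = rho2 g (rho2 h w).
Proof. by rewrite /rho2 /Ad_tensor_rep Ad_holonomyM trmx_mul !mulmxA. Qed.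

Lemma rho2E g (w : 'M[R]_n) i j : rho2 g w i j = chi i g * chi j g * w i j.
Proof.
have A : Ad_mx (holonomy g) = diag_mx (\row_k chi k g).
  by apply/matrixP => k l; rewrite Ad_holonomy_entry !mxE mulr_natr.
by rewrite /rho2 /Ad_tensor_rep A tr_diag_mx mul_mx_diag mul_diag_mx !mxE mulrAC.
Qed.

(** The half-turns attached to the first two lattice generators have diagonals (-1, 1, -1) and (1,
    -1, -1), and each position holds a -1 in one of them. *)
Lemma chi_neg j : exists g, chi j g = -1.
Proof.
have [g0 e0] := endp_surj (@lattice_delta R 3 o0).
have [g1 e1] := endp_surj (@lattice_delta R 3 o1).
have p1 : parity (1 : R) = true by rewrite /parity floor1.
have p0 : parity (0 : R) = false by rewrite /parity floor0.
have s0 : half_turn_sign (parity (endp g0 0 o0)) (parity (endp g0 0 o1)) =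
    half_turn_sign true false by rewrite e0 !mxE /= p1 p0.
have s1 : half_turn_sign (parity (endp g1 0 o0)) (parity (endp g1 0 o1)) =
    half_turn_sign false true by rewrite e1 !mxE /= p1 p0.
have H k : half_turn_sign true false k = -1 \/ half_turn_sign false true k = -1.
  by move: k; apply: forall3; rewrite /half_turn_sign /=; [left | right | left].
rewrite /chi; move: (match _ with inl k => k | inr k => k end) => k.
by case: (H k) => Hk; [exists g0; rewrite s0 | exists g1; rewrite s1].
Qed.

Lemma rhoE g (w : 'rV[R]_n) j : rho g w 0 j = chi j g * w 0 j.
Proof. exact: Ad_holonomy. Qed.

Lemma holonomy_acyclic :
  @acyclic R R idfun 3 n (@torus_manifold R 3) x0 so33_lie holonomy.
Proof.
have g_ j := cid (chi_neg j).
have chi_g j := svalP (g_ j).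
move=> k _ omega fo co.
have oF := unroll_rolls rho1 fo.
have eF := unroll_equivariant rho1 rhoM fo.
have dF := (closed_formP oF).1 co.
case: k omega fo co oF eF dF => [|k] omega fo co oF eF dF.
  have := @exact_form0P R 3 _ rho omega (unroll omega) oF (closed0_eq0 rhoE chi_g eF dF).
  by [].
apply: (exact_formSP rho1 rhoM oF).2;
  exists (primitive (fun j => sval (g_ j)) (unroll omega)).
  by apply: (primitive_equivariant rhoE) eF.
exact: (dext_primitive rhoE chi_g eF dF).
Qed.

Lemma holonomy_minus :
  @cohomology_minus_neq0 R R idfun 3 n (@torus_manifold R 3) x0 so33_lie holonomy 2.
Proof.
(* The same axis in the two copies of so(3), hence two indices with the same character. *)
pose p : 'I_n := lshift 3 o0; pose q : 'I_n := rshift 3 o0.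
have pq : (p == q) = false by [].
pose Z : 'M[R]_n := delta_mx p q - delta_mx q p.
have Zpq : Z p q = 1 by rewrite !mxE !eqxx pq subr0.
have ZT : Z^T = - Z by rewrite /Z linearB /= !trmx_delta opprB.
have chipq g : chi p g = chi q g.
  rewrite /chi /p /q -[lshift 3 o0]/(unsplit (inl o0)) -[rshift 3 o0]/(unsplit (inr o0)).
  by rewrite !unsplitK.
have chi2 g : chi p g * chi q g = 1.
  rewrite -chipq /chi; case: (fintype.split p) => k;
    move: k; apply: forall3; rewrite /half_turn_sign /= -expr2 sqrr_sign //.
have rhoZ g a : rho2 g (a *: Z) = a *: Z.
  apply/matrixP => i j; rewrite rho2E [(_ *: Z) _ _]mxE [Z _ _]mxE !mxE.
  have [/andP[/eqP -> /eqP ->]|_] := boolP ((i == p) && (j == q)).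
    by rewrite chi2 mul1r.
  have [/andP[/eqP -> /eqP ->]|_] := boolP ((i == q) && (j == p)).
    by rewrite [chi q g * _]mulrC chi2 mul1r.
  by rewrite subr0 !mulr0.
pose F (_ : V) (v : 'M[R]_(2, 3)) := area o0 o1 v *: Z.
have eF : equivariant_form rho2 F := area_equivariant o0 o1 rhoZ.
have rho20 g : rho2 g 0 = 0 by have := rhoZ g 0; rewrite scale0r.
exists (roll F); split.
- exact: (roll_is_form rho2M eF).
- by apply/(closed_formP (@roll_rolls _ _ _ _ F)) => x v; exact: dext_cst.
(* As Z is skew, the swapped form is minus the form; their sum is the zero form, with primitive
   0. *)
- apply: (exact_formSP rho21 rho2M (F := fun _ _ => 0) _).2.
    by move=> s i y _ _ v; rewrite /swap_form /roll /F linearZ /= ZT scalerN addNr.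
  exists (fun _ _ => 0); first exact: zero_equivariant.
  by move=> x v; rewrite dext_cst.
- move/(exact_formSP rho21 rho2M (@roll_rolls _ _ _ _ F)).
  apply: (@area_not_exact R 3 n rho2 o0 o1 _ Z p q) => //.
  by move=> g w; rewrite rho2E chi2 mul1r.
Qed.

End holonomy.

Theorem proposition1 (R : realType) :
  exists (is_complex : bool) (M : closed_oriented_manifold R 3) (x0 : M)
    (n : nat) (G : lie_group (base_field R is_complex) n)
    (h : {multiplicative pi1 R x0 -> G}),
    [/\ semisimple G,
        acyclic (base_embedding R is_complex) h &
        cohomology_minus_neq0 (base_embedding R is_complex) h 2].
Proof.
exists false, (@torus_manifold R 3), (tproj 0), (3 + 3)%N, (@so33_lie R), (@holonomy R).
by split; [exact: so33_semisimple | exact: holonomy_acyclic | exact: holonomy_minus].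
Qed.
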